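(* Let $\Omega\subseteq\mathbb{C}$ be a simply connected domain, $h:\Omega\to\mathbb{C}$ a holomorphic function, $h\not\equiv0$, and $u:\Omega\to\mathbb{R}$ a $C^2$-solution to $\Delta u=4\,|h(z)|^2\,e^{2u}$ in $\Omega$. Then there exists a holomorphic function $f:\Omega\to\mathbb{D}$ such that $$u(z)=\log\left(\frac{|f'(z)|}{1-|f(z)|^2}\,\frac{1}{|h(z)|}\right),\qquad z\in\Omega .$$ Moreover, $f$ is uniquely determined up to postcomposition with a conformal automorphism of the unit disk; that is, if $g:\Omega\to\mathbb{D}$ is another holomorphic function satisfying this identity, then $g=T\circ f$ for some conformal automorphism $T$ of $\mathbb{D}$.
   Context: $\mathbb{D}=\{z\in\mathbb{C}:|z|<1\}$ and $\Delta=\partial^2/\partial x^2+\partial^2/\partial y^2$, $z=x+iy$. At zeros of $h$ the quotient $|f'(z)|/|h(z)|$ in the representation formula is understood via the continuous extension of $f'/h$ across the zeros of $h$ (so $f'/h$ extends to a zero-free holomorphic function on $\Omega$). *)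

(* Defs.v *)
From Stdlib Require Import Reals.
From Coquelicot Require Import Coquelicot.
Open Scope R_scope.

Definition maps_to {A B : Type} (f : A -> B) (X : A -> Prop) (Y : B -> Prop) : Prop :=
  forall x, X x -> Y (f x).

Definition unit_disk (z : C) : Prop := Cmod z < 1.

Definition unit_interval (t : R) : Prop := 0 <= t <= 1.

Definition unit_square (p : R * R) : Prop :=
  unit_interval (fst p) /\ unit_interval (snd p).

(** Functions on a subset of [C] are total functions of which only the values
    on that subset matter; the subsets below on which derivatives are taken
    are open. *)

Definition connected_set (X : C -> Prop) : Prop :=
  forall U V : C -> Prop,
    @open C_UniformSpace U -> @open C_UniformSpace V ->
    (forall z, X z -> U z \/ V z) ->
    (exists z, X z /\ U z) -> (exists z, X z /\ V z) ->
    exists z, X z /\ U z /\ V z.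

Definition domain (X : C -> Prop) : Prop :=
  (exists z, X z) /\ @open C_UniformSpace X /\ connected_set X.

Definition loop_in (X : C -> Prop) (gamma : R -> C) : Prop :=
  @continuous_on R_UniformSpace C_UniformSpace unit_interval gamma /\
  maps_to gamma unit_interval X /\
  gamma 0 = gamma 1.

(** In [H (s, t)], [s] is the deformation parameter and [t] the curve
    parameter; the base point is fixed during the deformation. *)
Definition null_homotopic_in (X : C -> Prop) (gamma : R -> C) : Prop :=
  exists H : R * R -> C,
    @continuous_on (prod_UniformSpace R_UniformSpace R_UniformSpace)
      C_UniformSpace unit_square H /\
    maps_to H unit_square X /\
    (forall t, unit_interval t -> H (0, t) = gamma t) /\
    (forall t, unit_interval t -> H (1, t) = gamma 0) /\
    (forall s, unit_interval s -> H (s, 0) = gamma 0 /\ H (s, 1) = gamma 0).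

Definition simply_connected_domain (X : C -> Prop) : Prop :=
  domain X /\ forall gamma, loop_in X gamma -> null_homotopic_in X gamma.

Definition holomorphic_on (X : C -> Prop) (f : C -> C) : Prop :=
  forall z, X z -> @ex_derive C_AbsRing C_NormedModule f z.

Definition disk_automorphism (T : C -> C) : Prop :=
  holomorphic_on unit_disk T /\ maps_to T unit_disk unit_disk /\
  exists S : C -> C,
    holomorphic_on unit_disk S /\ maps_to S unit_disk unit_disk /\
    forall z, unit_disk z -> S (T z) = z /\ T (S z) = z.

Definition partial_x (u : C -> R) (z : C) : R :=
  Derive (fun x => u (x, Im z)) (Re z).

Definition partial_y (u : C -> R) (z : C) : R :=
  Derive (fun y => u (Re z, y)) (Im z).

Definition C1_on (X : C -> Prop) (u : C -> R) : Prop :=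
  (forall z, X z ->
     ex_derive (fun x : R => u (x, Im z)) (Re z) /\
     ex_derive (fun y : R => u (Re z, y)) (Im z)) /\
  @continuous_on C_UniformSpace R_UniformSpace X (partial_x u) /\
  @continuous_on C_UniformSpace R_UniformSpace X (partial_y u).

Definition C2_on (X : C -> Prop) (u : C -> R) : Prop :=
  C1_on X u /\ C1_on X (partial_x u) /\ C1_on X (partial_y u).

Definition laplacian (u : C -> R) (z : C) : R :=
  partial_x (partial_x u) z + partial_y (partial_y u) z.

(** [q] is the continuous extension of [f' / h] across the zeros of [h] (unique
    when these are isolated).  As [ln] is total with value 0 outside the
    positive reals, [q] is required to be zero-free for the logarithm to be
    meaningful. *)
Definition liouville_representation
    (X : C -> Prop) (h : C -> C) (u : C -> R) (f q : C -> C) : Prop :=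
  @continuous_on C_UniformSpace C_UniformSpace X q /\
  (forall z, X z -> h z <> RtoC 0 -> q z = Cdiv (C_derive f z) (h z)) /\
  (forall z, X z ->
     q z <> RtoC 0 /\ u z = ln (Cmod (q z) / (1 - Cmod (f z) ^ 2))).

(* Main.v *)
(** Existence: put [a = - u_z] and [c = h e^u].  The system [A' = a A + c conj B],
    [B' = a B + c conj A] for holomorphic [A], [B] is integrable exactly because of the
    equation for [u], and its coefficients are regular at the zeros of [h].  Along a solution
    [e^u (|B|^2 - |A|^2)] is constant; normalising it to 1, [f = A / B] maps into the disk and
    [f' = h / B^2], so [q = 1 / B^2] is zero-free and [|q| / (1 - |f|^2) = e^u].  In terms of
    [A + B] and [A - B] the system splits into two equations [P' = a P +- c conj P], which are
    solved locally by Picard iteration and globally by continuation along paths, simple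
    connectedness ruling out monodromy.  That [h] has a continuous derivative is Goursat's
    theorem together with Cauchy's formula.

    Uniqueness: after composition with disk automorphisms, [F = f] and [G = g] vanish at a
    point where [h <> 0], with equal derivatives there.  The ratio [psi = G' / F'] satisfies
    [|psi| (1 - |F|^2) = 1 - |G|^2]; differentiating this turns [(G, psi)] into the solution of
    a first order system that [(F, 1)] solves as well, so [G = F] nearby by Gronwall, and
    everywhere by the identity theorem. *)

Require Import Defs.
From Stdlib Require Import Reals Lra Lia Psatz ClassicalEpsilon.
From Coquelicot Require Import Coquelicot.
Open Scope R_scope.

(** The classical route prescribes the Schwarzian derivative of [f], which has poles at the zeros of
    [h], where [f] might branch. The system for [A], [B] has no such points, at the price of
    conjugates: it is only real-linear. Since [a] and [c] are not holomorphic, asking for a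
    holomorphic [P] with [P' = a P + c conj P] is overdetermined. The condition is that the
    zbar-derivative of the right-hand side vanishes: [(a_zbar + |c|^2) P + (c_zbar + c conj a) conj
    P = 0]. The first bracket vanishes by the equation for [u], the second because [h] is
    holomorphic and [u] is real. Picard iteration along L-shaped paths ignores this condition, so it
    enters only afterwards, when the fixed point is shown to be holomorphic.

    Complex integrals and mean value estimates are reduced to real and imaginary parts, and balls of
    the plane are squares. Hence the factors 2 in most estimates; no constant is meant to be
    sharp. *)

Local Notation cder := (@is_derive C_AbsRing C_NormedModule).
Local Notation Ccont := (@continuous C_UniformSpace C_UniformSpace).
Local Notation Rcont := (@continuous R_UniformSpace C_UniformSpace).

(** * Moduli, and balls of the plane as open squares *)

Lemma Cmod_le_sum (z : C) : Cmod z <= Rabs (fst z) + Rabs (snd z).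
Proof.
  destruct z as [x y]; unfold Cmod; simpl.
  apply Rsqr_incr_0_var.
  - rewrite Rsqr_sqrt by nra. unfold Rsqr.
    assert (H1 := Rabs_pos x). assert (H2 := Rabs_pos y).
    assert (H3 : Rabs x * Rabs x = x * x) by (rewrite <- Rabs_mult; apply Rabs_pos_eq; nra).
    assert (H4 : Rabs y * Rabs y = y * y) by (rewrite <- Rabs_mult; apply Rabs_pos_eq; nra).
    nra.
  - apply Rplus_le_le_0_compat; apply Rabs_pos.
Qed.

Lemma Cmod_minus_sym (z w : C) : Cmod (z - w) = Cmod (w - z).
Proof. rewrite <- (Cmod_opp (z - w)); f_equal; ring. Qed.

Lemma Cmod_triangle_minus (z w : C) : Cmod (z - w) <= Cmod z + Cmod w.
Proof. unfold Cminus; rewrite <- (Cmod_opp w); apply Cmod_triangle. Qed.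

Lemma Cmod_sub_lower (z w : C) : Cmod z - Cmod w <= Cmod (z - w).
Proof.
  assert (H := Cmod_triangle (z - w) w).
  replace (z - w + w)%C with z in H by ring. lra.
Qed.

Lemma Cminus_0_eq (u v : C) : (u - v)%C = RtoC 0 -> u = v.
Proof.
  intro E. replace u with ((u - v) + v)%C by ring. rewrite E; ring.
Qed.

Lemma fst_le_Cmod (z : C) : Rabs (fst z) <= Cmod z.
Proof. apply re_le_Cmod. Qed.

Lemma snd_le_Cmod (z : C) : Rabs (snd z) <= Cmod z.
Proof. eapply Rle_trans; [apply Rmax_r | apply Rmax_Cmod]. Qed.

Lemma Cmod_diag (z : C) : Cmod (z - z) = 0.
Proof. rewrite <- Cmod_0; f_equal; ring. Qed.

Lemma RtoC_neq_0 (x : R) : x <> 0 -> RtoC x <> RtoC 0.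
Proof. intros H E; now apply (f_equal fst) in E. Qed.

Lemma pow2_pos (n : nat) : 0 < 2 ^ n.
Proof. apply pow_lt; lra. Qed.

Lemma Cmod_sqr (z : C) : Cmod z ^ 2 = fst z ^ 2 + snd z ^ 2.
Proof. rewrite Cmod2_alt; reflexivity. Qed.

(** The uniform structure on [C] is that of a product, so its balls are squares; passing to discs
    costs the factor 2 of [Cmod_of_Cball]. *)
Lemma Cball_iff (z w : C) (r : R) :
  ball z r w <-> Rabs (fst w - fst z) < r /\ Rabs (snd w - snd z) < r.
Proof. reflexivity. Qed.

Tactic Notation "cball" hyp(H) ident(H1) ident(H2) := destruct (proj1 (Cball_iff _ _ _) H) as [H1 H2]; cbn [fst snd] in H1, H2.

Lemma Cball_of_Cmod (z w : C) (r : R) : Cmod (w - z) < r -> ball z r w.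
Proof.
  intro H; apply Cball_iff; split.
  - eapply Rle_lt_trans; [|exact H]. exact (fst_le_Cmod (w - z)).
  - eapply Rle_lt_trans; [|exact H]. exact (snd_le_Cmod (w - z)).
Qed.

Lemma Cmod_of_Cball (z w : C) (r : R) : ball z r w -> Cmod (w - z) < 2 * r.
Proof.
  rewrite Cball_iff; intros [H1 H2]. eapply Rle_lt_trans; [apply Cmod_le_sum|].
  change (Rabs (fst w - fst z) + Rabs (snd w - snd z) < 2 * r). lra.
Qed.

Definition segment (z w : C) (t : R) : C := (z + RtoC t * (w - z))%C.

Lemma segment_0 z w : segment z w 0 = z.
Proof. unfold segment; ring. Qed.

Lemma segment_1 z w : segment z w 1 = w.
Proof. unfold segment; ring. Qed.

Definition convex_set (X : C -> Prop) : Prop :=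
  forall z w t, X z -> X w -> 0 <= t <= 1 -> X (segment z w t).

Lemma Rball_convex (x a b t r : R) : Rabs (a - x) < r -> Rabs (b - x) < r ->
  0 <= t <= 1 -> Rabs (a + t * (b - a) - x) < r.
Proof.
  intros Ha Hb [Ht0 Ht1]. apply Rabs_def2 in Ha as [Ha1 Ha2]. apply Rabs_def2 in Hb as [Hb1 Hb2].
  destruct (Rle_lt_or_eq_dec 0 t Ht0) as [Ht|<-]; [|apply Rabs_def1; lra].
  assert (A := Rmult_lt_compat_l t _ _ Ht Hb1). assert (B := Rmult_lt_compat_l t _ _ Ht Hb2).
  assert (A' := Rmult_le_compat_l (1 - t) _ _ ltac:(lra) (Rlt_le _ _ Ha1)).
  assert (B' := Rmult_le_compat_l (1 - t) _ _ ltac:(lra) (Rlt_le _ _ Ha2)).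
  apply Rabs_def1; lra.
Qed.

Lemma ball_convex (z : C) (r : R) : convex_set (ball z r).
Proof.
  intros a b t Ha Hb Ht. cball Ha H1 H2. cball Hb H3 H4.
  apply Cball_iff. unfold segment; simpl.
  split.
  - replace (fst a + (t * (fst b + - fst a) - 0 * (snd b + - snd a)) - fst z)
      with (fst a + t * (fst b - fst a) - fst z) by ring.
    now apply Rball_convex.
  - replace (snd a + (t * (snd b + - snd a) + 0 * (fst b + - fst a)) - snd z)
      with (snd a + t * (snd b - snd a) - snd z) by ring.
    now apply Rball_convex.
Qed.

Lemma convex_inter (X Y : C -> Prop) :
  convex_set X -> convex_set Y -> convex_set (fun z => X z /\ Y z).
Proof. intros HX HY z w t [] [] Ht; split; auto. Qed.

Lemma ball_open (z : C) (r : R) : @open C_UniformSpace (ball z r).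
Proof.
  intros w Hw. cball Hw H1 H2.
  set (d := Rmin (r - Rabs (fst w - fst z)) (r - Rabs (snd w - snd z))).
  assert (Hd : 0 < d).
  { unfold d; apply Rmin_glb_lt; apply Rlt_0_minus; assumption. }
  exists (mkposreal d Hd). intros y Hy. cball Hy H3 H4. simpl in H3, H4.
  change (Rabs (fst w - fst z) < r) in H1. change (Rabs (snd w - snd z) < r) in H2.
  change (Rabs (fst y - fst w) < d) in H3. change (Rabs (snd y - snd w) < d) in H4.
  assert (H5 := Rmin_l (r - Rabs (fst w - fst z)) (r - Rabs (snd w - snd z))).
  assert (H6 := Rmin_r (r - Rabs (fst w - fst z)) (r - Rabs (snd w - snd z))).
  fold d in H5, H6. assert (H5' := Rle_refl (Rabs (fst w - fst z))). assert (H6' := Rle_refl (Rabs (snd w - snd z))).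
  apply Rabs_def2 in H3 as [? ?]. apply Rabs_def2 in H4 as [? ?].
  apply Rabs_le_between in H5'. apply Rabs_le_between in H6'.
  apply Cball_iff; split; apply Rabs_def1; lra.
Qed.

Lemma open_ball_sub (X : C -> Prop) (z : C) : @open C_UniformSpace X -> X z ->
  exists r, 0 < r /\ forall w, ball z r w -> X w.
Proof.
  intros HX Hz. destruct (HX z Hz) as [e He]. exists e; split; [apply cond_pos | exact He].
Qed.

Lemma ball_Rmin {U : UniformSpace} (z w : U) (a b : R) :
  ball z (Rmin a b) w -> ball z a w /\ ball z b w.
Proof. split; (eapply ball_le; [|eassumption]); [apply Rmin_l | apply Rmin_r]. Qed.

Lemma ball_self {U : UniformSpace} (x : U) (r : R) : 0 < r -> ball x r x.
Proof. intro H; apply (ball_center x (mkposreal r H)). Qed.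

(** * Continuity of complex-valued maps *)

Lemma continuous_C_iff {U : UniformSpace} (f : U -> C) (x : U) :
  @continuous U C_UniformSpace f x <->
  continuous (fun y => fst (f y)) x /\ continuous (fun y => snd (f y)) x.
Proof.
  split.
  - intro H; split.
    + apply (@continuous_comp U C_UniformSpace R_UniformSpace f fst); auto.
      destruct (f x); apply continuous_fst.
    + apply (@continuous_comp U C_UniformSpace R_UniformSpace f snd); auto.
      destruct (f x); apply continuous_snd.
  - intros [H1 H2].
    intros P [e He].
    destruct (H1 (ball (fst (f x)) e)) as [d1 Hd1]; [now exists e|].
    destruct (H2 (ball (snd (f x)) e)) as [d2 Hd2]; [now exists e|].
    assert (Hd : 0 < Rmin d1 d2) by (apply Rmin_glb_lt; apply cond_pos).
    exists (mkposreal _ Hd). intros y Hy. apply He. split.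
    + apply Hd1. eapply ball_le; [|exact Hy]. apply Rmin_l.
    + apply Hd2. eapply ball_le; [|exact Hy]. apply Rmin_r.
Qed.

Section ContC.
Context {U : UniformSpace}.
Implicit Types (f g : U -> C) (x : U).
Notation cc := (@continuous U C_UniformSpace).

Lemma continuous_Cplus f g x : cc f x -> cc g x -> cc (fun y => f y + g y)%C x.
Proof.
  rewrite !continuous_C_iff; intros [] []; split.
  - now apply (continuous_plus (fun y => fst (f y)) (fun y => fst (g y))).
  - now apply (continuous_plus (fun y => snd (f y)) (fun y => snd (g y))).
Qed.

Lemma continuous_Cmult f g x : cc f x -> cc g x -> cc (fun y => f y * g y)%C x.
Proof.
  rewrite !continuous_C_iff; intros [] []; split.
  - apply (continuous_minus (fun y => fst (f y) * fst (g y)) (fun y => snd (f y) * snd (g y)));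
      apply (@continuous_mult U R_AbsRing); assumption.
  - apply (continuous_plus (fun y => fst (f y) * snd (g y)) (fun y => snd (f y) * fst (g y)));
      apply (@continuous_mult U R_AbsRing); assumption.
Qed.

Lemma continuous_Copp f x : cc f x -> cc (fun y => - f y)%C x.
Proof.
  rewrite !continuous_C_iff; intros []; split.
  - now apply (continuous_opp (fun y => fst (f y))).
  - now apply (continuous_opp (fun y => snd (f y))).
Qed.

Lemma continuous_Cminus f g x : cc f x -> cc g x -> cc (fun y => f y - g y)%C x.
Proof. intros; apply continuous_Cplus; auto using continuous_Copp. Qed.

Lemma continuous_Cconj f x : cc f x -> cc (fun y => Cconj (f y)) x.
Proof.
  rewrite !continuous_C_iff; intros []; split; simpl; auto.
  now apply (continuous_opp (fun y => snd (f y))).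
Qed.

Lemma continuous_RtoC (f : U -> R) x :
  continuous f x -> cc (fun y => RtoC (f y)) x.
Proof. rewrite continuous_C_iff; split; simpl; auto. apply continuous_const. Qed.

Lemma continuous_pairC (f g : U -> R) x :
  continuous f x -> continuous g x -> cc (fun y => (f y, g y)) x.
Proof. rewrite continuous_C_iff; split; auto. Qed.

Lemma continuous_fst_C f x : cc f x -> continuous (fun y => fst (f y)) x.
Proof. now rewrite continuous_C_iff. Qed.

Lemma continuous_snd_C f x : cc f x -> continuous (fun y => snd (f y)) x.
Proof. now rewrite continuous_C_iff. Qed.

Lemma continuous_Cinv f x : cc f x -> f x <> RtoC 0 -> cc (fun y => / f y)%C x.
Proof.
  rewrite !continuous_C_iff; intros [H1 H2] H0.
  assert (Hc : continuous (fun y => / (fst (f y) ^ 2 + snd (f y) ^ 2)) x).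
  { apply (continuous_comp (fun y => fst (f y) ^ 2 + snd (f y) ^ 2) Rinv).
    - apply (continuous_plus (fun y => fst (f y) ^ 2) (fun y => snd (f y) ^ 2)); simpl.
      + apply (@continuous_mult U R_AbsRing); auto.
        apply (@continuous_mult U R_AbsRing); auto; apply continuous_const.
      + apply (@continuous_mult U R_AbsRing); auto.
        apply (@continuous_mult U R_AbsRing); auto; apply continuous_const.
    - apply continuous_Rinv. intro E; apply H0. destruct (f x) as [a b]; simpl in *.
      apply injective_projections; simpl; nra. }
  split; simpl.
  - apply (@continuous_mult U R_AbsRing); auto.
  - apply (@continuous_mult U R_AbsRing); auto.
    now apply (continuous_opp (fun y => snd (f y))).
Qed.

Lemma continuous_Cmod f x : cc f x -> continuous (fun y => Cmod (f y)) x.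
Proof.
  rewrite !continuous_C_iff; intros [H1 H2].
  unfold Cmod. apply (continuous_comp (fun y => fst (f y) ^ 2 + snd (f y) ^ 2) sqrt); [|apply continuous_sqrt].
  apply (continuous_plus (fun y => fst (f y) ^ 2) (fun y => snd (f y) ^ 2)); simpl;
    apply (@continuous_mult U R_AbsRing); auto;
    apply (@continuous_mult U R_AbsRing); auto; apply continuous_const.
Qed.

Lemma continuous_Ccomp (f : C -> C) (g : U -> C) x : cc g x ->
  @continuous C_UniformSpace C_UniformSpace f (g x) -> cc (fun y => f (g y)) x.
Proof. intros; now apply (@continuous_comp U C_UniformSpace C_UniformSpace g f). Qed.
End ContC.

Ltac ccont := match goal with
  | |- continuous (fun y => (@?f y + @?g y)%C) ?x => apply (continuous_Cplus f g x); ccont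
  | |- continuous (fun y => (@?f y - @?g y)%C) ?x => apply (continuous_Cminus f g x); ccont
  | |- continuous (fun y => (@?f y * @?g y)%C) ?x => apply (continuous_Cmult f g x); ccont
  | |- continuous (fun y => Cconj (@?f y)) ?x => apply (continuous_Cconj f x); ccont
  | |- continuous (fun _ => ?k) _ => apply continuous_const
  | _ => auto
  end.

Lemma continuous_C_eps {U : UniformSpace} (f : U -> C) (x : U) :
  @continuous U C_UniformSpace f x ->
  forall e, 0 < e -> exists d, 0 < d /\ forall y, ball x d y -> Cmod (f y - f x) < e.
Proof.
  intros H e He.
  destruct (H (ball (f x) (e / 2))) as [d Hd].
  { exists (mkposreal (e / 2) ltac:(lra)). auto. }
  exists d; split; [apply cond_pos|]. intros y Hy.
  apply Hd in Hy. apply Cmod_of_Cball in Hy. lra.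
Qed.

Lemma continuous_of_C_eps {U : UniformSpace} (f : U -> C) (x : U) :
  (forall e, 0 < e -> exists d, 0 < d /\ forall y, ball x d y -> Cmod (f y - f x) < e) ->
  @continuous U C_UniformSpace f x.
Proof.
  intros H P [e He].
  destruct (H e (cond_pos e)) as [d [Hd0 Hd]].
  exists (mkposreal d Hd0). intros y Hy. apply He, Cball_of_Cmod, Hd, Hy.
Qed.

Lemma continuous_to_pair {U : UniformSpace} (f : C -> C) (g h : U -> R) (x : U) :
  continuous g x -> continuous h x ->
  @continuous C_UniformSpace C_UniformSpace f (g x, h x) ->
  @continuous U C_UniformSpace (fun y => f (g y, h y)) x.
Proof.
  intros Hg Hh Hf.
  apply (@continuous_comp U C_UniformSpace C_UniformSpace (fun y => (g y, h y)) f); auto.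
  now apply continuous_pairC.
Qed.

(** * Complex derivatives *)

Section ComplexDerivative.
Implicit Types (f g : C -> C) (z w l m : C).

Lemma cder_eps (f : C -> C) (z l : C) : cder f z l <->
  forall e, 0 < e -> exists d, 0 < d /\
    forall w, ball z d w -> Cmod (f w - f z - (w - z) * l) <= e * Cmod (w - z).
Proof.
  assert (N1 : forall u : C, @norm C_AbsRing C_NormedModule u = Cmod u) by reflexivity.
  assert (N2 : forall u : C, @norm C_AbsRing (AbsRing_NormedModule C_AbsRing) u = Cmod u) by reflexivity.
  split.
  - intros [_ H] e He.
    destruct (H z (fun P HP => HP) (mkposreal e He)) as [d Hd].
    (* [is_derive] takes its limit over discs, while [ball] is a square; half the radius fits the
       square into the disc. *)
    exists (d / 2); split; [apply is_pos_div_2|].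
    intros w Hw. apply Cmod_of_Cball in Hw.
    apply (Hd w). change (Cmod (w - z) < d). lra.
  - intro H; split.
    + apply is_linear_scal_l.
    + intros y Hy e.
      apply (@is_filter_lim_locally_unique C_AbsRing (AbsRing_NormedModule C_AbsRing)) in Hy; subst y.
      destruct (H e (cond_pos e)) as [d [Hd0 Hd]].
      exists (mkposreal d Hd0). intros w Hw.
      apply (Hd w). apply Cball_of_Cmod. exact Hw.
Qed.

Lemma cder_cont f z l : cder f z l -> @continuous C_UniformSpace C_UniformSpace f z.
Proof.
  intro H. assert (Hc := @ex_derive_continuous C_AbsRing C_NormedModule f z (ex_intro _ l H)).
  apply continuous_of_C_eps. intros e He.
  destruct (Hc (ball (f z) (e / 2))) as [d Hd].
  { exists (mkposreal (e / 2) ltac:(lra)). auto. }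
  exists (d / 2). split; [apply is_pos_div_2|]. intros y Hy. apply Cmod_of_Cball in Hy.
  assert (B : ball (f z) (e / 2) (f y)).
  { apply Hd. change (Cmod (y - z) < d). lra. }
  apply Cmod_of_Cball in B. lra.
Qed.

Lemma cder_ext_loc (f g : C -> C) (z l : C) (r : R) : 0 < r ->
  (forall w, ball z r w -> f w = g w) -> cder f z l -> cder g z l.
Proof.
  intros Hr E H. rewrite cder_eps in H |- *.
  intros e He. destruct (H e He) as [d [Hd0 Hd]].
  exists (Rmin d r); split; [now apply Rmin_glb_lt|].
  intros w Hw. apply ball_Rmin in Hw as [Hw1 Hw2].
  rewrite <- E, <- (E z); auto.
  now apply ball_self.
Qed.

Lemma cder_const (c z : C) : cder (fun _ => c) z (RtoC 0).
Proof. exact (@is_derive_const C_AbsRing C_NormedModule c z). Qed.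

Lemma cder_id (z : C) : cder (fun w => w) z (RtoC 1).
Proof.
  apply cder_eps; intros e He; exists 1; split; [lra|]; intros w _.
  replace (w - z - (w - z) * RtoC 1)%C with (RtoC 0) by ring.
  rewrite Cmod_0. apply Rmult_le_pos; [lra|apply Cmod_ge_0].
Qed.

Lemma cder_plus f g z l m : cder f z l -> cder g z m ->
  cder (fun w => f w + g w)%C z (l + m)%C.
Proof. exact (@is_derive_plus C_AbsRing C_NormedModule f g z l m). Qed.

Lemma cder_eq f z l m : cder f z l -> l = m -> cder f z m.
Proof. now intros H <-. Qed.

(* [C_NormedModule] and [AbsRing_NormedModule C_AbsRing] have the same norm but different uniform
   structures, while Coquelicot states the product and chain rules for the latter. *)
Lemma cder_AbsRing f z l :
  cder f z l <-> @is_derive C_AbsRing (AbsRing_NormedModule C_AbsRing) f z l.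
Proof. split; intros [_ H]; (split; [apply is_linear_scal_l|exact H]). Qed.

Lemma cder_mult f g z l m : cder f z l -> cder g z m ->
  cder (fun w => f w * g w)%C z (l * g z + f z * m)%C.
Proof.
  intros Hf Hg. apply cder_AbsRing in Hf, Hg. apply cder_AbsRing.
  exact (@is_derive_mult C_AbsRing f g z l m Hf Hg Cmult_comm).
Qed.

Lemma cder_minus f g z l m : cder f z l -> cder g z m ->
  cder (fun w => f w - g w)%C z (l - m)%C.
Proof. exact (@is_derive_minus C_AbsRing C_NormedModule f g z l m). Qed.

Lemma cder_inv_id (z : C) : z <> RtoC 0 -> cder Cinv z (- / (z * z))%C.
Proof.
  intro Hz. apply cder_eps. intros e He.
  assert (Hm : 0 < Cmod z) by now apply Cmod_gt_0.
  set (m := Cmod z) in *.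
  (* The remainder is [(w - z)^2 / (w z^2)]. The bound [m / 4] keeps [|w| >= m / 2], and [e m^3 / 8]
     then makes the remainder at most [e / 2] times [|w - z|]. *)
  set (d := Rmin (m / 4) (e * m ^ 3 / 8)).
  assert (Hd : 0 < d).
  { apply Rmin_glb_lt; [lra|]. assert (0 < m ^ 3) by (apply pow_lt; auto).
    apply Rdiv_lt_0_compat; [nra|lra]. }
  exists d; split; auto. intros w Hw. apply Cmod_of_Cball in Hw.
  assert (D1 : d <= m / 4) by apply Rmin_l.
  assert (D2 : d <= e * m ^ 3 / 8) by apply Rmin_r.
  assert (Hw1 : m / 2 <= Cmod w).
  { assert (T := Cmod_sub_lower z w). rewrite Cmod_minus_sym in T. fold m in T. lra. }
  assert (Hw0 : w <> RtoC 0) by (apply Cmod_gt_0; lra).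
  replace (/ w - / z - (w - z) * - / (z * z))%C
    with ((w - z) * ((w - z) * (/ w * (/ z * / z))))%C by (field; auto).
  rewrite !Cmod_mult, !Cmod_inv by auto. fold m.
  rewrite Rmult_comm. apply Rmult_le_compat_r; [apply Cmod_ge_0|].
  assert (I1 : / Cmod w <= 2 / m).
  { replace (2 / m) with (/ (m / 2)) by (field; lra). apply Rinv_le_contravar; lra. }
  assert (I0 : 0 < / m) by now apply Rinv_0_lt_compat.
  assert (P := Cmod_ge_0 (w - z)).
  assert (I2 : 0 < / Cmod w) by (apply Rinv_0_lt_compat; lra).
  apply Rle_trans with (2 * d * (2 / m * (/ m * / m))).
  - apply Rmult_le_compat; auto; [|lra|].
    + apply Rmult_le_pos; [lra|]. nra.
    + apply Rmult_le_compat_r; [nra|auto].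
  - apply Rle_trans with (2 * (e * m ^ 3 / 8) * (2 / m * (/ m * / m))).
    + apply Rmult_le_compat_r; [|lra]. apply Rmult_le_pos; [|nra].
      apply Rdiv_le_0_compat; lra.
    + apply Rle_trans with (e / 2); [right; field; lra | lra].
Qed.

Lemma cder_comp f g z l m : cder f (g z) l -> cder g z m ->
  cder (fun w => f (g w)) z (l * m)%C.
Proof.
  intros Hf Hg. apply cder_AbsRing in Hg. rewrite Cmult_comm. exact (@is_derive_comp C_AbsRing C_NormedModule f g z l m Hf Hg).
Qed.

Lemma cder_inv f z l : cder f z l -> f z <> RtoC 0 ->
  cder (fun w => / f w)%C z (- l / (f z * f z))%C.
Proof.
  intros H H0.
  eapply cder_eq; [apply (cder_comp Cinv f); [now apply cder_inv_id|exact H]|].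
  field; auto.
Qed.

Lemma cder_div f g z l m : cder f z l -> cder g z m -> g z <> RtoC 0 ->
  cder (fun w => f w / g w)%C z ((l * g z - f z * m) / (g z * g z))%C.
Proof.
  intros Hf Hg H0.
  eapply cder_eq; [apply cder_mult; [exact Hf|apply cder_inv; eauto]|].
  simpl. field; auto.
Qed.

Lemma cder_scal (c : C) f z l : cder f z l -> cder (fun w => c * f w)%C z (c * l)%C.
Proof.
  intro H. eapply cder_eq; [apply cder_mult; [apply cder_const|exact H]|].
  simpl; ring.
Qed.

End ComplexDerivative.

(** * Derivatives of curves in the plane *)

Section CurveDerivative.
Implicit Types (f g : R -> C) (s t : R) (z w l m : C).

(** Componentwise, so that the real mean value theorem and the real fundamental theorem of calculus
    apply directly. *)
Definition rder (f : R -> C) (t : R) (l : C) : Prop :=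
  is_derive (fun s => fst (f s)) t (fst l) /\ is_derive (fun s => snd (f s)) t (snd l).

Lemma is_derive_eps (f : R -> R) (x l : R) : is_derive f x l <->
  forall e, 0 < e -> exists d, 0 < d /\
    forall y, Rabs (y - x) < d -> Rabs (f y - f x - (y - x) * l) <= e * Rabs (y - x).
Proof.
  split.
  - intros [_ H] e He.
    destruct (H x (fun P HP => HP) (mkposreal e He)) as [d Hd].
    exists d; split; [apply cond_pos|]. intros y Hy. apply (Hd y). exact Hy.
  - intro H; split; [apply is_linear_scal_l|].
    intros y Hy e. apply (@is_filter_lim_locally_unique R_AbsRing (AbsRing_NormedModule R_AbsRing)) in Hy; subst y.
    destruct (H e (cond_pos e)) as [d [Hd0 Hd]].
    exists (mkposreal d Hd0). intros w Hw. apply (Hd w Hw).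
Qed.

Lemma rder_eps (f : R -> C) (t : R) (l : C) : rder f t l <->
  forall e, 0 < e -> exists d, 0 < d /\
    forall s, Rabs (s - t) < d ->
      Cmod (f s - f t - RtoC (s - t) * l) <= e * Rabs (s - t).
Proof.
  unfold rder; rewrite !is_derive_eps. split.
  - intros [H1 H2] e He.
    destruct (H1 (e / 2) ltac:(lra)) as [d1 [Hd1 K1]].
    destruct (H2 (e / 2) ltac:(lra)) as [d2 [Hd2 K2]].
    exists (Rmin d1 d2); split; [now apply Rmin_glb_lt|].
    intros s Hs.
    specialize (K1 s (Rlt_le_trans _ _ _ Hs (Rmin_l _ _))).
    specialize (K2 s (Rlt_le_trans _ _ _ Hs (Rmin_r _ _))).
    eapply Rle_trans; [apply Cmod_le_sum|]. simpl.
    replace (fst (f s) + - fst (f t) + - ((s - t) * fst l - 0 * snd l))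
      with (fst (f s) - fst (f t) - (s - t) * fst l) by ring.
    replace (snd (f s) + - snd (f t) + - ((s - t) * snd l + 0 * fst l))
      with (snd (f s) - snd (f t) - (s - t) * snd l) by ring.
    lra.
  - intro H; split; intros e He; destruct (H e He) as [d [Hd0 Hd]]; exists d; split; auto;
      intros s Hs; specialize (Hd s Hs); (eapply Rle_trans; [|exact Hd]).
    + eapply Rle_trans; [|apply fst_le_Cmod]. simpl. right; f_equal; ring.
    + eapply Rle_trans; [|apply snd_le_Cmod]. simpl. right; f_equal; ring.
Qed.

Lemma rder_cont f t l : rder f t l -> @continuous R_UniformSpace C_UniformSpace f t.
Proof.
  intros [H1 H2]. apply continuous_C_iff. split; apply (@ex_derive_continuous R_AbsRing R_NormedModule); eexists; eauto.
Qed.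

Lemma rder_eq f t l m : rder f t l -> l = m -> rder f t m.
Proof. now intros H <-. Qed.

Lemma rder_ext_loc (f g : R -> C) (t : R) (l : C) (r : R) : 0 < r ->
  (forall s, Rabs (s - t) < r -> f s = g s) -> rder f t l -> rder g t l.
Proof.
  intros Hr E [H1 H2]. split.
  - eapply (@is_derive_ext_loc R_AbsRing R_NormedModule); [|exact H1].
    exists (mkposreal r Hr). intros s Hs. now rewrite E.
  - eapply (@is_derive_ext_loc R_AbsRing R_NormedModule); [|exact H2].
    exists (mkposreal r Hr). intros s Hs. now rewrite E.
Qed.

Lemma rder_const (c : C) (t : R) : rder (fun _ => c) t (RtoC 0).
Proof. split; apply (@is_derive_const R_AbsRing R_NormedModule). Qed.

Lemma rder_plus f g t l m : rder f t l -> rder g t m ->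
  rder (fun s => f s + g s)%C t (l + m)%C.
Proof. intros [] []; split; now apply (@is_derive_plus R_AbsRing R_NormedModule). Qed.

Lemma rder_opp f t l : rder f t l -> rder (fun s => - f s)%C t (- l)%C.
Proof. intros []; split; now apply (@is_derive_opp R_AbsRing R_NormedModule). Qed.

Lemma rder_minus f g t l m : rder f t l -> rder g t m ->
  rder (fun s => f s - g s)%C t (l - m)%C.
Proof. intros; apply rder_plus; auto using rder_opp. Qed.

Lemma rder_conj f t l : rder f t l -> rder (fun s => Cconj (f s)) t (Cconj l).
Proof. intros []; split; auto. simpl. now apply (@is_derive_opp R_AbsRing R_NormedModule). Qed.

Lemma is_derive_Rconst (c t : R) : is_derive (fun _ : R => c) t 0.
Proof. exact (@is_derive_const R_AbsRing R_NormedModule c t). Qed.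

Lemma is_derive_Rid (t : R) : is_derive (fun s : R => s) t 1.
Proof. exact (@is_derive_id R_AbsRing t). Qed.

Lemma is_derive_Rmult (f g : R -> R) (t l m : R) : is_derive f t l -> is_derive g t m ->
  is_derive (fun s => f s * g s) t (l * g t + f t * m).
Proof. intros; apply (@is_derive_mult R_AbsRing); auto. intros; apply Rmult_comm. Qed.

Lemma rder_mult f g t l m : rder f t l -> rder g t m ->
  rder (fun s => f s * g s)%C t (l * g t + f t * m)%C.
Proof.
  intros [] []; split; simpl.
  - replace (fst l * fst (g t) - snd l * snd (g t) + (fst (f t) * fst m - snd (f t) * snd m))
      with ((fst l * fst (g t) + fst (f t) * fst m) - (snd l * snd (g t) + snd (f t) * snd m)) by ring.
    apply (@is_derive_minus R_AbsRing R_NormedModule (fun s => fst (f s) * fst (g s))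
      (fun s => snd (f s) * snd (g s))); now apply is_derive_Rmult.
  - replace (fst l * snd (g t) + snd l * fst (g t) + (fst (f t) * snd m + snd (f t) * fst m))
      with ((fst l * snd (g t) + fst (f t) * snd m) + (snd l * fst (g t) + snd (f t) * fst m)) by ring.
    apply (@is_derive_plus R_AbsRing R_NormedModule (fun s => fst (f s) * snd (g s))
      (fun s => snd (f s) * fst (g s))); now apply is_derive_Rmult.
Qed.

Lemma rder_RtoC (f : R -> R) (t l : R) : is_derive f t l -> rder (fun s => RtoC (f s)) t (RtoC l).
Proof. intro H; split; [exact H|exact (is_derive_Rconst 0 t)]. Qed.

(** Mixed chain rule: the inner derivative is real, the outer one complex. It lets holomorphic
    functions be studied along segments, circles and coordinate lines. *)
Lemma rder_comp_cder (f : C -> C) (g : R -> C) t l m : cder f (g t) l -> rder g t m ->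
  rder (fun s => f (g s)) t (l * m)%C.
Proof.
  intros Hf Hg. assert (Cg := rder_cont _ _ _ Hg). rewrite rder_eps in Hg |- *. rewrite cder_eps in Hf.
  intros e He. assert (A1 := Cmod_ge_0 m). assert (A2 := Cmod_ge_0 l).
  (* With [e1 <= 1] the curve satisfies [|g s - g t| <= (1 + |m|) |s - t|], so the two errors add up
     to at most [e1 (1 + |m| + |l|) |s - t|]. *)
  set (K := 2 + Cmod m + Cmod l). assert (HK : 0 < K) by (unfold K; lra).
  set (e1 := Rmin (e / K) 1).
  assert (He1 : 0 < e1) by (apply Rmin_glb_lt; [apply Rdiv_lt_0_compat; lra|lra]).
  assert (He1' : e1 * K <= e).
  { apply Rle_trans with (e / K * K); [apply Rmult_le_compat_r; [lra|apply Rmin_l]|right; field; lra]. }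
  assert (He1'' : e1 <= 1) by apply Rmin_r.
  destruct (Hf e1 He1) as [d1 [Hd1 H1]]. destruct (Hg e1 He1) as [d2 [Hd2 H2]].
  destruct (continuous_C_eps _ _ Cg d1 Hd1) as [d3 [Hd3 H3]].
  exists (Rmin d2 d3); split; [now apply Rmin_glb_lt|]. intros s Hs.
  specialize (H2 s (Rlt_le_trans _ _ _ Hs (Rmin_l _ _))).
  specialize (H1 _ (Cball_of_Cmod _ _ _ (H3 s (Rlt_le_trans _ _ _ Hs (Rmin_r _ _))))).
  assert (P := Rabs_pos (s - t)).
  assert (Hgw : Cmod (g s - g t) <= (1 + Cmod m) * Rabs (s - t)).
  { replace (g s - g t)%C with ((g s - g t - RtoC (s - t) * m) + RtoC (s - t) * m)%C by ring.
    eapply Rle_trans; [apply Cmod_triangle|]. rewrite Cmod_mult, Cmod_R. nra. }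
  replace (f (g s) - f (g t) - RtoC (s - t) * (l * m))%C
    with ((f (g s) - f (g t) - (g s - g t) * l) + l * (g s - g t - RtoC (s - t) * m))%C by ring.
  eapply Rle_trans; [apply Cmod_triangle|]. rewrite Cmod_mult.
  assert (Q1 := Rmult_le_compat_l e1 _ _ ltac:(lra) Hgw). assert (Q2 := Rmult_le_compat_l _ _ _ A2 H2).
  assert (Q3 := Rmult_le_pos _ _ (Rlt_le _ _ He1) P).
  apply Rle_trans with (e1 * K * Rabs (s - t)); [unfold K; lra|]. apply Rmult_le_compat_r; auto.
Qed.

Lemma rder_segment z w t : rder (segment z w) t (w - z)%C.
Proof.
  unfold segment. eapply rder_eq.
  - apply rder_plus; [apply rder_const|]. apply rder_mult; [|apply rder_const].
    exact (rder_RtoC _ _ _ (is_derive_Rid t)).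
  - simpl. ring.
Qed.

Lemma rder_segment_cder (f : C -> C) z w t l : cder f (segment z w t) l ->
  rder (fun s => f (segment z w s)) t (l * (w - z))%C.
Proof. intro H. apply rder_comp_cder; auto. apply rder_segment. Qed.

Lemma rder_horizontal (f : C -> C) x y l : cder f (x, y) l -> rder (fun s => f (s, y)) x l.
Proof.
  intro H. eapply rder_eq.
  - apply (rder_comp_cder f (fun s => (s, y))); [exact H|].
    instantiate (1 := (1, 0)). split; [exact (is_derive_Rid x)|exact (is_derive_Rconst y x)].
  - apply injective_projections; simpl; ring.
Qed.

Lemma rder_vertical (f : C -> C) x y l : cder f (x, y) l -> rder (fun s => f (x, s)) y (Ci * l)%C.
Proof.
  intro H. eapply rder_eq.
  - apply (rder_comp_cder f (fun s => (x, s))); [exact H|].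
    instantiate (1 := (0, 1)). split; [exact (is_derive_Rconst x y)|exact (is_derive_Rid y)].
  - apply injective_projections; simpl; ring.
Qed.

Lemma rder_unique f t l m : rder f t l -> rder f t m -> l = m.
Proof.
  intros [A B] [A' B']. apply injective_projections.
  - apply is_derive_unique in A, A'. congruence.
  - apply is_derive_unique in B, B'. congruence.
Qed.

Lemma cder_unique (f : C -> C) z l m : cder f z l -> cder f z m -> l = m.
Proof.
  destruct z as [x y]; intros H1 H2. eapply rder_unique; eapply rder_horizontal; eauto.
Qed.

(** The mean value theorem gives a different intermediate point for each component, and the sum of
    the two estimates produces the factor 2. *)
Lemma rder_bound (f f' : R -> C) (a b M : R) :
  (forall t, Rmin a b <= t <= Rmax a b -> rder f t (f' t)) ->
  (forall t, Rmin a b <= t <= Rmax a b -> Cmod (f' t) <= M) ->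
  Cmod (f b - f a) <= 2 * M * Rabs (b - a).
Proof.
  intros D B.
  destruct (MVT_gen (fun t => fst (f t)) a b (fun t => fst (f' t))) as [c [Hc Ec]].
  { intros x Hx; apply D; lra. }
  { intros x Hx. apply derivable_continuous_pt. exists (fst (f' x)). now apply is_derive_Reals, D. }
  destruct (MVT_gen (fun t => snd (f t)) a b (fun t => snd (f' t))) as [d [Hd Ed]].
  { intros x Hx; apply D; lra. }
  { intros x Hx. apply derivable_continuous_pt. exists (snd (f' x)). now apply is_derive_Reals, D. }
  eapply Rle_trans; [apply Cmod_le_sum|].
  change (Rabs (fst (f b) - fst (f a)) + Rabs (snd (f b) - snd (f a)) <= 2 * M * Rabs (b - a)).
  rewrite Ec, Ed, !Rabs_mult.
  assert (B1 := Rle_trans _ _ _ (fst_le_Cmod _) (B c Hc)).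
  assert (B2 := Rle_trans _ _ _ (snd_le_Cmod _) (B d Hd)).
  assert (P := Rabs_pos (b - a)). nra.
Qed.

Lemma rder_zero_const (f : R -> C) (a b : R) :
  (forall t, Rmin a b <= t <= Rmax a b -> rder f t (RtoC 0)) -> f a = f b.
Proof.
  intro D. assert (H := rder_bound f (fun _ => RtoC 0) a b 0 D).
  assert (H0 : Cmod (f b - f a) <= 0).
  { replace 0 with (2 * 0 * Rabs (b - a)) by ring. apply H. intros; rewrite Cmod_0; lra. }
  assert (H1 : (f b - f a)%C = RtoC 0) by (apply Cmod_eq_0; apply Rle_antisym; auto; apply Cmod_ge_0).
  replace (f b) with ((f b - f a) + f a)%C by ring. rewrite H1; ring.
Qed.

End CurveDerivative.

(** * Integrals of curves *)

Definition CInt (f : R -> C) (a b : R) : C :=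
  (RInt (fun t => fst (f t)) a b, RInt (fun t => snd (f t)) a b).

(** Independent of the order of the endpoints, since integrals start at a base point and may run in
    either direction. *)
Definition between (a b t : R) : Prop := Rmin a b <= t <= Rmax a b.

Lemma between_iff a b t : between a b t <-> (a <= t <= b \/ b <= t <= a).
Proof. unfold between, Rmin, Rmax; destruct (Rle_dec a b); split; intros; lra. Qed.

Lemma between_l a b : between a b a.
Proof. apply between_iff; lra. Qed.

Lemma between_r a b : between a b b.
Proof. apply between_iff; lra. Qed.

(** The advantage of square balls: L-shaped paths between two of their points never leave them. *)
Lemma ball_box (z0 b w p : C) (d : R) : ball z0 d b -> ball z0 d w ->
  between (fst b) (fst w) (fst p) -> between (snd b) (snd w) (snd p) -> ball z0 d p.
Proof.
  intros Hb Hw H1 H2. cball Hb B1 B2. cball Hw W1 W2. apply between_iff in H1, H2.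
  apply Rabs_def2 in B1 as [? ?]. apply Rabs_def2 in B2 as [? ?].
  apply Rabs_def2 in W1 as [? ?]. apply Rabs_def2 in W2 as [? ?].
  apply Cball_iff; split; apply Rabs_def1; lra.
Qed.

Definition cont_between (f : R -> C) (a b : R) : Prop :=
  forall t, between a b t -> Rcont f t.

Section CurveIntegral.
Implicit Types (f g : R -> C) (a b c t : R).

Lemma ex_RInt_fst f a b : cont_between f a b -> ex_RInt (fun t => fst (f t)) a b.
Proof. intro H; apply (@ex_RInt_continuous R_CompleteNormedModule); intros t Ht; now apply continuous_fst_C, H. Qed.

Lemma ex_RInt_snd f a b : cont_between f a b -> ex_RInt (fun t => snd (f t)) a b.
Proof. intro H; apply (@ex_RInt_continuous R_CompleteNormedModule); intros t Ht; now apply continuous_snd_C, H. Qed.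

Hint Resolve ex_RInt_fst ex_RInt_snd : core.

Lemma CInt_ext f g a b : (forall t, between a b t -> f t = g t) -> CInt f a b = CInt g a b.
Proof.
  intro E; unfold CInt; f_equal; apply RInt_ext; intros t Ht;
    rewrite E; auto; unfold between; lra.
Qed.

Lemma CInt_point f a : CInt f a a = RtoC 0.
Proof. unfold CInt; now rewrite !RInt_point. Qed.

Lemma CInt_swap f a b : cont_between f a b -> CInt f b a = (- CInt f a b)%C.
Proof.
  intro H; unfold CInt.
  rewrite <- (opp_RInt_swap (fun t => fst (f t)) a b), <- (opp_RInt_swap (fun t => snd (f t)) a b); auto.
Qed.

Lemma CInt_Chasles f a b c : cont_between f a b -> cont_between f b c ->
  (CInt f a b + CInt f b c)%C = CInt f a c.
Proof.
  intros H1 H2. unfold CInt.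
  rewrite <- (RInt_Chasles (fun t => fst (f t)) a b c), <- (RInt_Chasles (fun t => snd (f t)) a b c); auto.
Qed.

Lemma CInt_plus f g a b : cont_between f a b -> cont_between g a b ->
  CInt (fun t => f t + g t)%C a b = (CInt f a b + CInt g a b)%C.
Proof.
  intros H1 H2. unfold CInt.
  apply injective_projections.
  - apply (@RInt_plus R_CompleteNormedModule (fun t => fst (f t)) (fun t => fst (g t))); auto.
  - apply (@RInt_plus R_CompleteNormedModule (fun t => snd (f t)) (fun t => snd (g t))); auto.
Qed.

Lemma cont_between_mult f g a b : cont_between f a b -> cont_between g a b ->
  cont_between (fun t => f t * g t)%C a b.
Proof. intros H1 H2 t Ht; apply continuous_Cmult; auto. Qed.

Lemma cont_between_minus f g a b : cont_between f a b -> cont_between g a b ->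
  cont_between (fun t => f t - g t)%C a b.
Proof. intros H1 H2 t Ht; apply continuous_Cminus; auto. Qed.

Lemma cont_between_const (k : C) a b : cont_between (fun _ => k) a b.
Proof. intros t Ht; apply continuous_const. Qed.

Lemma CInt_scal (k : C) f a b : cont_between f a b ->
  CInt (fun t => k * f t)%C a b = (k * CInt f a b)%C.
Proof.
  intros H. unfold CInt. apply injective_projections; simpl.
  - assert (E1 := @RInt_scal R_CompleteNormedModule (fun t => fst (f t)) a b (fst k) (ex_RInt_fst _ _ _ H)).
    assert (E2 := @RInt_scal R_CompleteNormedModule (fun t => snd (f t)) a b (snd k) (ex_RInt_snd _ _ _ H)).
    assert (E := @RInt_minus R_CompleteNormedModule (fun t => fst k * fst (f t)) (fun t => snd k * snd (f t)) a b
      (@ex_RInt_scal R_NormedModule _ _ _ _ (ex_RInt_fst _ _ _ H))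
      (@ex_RInt_scal R_NormedModule _ _ _ _ (ex_RInt_snd _ _ _ H))).
    etransitivity; [exact E|]. apply f_equal2; [exact E1|exact E2].
  - assert (E1 := @RInt_scal R_CompleteNormedModule (fun t => snd (f t)) a b (fst k) (ex_RInt_snd _ _ _ H)).
    assert (E2 := @RInt_scal R_CompleteNormedModule (fun t => fst (f t)) a b (snd k) (ex_RInt_fst _ _ _ H)).
    assert (E := @RInt_plus R_CompleteNormedModule (fun t => fst k * snd (f t)) (fun t => snd k * fst (f t)) a b
      (@ex_RInt_scal R_NormedModule _ _ _ _ (ex_RInt_snd _ _ _ H))
      (@ex_RInt_scal R_NormedModule _ _ _ _ (ex_RInt_fst _ _ _ H))).
    etransitivity; [exact E|]. apply f_equal2; [exact E1|exact E2].
Qed.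

Lemma CInt_opp f a b : cont_between f a b -> CInt (fun t => - f t)%C a b = (- CInt f a b)%C.
Proof.
  intro H. rewrite (CInt_ext _ (fun t => (RtoC (-1)) * f t)%C), CInt_scal by
    (auto || (intros; apply injective_projections; simpl; ring)).
  apply injective_projections; simpl; ring.
Qed.

Lemma CInt_minus f g a b : cont_between f a b -> cont_between g a b ->
  CInt (fun t => f t - g t)%C a b = (CInt f a b - CInt g a b)%C.
Proof.
  intros H1 H2. unfold Cminus. rewrite CInt_plus, CInt_opp; auto.
  intros t Ht; apply (@continuous_Copp R_UniformSpace); auto.
Qed.

Lemma CInt_const (k : C) a b : CInt (fun _ => k) a b = (RtoC (b - a) * k)%C.
Proof.
  unfold CInt; rewrite !RInt_const. apply injective_projections; simpl;
   unfold scal; simpl; unfold mult; simpl; ring.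
Qed.

Lemma RInt_abs_bound (f : R -> R) (a b M : R) : ex_RInt f a b ->
  (forall t, between a b t -> Rabs (f t) <= M) -> Rabs (RInt f a b) <= M * Rabs (b - a).
Proof.
  intros E H. destruct (Rle_dec a b) as [L|L].
  - rewrite (Rabs_pos_eq (b - a)), Rmult_comm by lra.
    apply abs_RInt_le_const; auto. intros t Ht; apply H.
    unfold between; now rewrite Rmin_left, Rmax_right.
  - rewrite <- opp_RInt_swap by (now apply ex_RInt_swap).
    change (Rabs (- RInt f b a) <= M * Rabs (b - a)).
    rewrite Rabs_Ropp, (Rabs_left (b - a)), Rmult_comm by lra.
    replace (- (b - a)) with (a - b) by ring.
    apply abs_RInt_le_const; [lra|now apply ex_RInt_swap|]. intros t Ht; apply H.
    unfold between; rewrite Rmin_right, Rmax_left; lra.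
Qed.

Lemma CInt_bound f a b M : cont_between f a b ->
  (forall t, between a b t -> Cmod (f t) <= M) -> Cmod (CInt f a b) <= 2 * M * Rabs (b - a).
Proof.
  intros H B. eapply Rle_trans; [apply Cmod_le_sum|]. unfold CInt; simpl.
  assert (H1 := RInt_abs_bound (fun t => fst (f t)) a b M (ex_RInt_fst _ _ _ H)
    (fun t Ht => Rle_trans _ _ _ (fst_le_Cmod _) (B t Ht))).
  assert (H2 := RInt_abs_bound (fun t => snd (f t)) a b M (ex_RInt_snd _ _ _ H)
    (fun t Ht => Rle_trans _ _ _ (snd_le_Cmod _) (B t Ht))).
  lra.
Qed.

Lemma CInt_derive (F : R -> C) f a b : (forall t, between a b t -> rder F t (f t)) ->
  cont_between f a b -> CInt f a b = (F b - F a)%C.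
Proof.
  intros D H. unfold CInt. apply injective_projections; simpl.
  - apply is_RInt_unique.
    apply (is_RInt_derive (fun t => fst (F t)) (fun t => fst (f t))); intros t Ht.
    + apply D, Ht.
    + now apply continuous_fst_C, H.
  - apply is_RInt_unique.
    apply (is_RInt_derive (fun t => snd (F t)) (fun t => snd (f t))); intros t Ht.
    + apply D, Ht.
    + now apply continuous_snd_C, H.
Qed.

(** The margin [r] beyond both endpoints is there because the derivative at [b] is two-sided. *)
Lemma rder_CInt f a b r : 0 < r ->
  (forall t, Rmin a b - r < t < Rmax a b + r -> Rcont f t) ->
  rder (fun x => CInt f a x) b (f b).
Proof.
  intros Hr H.
  assert (E : forall x, Rabs (x - b) < r -> cont_between f a x).
  { intros x Hx t Ht. apply H. apply Rabs_def2 in Hx as [X1 X2].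
    unfold between, Rmin, Rmax in *.
    destruct (Rle_dec a x); destruct (Rle_dec a b); lra. }
  assert (Hb : Rcont f b).
  { apply H. unfold Rmin, Rmax; destruct (Rle_dec a b); lra. }
  split; simpl.
  - apply (is_derive_RInt (fun t => fst (f t)) _ a).
    + exists (mkposreal r Hr). intros x Hx. apply (@RInt_correct R_CompleteNormedModule), ex_RInt_fst, E, Hx.
    + now apply continuous_fst_C.
  - apply (is_derive_RInt (fun t => snd (f t)) _ a).
    + exists (mkposreal r Hr). intros x Hx. apply (@RInt_correct R_CompleteNormedModule), ex_RInt_snd, E, Hx.
    + now apply continuous_snd_C.
Qed.

Lemma is_derive_RInt_param_at (f f' : R -> R -> R) (a b x0 r : R) : 0 < r ->
  (forall x t, Rabs (x - x0) < r -> Rmin a b - r < t < Rmax a b + r ->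
     is_derive (fun y => f y t) x (f' x t) /\ continuous (fun t => f x t) t) ->
  (forall t, between a b t -> continuous (fun p : R * R => f' (fst p) (snd p)) (x0, t)) ->
  is_derive (fun x => RInt (fun t => f x t) a b) x0 (RInt (fun t => f' x0 t) a b).
Proof.
  intros Hr D H.
  replace (RInt (fun t => f' x0 t) a b) with (RInt (fun t => Derive (fun u => f u t) x0) a b).
  - apply is_derive_RInt_param.
    + exists (mkposreal r Hr). intros x Hx t Ht. exists (f' x t). apply D; auto; lra.
    + intros t Ht.
      apply (continuity_2d_pt_ext_loc f').
      * exists (mkposreal r Hr). simpl. intros x s Hx Hs. symmetry. apply is_derive_unique, D; auto.
        apply Rabs_def2 in Hs; lra.
      * apply continuity_2d_pt_filterlim. apply H, Ht.
    + exists (mkposreal r Hr). intros x Hx. apply (@ex_RInt_continuous R_CompleteNormedModule). intros t Ht. apply D; auto; lra.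
  - apply RInt_ext. intros t Ht. apply is_derive_unique, D; [rewrite Rminus_diag, Rabs_R0; auto|lra].
Qed.

Lemma rder_CInt_param (F F' : R -> R -> C) (a b x0 r : R) : 0 < r ->
  (forall x t, Rabs (x - x0) < r -> Rmin a b - r < t < Rmax a b + r ->
     rder (fun y => F y t) x (F' x t) /\ Rcont (fun t => F x t) t) ->
  (forall t, between a b t -> Ccont (fun p => F' (fst p) (snd p)) (x0, t)) ->
  rder (fun x => CInt (fun t => F x t) a b) x0 (CInt (fun t => F' x0 t) a b).
Proof.
  intros Hr D H. split; simpl.
  - apply (is_derive_RInt_param_at (fun x t => fst (F x t)) (fun x t => fst (F' x t)) _ _ _ r); auto.
    + intros x t Hx Ht; destruct (D x t Hx Ht) as [[D1 D2] Hc]; split; auto.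
      now apply continuous_fst_C.
    + intros t Ht. apply (@continuous_fst_C C_UniformSpace (fun p => F' (fst p) (snd p))); auto.
  - apply (is_derive_RInt_param_at (fun x t => snd (F x t)) (fun x t => snd (F' x t)) _ _ _ r); auto.
    + intros x t Hx Ht; destruct (D x t Hx Ht) as [[D1 D2] Hc]; split; auto.
      now apply continuous_snd_C.
    + intros t Ht. apply (@continuous_snd_C C_UniformSpace (fun p => F' (fst p) (snd p))); auto.
Qed.

(** Cauchy-Riemann equations with continuous [W]. Once the linear part is subtracted, each leg of
    the L-shaped path from [z] to [w] contributes at most [2 * (e / 4)] times its length, by
    [rder_bound]. *)
Lemma cder_of_partials (F W : C -> C) (z : C) (r : R) : 0 < r ->
  (forall w, ball z r w -> rder (fun s => F (s, snd w)) (fst w) (W w) /\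
                           rder (fun s => F (fst w, s)) (snd w) (Ci * W w)%C) ->
  Ccont W z -> cder F z (W z).
Proof.
  intros Hr D H. apply cder_eps. intros e He.
  destruct (continuous_C_eps _ _ H (e / 4) ltac:(lra)) as [d [Hd K]].
  exists (Rmin r d); split; [now apply Rmin_glb_lt|].
  intros w Hw. destruct z as [x0 y0]; destruct w as [x y].
  assert (B : forall s t, between x0 x s -> between y0 y t ->
    ball ((x0, y0) : C) r ((s, t) : C) /\ ball ((x0, y0) : C) d ((s, t) : C)).
  { intros s t Hs Ht. apply ball_Rmin, (ball_box (x0, y0) (x0, y0) (x, y)); auto.
    apply ball_self; now apply Rmin_glb_lt. }
  assert (E1 : Cmod ((F (x, y) - RtoC x * W (x0, y0)) - (F (x0, y) - RtoC x0 * W (x0, y0)))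
     <= 2 * (e / 4) * Rabs (x - x0)).
  { apply (rder_bound (fun s => F (s, y) - RtoC s * W (x0, y0))%C
       (fun s => W (s, y) - W (x0, y0))%C).
    - intros s Hs. destruct (B s y Hs (between_r y0 y)) as [Q _].
      destruct (D _ Q) as [D1 _]. simpl in D1.
      apply rder_minus; [exact D1|]. eapply rder_eq.
      + apply rder_mult; [apply rder_RtoC, is_derive_Rid|apply rder_const].
      + simpl; ring.
    - intros s Hs. destruct (B s y Hs (between_r y0 y)) as [_ Q].
      apply Rlt_le, K, Q. }
  assert (E2 : Cmod ((F (x0, y) - RtoC y * (Ci * W (x0, y0))) - (F (x0, y0) - RtoC y0 * (Ci * W (x0, y0))))
     <= 2 * (e / 4) * Rabs (y - y0)).
  { apply (rder_bound (fun s => F (x0, s) - RtoC s * (Ci * W (x0, y0)))%C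
       (fun s => Ci * W (x0, s) - Ci * W (x0, y0))%C).
    - intros s Hs. destruct (B x0 s (between_l x0 x) Hs) as [Q _].
      destruct (D _ Q) as [_ D1]. simpl in D1.
      apply rder_minus; [exact D1|]. eapply rder_eq.
      + apply rder_mult; [apply rder_RtoC, is_derive_Rid|apply rder_const].
      + simpl; ring.
    - intros s Hs. destruct (B x0 s (between_l x0 x) Hs) as [_ Q].
      replace (Ci * W (x0, s) - Ci * W (x0, y0))%C with (Ci * (W (x0, s) - W (x0, y0)))%C by ring.
      rewrite Cmod_mult, Cmod_Ci, Rmult_1_l. apply Rlt_le, K, Q. }
  assert (X1 := fst_le_Cmod ((x, y) - (x0, y0))%C). assert (Y1 := snd_le_Cmod ((x, y) - (x0, y0))%C).
  change (Rabs (x - x0) <= Cmod ((x, y) - (x0, y0))) in X1.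
  change (Rabs (y - y0) <= Cmod ((x, y) - (x0, y0))) in Y1.
  replace (F (x, y) - F (x0, y0) - ((x, y) - (x0, y0)) * W (x0, y0))%C with
   (((F (x, y) - RtoC x * W (x0, y0)) - (F (x0, y) - RtoC x0 * W (x0, y0))) +
    ((F (x0, y) - RtoC y * (Ci * W (x0, y0))) - (F (x0, y0) - RtoC y0 * (Ci * W (x0, y0)))))%C
   by (apply injective_projections; simpl; ring).
  eapply Rle_trans; [apply Cmod_triangle|].
  nra.
Qed.
End CurveIntegral.

(** * Goursat's theorem *)

Definition in_rect (a b c d : R) (z : C) : Prop := a <= fst z <= b /\ c <= snd z <= d.

Definition rect_int (F : C -> C) (a b c d : R) : C :=
  (CInt (fun x => F (x, c)) a b + Ci * CInt (fun y => F (b, y)) c d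
   - CInt (fun x => F (x, d)) a b - Ci * CInt (fun y => F (a, y)) c d)%C.

Definition cont_rect (F : C -> C) (a b c d : R) : Prop := forall z, in_rect a b c d z -> Ccont F z.

Lemma continuous_horizontal (F : C -> C) x y : Ccont F (x, y) -> Rcont (fun s => F (s, y)) x.
Proof.
  intro H. apply (continuous_to_pair F (fun s => s) (fun _ => y)); auto.
  apply continuous_id. apply continuous_const.
Qed.

Lemma continuous_vertical (F : C -> C) x y : Ccont F (x, y) -> Rcont (fun s => F (x, s)) y.
Proof.
  intro H. apply (continuous_to_pair F (fun _ => x) (fun s => s)); auto.
  apply continuous_const. apply continuous_id.
Qed.

Section Rect.
Implicit Types (F G : C -> C) (a b c d : R).

Lemma between_le a b t : a <= b -> between a b t -> a <= t <= b.
Proof. unfold between; intro H; now rewrite Rmin_left, Rmax_right. Qed.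

Lemma cont_side_h F a b c d y a' b' : cont_rect F a b c d -> c <= y <= d ->
  a <= a' <= b -> a <= b' <= b -> cont_between (fun x => F (x, y)) a' b'.
Proof.
  intros H Hy Ha Hb t Ht. apply continuous_horizontal, H. split; simpl; auto.
  unfold between, Rmin, Rmax in Ht; destruct (Rle_dec a' b'); lra.
Qed.

Lemma cont_side_v F a b c d x c' d' : cont_rect F a b c d -> a <= x <= b ->
  c <= c' <= d -> c <= d' <= d -> cont_between (fun y => F (x, y)) c' d'.
Proof.
  intros H Hy Ha Hb t Ht. apply continuous_vertical, H. split; simpl; auto.
  unfold between, Rmin, Rmax in Ht; destruct (Rle_dec c' d'); lra.
Qed.

Lemma rect_int_split F a b c d m n : cont_rect F a b c d -> a <= m <= b -> c <= n <= d ->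
  rect_int F a b c d =
  (rect_int F a m c n + rect_int F m b c n + rect_int F a m n d + rect_int F m b n d)%C.
Proof.
  intros H Hm Hn. unfold rect_int.
  rewrite <- (CInt_Chasles (fun x => F (x, c)) a m b) by (eapply cont_side_h; eauto; lra).
  rewrite <- (CInt_Chasles (fun x => F (x, d)) a m b) by (eapply cont_side_h; eauto; lra).
  rewrite <- (CInt_Chasles (fun y => F (a, y)) c n d) by (eapply cont_side_v; eauto; lra).
  rewrite <- (CInt_Chasles (fun y => F (b, y)) c n d) by (eapply cont_side_v; eauto; lra).
  ring.
Qed.

Lemma rect_int_minus F G a b c d : cont_rect F a b c d -> cont_rect G a b c d -> a <= b -> c <= d ->
  rect_int (fun z => F z - G z)%C a b c d = (rect_int F a b c d - rect_int G a b c d)%C.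
Proof.
  intros H1 H2 Hab Hcd. unfold rect_int.
  rewrite !CInt_minus by (first [eapply cont_side_h | eapply cont_side_v]; eauto; lra).
  ring.
Qed.

Lemma rect_int_primitive (P : C -> C) F a b c d : cont_rect F a b c d -> a <= b -> c <= d ->
  (forall z, in_rect a b c d z -> cder P z (F z)) -> rect_int F a b c d = RtoC 0.
Proof.
  intros H Hab Hcd D. unfold rect_int.
  assert (V : forall x, a <= x <= b -> (Ci * CInt (fun y => F (x, y)) c d)%C = (P (x, d) - P (x, c))%C).
  { intros x Hx. rewrite <- CInt_scal by (eapply cont_side_v; eauto; lra).
    apply (CInt_derive (fun y => P (x, y))).
    - intros t Ht. apply between_le in Ht; auto. apply rder_vertical, D. split; auto.
    - apply cont_between_mult; [apply cont_between_const|eapply cont_side_v; eauto; lra]. }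
  assert (U : forall y, c <= y <= d -> CInt (fun x => F (x, y)) a b = (P (b, y) - P (a, y))%C).
  { intros y Hy. apply (CInt_derive (fun x => P (x, y))).
    - intros t Ht. apply between_le in Ht; auto. apply rder_horizontal, D. split; auto.
    - eapply cont_side_h; eauto; lra. }
  rewrite !V, !U by lra. ring.
Qed.

Lemma rect_int_bound F a b c d M : cont_rect F a b c d -> a <= b -> c <= d ->
  (forall z, in_rect a b c d z -> Cmod (F z) <= M) ->
  Cmod (rect_int F a b c d) <= 4 * M * ((b - a) + (d - c)).
Proof.
  intros H Hab Hcd B. unfold rect_int.
  assert (V : forall x, a <= x <= b -> Cmod (Ci * CInt (fun y => F (x, y)) c d)%C <= 2 * M * (d - c)).
  { intros x Hx. rewrite Cmod_mult, Cmod_Ci, Rmult_1_l. rewrite <- (Rabs_pos_eq (d - c)) by lra.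
    apply CInt_bound; [eapply cont_side_v; eauto; lra|].
    intros t Ht. apply between_le in Ht; auto. apply B; split; auto. }
  assert (U : forall y, c <= y <= d -> Cmod (CInt (fun x => F (x, y)) a b) <= 2 * M * (b - a)).
  { intros y Hy. rewrite <- (Rabs_pos_eq (b - a)) by lra.
    apply CInt_bound; [eapply cont_side_h; eauto; lra|].
    intros t Ht. apply between_le in Ht; auto. apply B; split; auto. }
  assert (V1 := V a ltac:(lra)). assert (V2 := V b ltac:(lra)).
  assert (U1 := U c ltac:(lra)). assert (U2 := U d ltac:(lra)).
  eapply Rle_trans; [apply Cmod_triangle_minus|].
  assert (T := Cmod_triangle_minus (CInt (fun x => F (x, c)) a b + Ci * CInt (fun y => F (b, y)) c d) (CInt (fun x => F (x, d)) a b)).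
  assert (T2 := Cmod_triangle (CInt (fun x => F (x, c)) a b) (Ci * CInt (fun y => F (b, y)) c d)).
  lra.
Qed.

(** Nested intervals, given by their left endpoints [u n] and lengths [w / 2^n]; the common point is
    the supremum of the left endpoints. *)
Lemma nested_lim (u : nat -> R) (w : R) : 0 <= w ->
  (forall n, u n <= u (S n) <= u n + w / 2 ^ S n) ->
  exists x, forall n, u n <= x <= u n + w / 2 ^ n.
Proof.
  intros Hw H.
  assert (M : forall n k, u n <= u (n + k)%nat).
  { intros n k; induction k as [|k IH]; [rewrite Nat.add_0_r; lra|].
    rewrite Nat.add_succ_r. specialize (H (n + k)%nat). lra. }
  assert (W : forall k, u (S k) + w / 2 ^ S k <= u k + w / 2 ^ k).
  { intro k. specialize (H k). assert (P2 := pow2_pos k).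
    replace (w / 2 ^ k) with (w / 2 ^ S k + w / 2 ^ S k) by (simpl; field; lra). lra. }
  assert (N : forall n k, u (n + k)%nat + w / 2 ^ (n + k) <= u n + w / 2 ^ n).
  { intros n k; induction k as [|k IH]; [rewrite Nat.add_0_r; lra|].
    rewrite Nat.add_succ_r. specialize (W (n + k)%nat). lra. }
  assert (Q : forall k, 0 <= w / 2 ^ k).
  { intro k. apply Rdiv_le_0_compat; auto. apply pow_lt; lra. }
  assert (X : forall n m, u m <= u n + w / 2 ^ n).
  { intros n m. destruct (Nat.le_ge_cases n m) as [L|L].
    - replace m with (n + (m - n))%nat by lia.
      specialize (N n (m - n)%nat). specialize (Q (n + (m - n))%nat). lra.
    - replace n with (m + (n - m))%nat by lia. specialize (M m (n - m)%nat).
      specialize (Q (m + (n - m))%nat). lra. }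
  destruct (completeness (fun x => exists n, x = u n)) as [x [Hx1 Hx2]].
  - exists (u 0%nat + w / 2 ^ 0). intros y [n ->]. apply X.
  - exists (u 0%nat); now exists 0%nat.
  - exists x. intro n; split.
    + apply Hx1; now exists n.
    + apply Hx2. intros y [m ->]. apply X.
Qed.

Lemma pow2_small (w d : R) : 0 < d -> exists n, w / 2 ^ n < d.
Proof.
  intros Hd. destruct (INR_unbounded (w / d)) as [n Hn].
  exists n. assert (P : INR n < 2 ^ n).
  { clear. induction n; [simpl; lra|]. rewrite S_INR. simpl.
    assert (1 <= 2 ^ n) by (apply pow_R1_Rle; lra). lra. }
  assert (Q := pow2_pos n).
  apply (Rmult_lt_reg_r (2 ^ n)); auto.
  replace (w / 2 ^ n * 2 ^ n) with (w / d * d) by (field; lra).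
  nra.
Qed.

(** Bisection, by contradiction: some quarter of a violating rectangle violates the estimate scaled
    by 1/4. At the common point of all these rectangles [F] is affine up to a small error, and
    affine functions have primitives. *)
Lemma goursat_eps F a c w h e : 0 <= w -> 0 <= h -> 0 < e ->
  (forall z, in_rect a (a + w) c (c + h) z -> exists l, cder F z l) ->
  Cmod (rect_int F a (a + w) c (c + h)) <= e * (w + h) ^ 2.
Proof.
  intros Hw Hh He D.
  assert (Hc : cont_rect F a (a + w) c (c + h)).
  { intros z Hz. destruct (D z Hz) as [l Hl]. eapply cder_cont; eauto. }
  destruct (Rle_dec (Cmod (rect_int F a (a + w) c (c + h))) (e * (w + h) ^ 2)) as [L|L]; auto.
  exfalso. apply Rnot_le_lt in L.
  set (J := fun x y w h => Cmod (rect_int F x (x + w) y (y + h))).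
  (* [p] is the lower left corner of a rectangle of generation [n]; the threshold is [e] times the
     square of its half-perimeter. *)
  set (bad := fun (n : nat) (p : R * R) =>
    a <= fst p /\ fst p + w / 2 ^ n <= a + w /\ c <= snd p /\ snd p + h / 2 ^ n <= c + h /\
    e * (w + h) ^ 2 / 4 ^ n < J (fst p) (snd p) (w / 2 ^ n) (h / 2 ^ n)).
  assert (step : forall n p, bad n p -> exists q, bad (S n) q /\
     fst p <= fst q <= fst p + w / 2 ^ S n /\ snd p <= snd q <= snd p + h / 2 ^ S n).
  { intros n [p1 p2] (B1 & B2 & B3 & B4 & B5); simpl fst in *; simpl snd in *.
    assert (P2 := pow2_pos n).
    assert (P4 : 0 < 4 ^ n) by (apply pow_lt; lra).
    set (w' := w / 2 ^ S n) in *. set (h' := h / 2 ^ S n) in *.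
    assert (Ew : w / 2 ^ n = w' + w') by (unfold w'; simpl; field; lra).
    assert (Eh : h / 2 ^ n = h' + h') by (unfold h'; simpl; field; lra).
    assert (W0 : 0 <= w') by (apply Rdiv_le_0_compat; [auto|apply pow_lt; lra]).
    assert (H0 : 0 <= h') by (apply Rdiv_le_0_compat; [auto|apply pow_lt; lra]).
    rewrite Ew in B2, B5. rewrite Eh in B4, B5.
    set (K := e * (w + h) ^ 2 / 4 ^ S n).
    replace (e * (w + h) ^ 2 / 4 ^ n) with (4 * K) in B5 by (unfold K; simpl; field; lra).
    assert (Sum : J p1 p2 (w' + w') (h' + h') <=
      J p1 p2 w' h' + J (p1 + w') p2 w' h' + J p1 (p2 + h') w' h' + J (p1 + w') (p2 + h') w' h').
    { unfold J. rewrite (rect_int_split F _ _ _ _ (p1 + w') (p2 + h')); try lra.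
      2:{ intros z [Z1 Z2]; apply Hc; split; lra. }
      rewrite <- !Rplus_assoc.
      eapply Rle_trans; [apply Cmod_triangle|]. apply Rplus_le_compat_r.
      eapply Rle_trans; [apply Cmod_triangle|]. apply Rplus_le_compat_r. apply Cmod_triangle. }
    assert (Q : forall x y, p1 <= x <= p1 + w' -> p2 <= y <= p2 + h' -> K < J x y w' h' ->
      exists q, bad (S n) q /\ p1 <= fst q <= p1 + w' /\ p2 <= snd q <= p2 + h').
    { intros x y Hx Hy L1. exists (x, y). unfold bad; simpl fst; simpl snd; fold w' h' K; repeat split; lra. }
    destruct (Rlt_dec K (J p1 p2 w' h')) as [L1|L1]; [apply (Q p1 p2); lra|].
    destruct (Rlt_dec K (J (p1 + w') p2 w' h')) as [L2|L2]; [apply (Q (p1 + w') p2); lra|].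
    destruct (Rlt_dec K (J p1 (p2 + h') w' h')) as [L3|L3]; [apply (Q p1 (p2 + h')); lra|].
    apply (Q (p1 + w') (p2 + h')); lra. }
  assert (bad0 : bad 0%nat (a, c)).
  { unfold bad, J; simpl fst; simpl snd; simpl pow. rewrite !Rdiv_1_r. simpl pow in L. repeat split; lra. }
  (* Dependent choice: each corner carries its proof of [bad], from which the next one is
     selected. *)
  set (sq := fix sq (n : nat) : {p | bad n p} :=
    match n return {p | bad n p} with
    | O => exist _ (a, c) bad0
    | S k => let p := sq k in
        let q := constructive_indefinite_description _ (step k (proj1_sig p) (proj2_sig p)) in
        exist _ (proj1_sig q) (proj1 (proj2_sig q))
    end).
  assert (Hs : forall n, fst (proj1_sig (sq n)) <= fst (proj1_sig (sq (S n))) <= fst (proj1_sig (sq n)) + w / 2 ^ S n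
     /\ snd (proj1_sig (sq n)) <= snd (proj1_sig (sq (S n))) <= snd (proj1_sig (sq n)) + h / 2 ^ S n).
  { intro n. exact (proj2 (proj2_sig (constructive_indefinite_description _ (step n (proj1_sig (sq n)) (proj2_sig (sq n)))))). }
  destruct (nested_lim (fun n => fst (proj1_sig (sq n))) w Hw (fun n => proj1 (Hs n))) as [x Hx].
  destruct (nested_lim (fun n => snd (proj1_sig (sq n))) h Hh (fun n => proj2 (Hs n))) as [y Hy].
  assert (Hxy : in_rect a (a + w) c (c + h) (x, y)).
  { specialize (Hx 0%nat). specialize (Hy 0%nat). simpl in Hx, Hy. rewrite Rdiv_1_r in Hx, Hy. now split. }
  destruct (D _ Hxy) as [l Hl]. rewrite cder_eps in Hl.
  (* [rect_int_bound] contributes a factor 4, so [e / 16] leads to [e / 4] times the squared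
     half-perimeter, contradicting [bad]. *)
  destruct (Hl (e / 16) ltac:(lra)) as [d [Hd0 Hd]].
  destruct (pow2_small (w + h) d Hd0) as [n Hn].
  specialize (Hx n). specialize (Hy n). destruct (sq n) as [[p1 p2] Hp]. simpl in Hx, Hy.
  destruct Hp as (B1 & B2 & B3 & B4 & B5). unfold J in B5. simpl fst in *. simpl snd in *.
  assert (P2 := pow2_pos n).
  set (w' := w / 2 ^ n) in *. set (h' := h / 2 ^ n) in *.
  assert (W0 : 0 <= w') by (apply Rdiv_le_0_compat; [auto|apply pow_lt; lra]).
  assert (H0 : 0 <= h') by (apply Rdiv_le_0_compat; [auto|apply pow_lt; lra]).
  assert (E : (w + h) / 2 ^ n = w' + h') by (unfold w', h'; field; lra).
  assert (E4 : e * (w + h) ^ 2 / 4 ^ n = e * (w' + h') ^ 2).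
  { unfold w', h'. replace 4 with (2 * 2) by ring. rewrite Rpow_mult_distr. field. lra. }
  rewrite E in Hn. rewrite E4 in B5.
  (* First order Taylor polynomial of [F] at the common point, and below it a primitive, which makes
     its boundary integral vanish. *)
  set (A := fun z : C => (F (x, y) + (z - (x, y)) * l)%C).
  set (Pa := fun z : C => (F (x, y) * z + (RtoC (1/2) * ((z - (x, y)) * (z - (x, y)))) * l)%C).
  assert (DA : forall z, cder A z l).
  { intro z. unfold A. eapply cder_eq.
    - apply cder_plus; [apply cder_const|]. apply cder_mult; [|apply cder_const].
      apply cder_minus; [apply cder_id|apply cder_const].
    - simpl; ring. }
  assert (DP : forall z, cder Pa z (A z)).
  { intro z. unfold Pa. eapply cder_eq.
    - apply cder_plus; [apply cder_scal, cder_id|]. apply cder_mult; [|apply cder_const].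
      apply cder_scal. apply cder_mult; (apply cder_minus; [apply cder_id|apply cder_const]).
    - unfold A. apply injective_projections; simpl; field. }
  assert (CA : cont_rect A p1 (p1 + w') p2 (p2 + h')).
  { intros z _. eapply cder_cont, DA. }
  assert (CF : cont_rect F p1 (p1 + w') p2 (p2 + h')).
  { intros z [Z1 Z2]; apply Hc; split; lra. }
  assert (J0 := rect_int_primitive Pa A p1 (p1 + w') p2 (p2 + h') CA ltac:(lra) ltac:(lra) (fun z _ => DP z)).
  assert (J1 := rect_int_minus F A p1 (p1 + w') p2 (p2 + h') CF CA ltac:(lra) ltac:(lra)).
  assert (J2 : Cmod (rect_int (fun z => F z - A z)%C p1 (p1 + w') p2 (p2 + h'))
     <= 4 * (e / 16 * (w' + h')) * ((p1 + w' - p1) + (p2 + h' - p2))).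
  { apply rect_int_bound; try lra.
    - intros z Hz. apply continuous_Cminus; auto.
    - intros [z1 z2] [Z1 Z2]. simpl in Z1, Z2.
      replace (F (z1, z2) - A (z1, z2))%C with (F (z1, z2) - F (x, y) - ((z1, z2) - (x, y)) * l)%C by (unfold A; ring).
      assert (Bz : Cmod ((z1, z2) - (x, y)) <= w' + h').
      { eapply Rle_trans; [apply Cmod_le_sum|]. simpl.
        apply Rplus_le_compat; apply Rabs_le; lra. }
      eapply Rle_trans; [apply Hd|].
      + apply Cball_of_Cmod. lra.
      + apply Rmult_le_compat_l; lra. }
  rewrite J1, J0 in J2.
  replace (rect_int F p1 (p1 + w') p2 (p2 + h') - RtoC 0)%C with (rect_int F p1 (p1 + w') p2 (p2 + h')) in J2 by ring.
  assert (0 <= (w' + h') ^ 2) by apply pow2_ge_0.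
  nra.
Qed.

Lemma Cmod_small_0 (z : C) (K : R) : (forall e, 0 < e -> Cmod z <= e * K) -> z = RtoC 0.
Proof.
  intros H. apply Cmod_eq_0. apply Rle_antisym; [|apply Cmod_ge_0].
  apply Rnot_lt_le. intro L.
  assert (HK : 0 < K). { specialize (H 1 Rlt_0_1). lra. }
  specialize (H (Cmod z / (2 * K)) ltac:(apply Rdiv_lt_0_compat; lra)).
  replace (Cmod z / (2 * K) * K) with (Cmod z / 2) in H by (field; lra). lra.
Qed.

Lemma goursat F a b c d : a <= b -> c <= d ->
  (forall z, in_rect a b c d z -> exists l, cder F z l) -> rect_int F a b c d = RtoC 0.
Proof.
  intros Hab Hcd D. apply (Cmod_small_0 _ ((b - a + (d - c)) ^ 2)). intros e He.
  replace b with (a + (b - a)) in D |- * by ring. replace d with (c + (d - c)) in D |- * by ring.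
  replace (a + (b - a) - a) with (b - a) by ring. replace (c + (d - c) - c) with (d - c) by ring.
  apply goursat_eps; auto; lra.
Qed.
End Rect.

(** Reversing an orientation only changes the sign. All four cases occur, because primitives are
    built from the centre of a ball outwards. *)
Lemma goursat_oriented F a b c d :
  (forall z, between a b (fst z) -> between c d (snd z) -> exists l, cder F z l) ->
  rect_int F a b c d = RtoC 0.
Proof.
  intros D.
  assert (Hc : forall z, between a b (fst z) -> between c d (snd z) -> Ccont F z).
  { intros z H1 H2. destruct (D z H1 H2). eapply cder_cont; eauto. }
  assert (A : between a b a) by (apply between_iff; lra).
  assert (B : between a b b) by (apply between_iff; lra).
  assert (C1 : between c d c) by (apply between_iff; lra).
  assert (C2 : between c d d) by (apply between_iff; lra).
  assert (Sh : forall y, between c d y -> CInt (fun x => F (x, y)) b a = (- CInt (fun x => F (x, y)) a b)%C).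
  { intros y Hy. apply CInt_swap. intros t Ht. apply continuous_horizontal, Hc; auto. }
  assert (Sv : forall x, between a b x -> CInt (fun y => F (x, y)) d c = (- CInt (fun y => F (x, y)) c d)%C).
  { intros y Hy. apply CInt_swap. intros t Ht. apply continuous_vertical, Hc; auto. }
  destruct (Rle_dec a b) as [L|L]; destruct (Rle_dec c d) as [L'|L'].
  - apply goursat; auto. intros z [H1 H2]; apply D; apply between_iff; auto.
  - assert (G := goursat F a b d c L ltac:(lra)
      (fun z Hz => D z (proj2 (between_iff _ _ _) (or_introl (proj1 Hz))) (proj2 (between_iff _ _ _) (or_intror (proj2 Hz))))).
    unfold rect_int in *. rewrite (Sv a), (Sv b) in G by auto. 
    replace (RtoC 0) with (- RtoC 0)%C by ring. rewrite <- G. ring.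
  - assert (G := goursat F b a c d ltac:(lra) L'
      (fun z Hz => D z (proj2 (between_iff _ _ _) (or_intror (proj1 Hz))) (proj2 (between_iff _ _ _) (or_introl (proj2 Hz))))).
    unfold rect_int in *. rewrite (Sh c), (Sh d) in G by auto.
    replace (RtoC 0) with (- RtoC 0)%C by ring. rewrite <- G. ring.
  - assert (G := goursat F b a d c ltac:(lra) ltac:(lra)
      (fun z Hz => D z (proj2 (between_iff _ _ _) (or_intror (proj1 Hz))) (proj2 (between_iff _ _ _) (or_intror (proj2 Hz))))).
    unfold rect_int in *. rewrite (Sh c), (Sh d), (Sv a), (Sv b) in G by auto.
    rewrite <- G. ring.
Qed.

(** [P1] goes horizontally first and so has the right y-derivative; [P2] goes vertically first and
    has the right x-derivative. Goursat's theorem identifies them. *)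
Lemma holomorphic_primitive (F : C -> C) (z : C) (r : R) : 0 < r ->
  (forall w, ball z r w -> exists l, cder F w l) ->
  exists P, forall w, ball z r w -> cder P w (F w).
Proof.
  intros Hr D. destruct z as [x0 y0].
  assert (Hc : forall w, ball ((x0, y0) : C) r w -> Ccont F w).
  { intros w Hw. destruct (D w Hw). eapply cder_cont; eauto. }
  set (P1 := fun z : C => (CInt (fun s => F (s, y0)) x0 (fst z) + Ci * CInt (fun t => F (fst z, t)) y0 (snd z))%C).
  set (P2 := fun z : C => (Ci * CInt (fun t => F (x0, t)) y0 (snd z) + CInt (fun s => F (s, snd z)) x0 (fst z))%C).
  assert (E : forall w, ball ((x0, y0) : C) r w -> P1 w = P2 w).
  { intros [x y] Hw. cball Hw Hx Hy.
    assert (G := goursat_oriented F x0 x y0 y).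
    unfold rect_int in G. unfold P1, P2; simpl.
    match type of G with _ -> ?a = _ => assert (G' : a = RtoC 0) end.
    { apply G. intros [s t] Hs Ht; simpl in Hs, Ht. apply D, Cball_iff; simpl.
      apply between_iff in Hs, Ht. apply Rabs_def2 in Hx as [X1 X2]. apply Rabs_def2 in Hy as [Y1 Y2].
      split; apply Rabs_def1; lra. }
    match goal with |- ?a = ?b => replace a with (b + (a - b))%C by ring end.
    match goal with |- (?b + ?d)%C = _ => replace d with (RtoC 0) end.
    - ring.
    - rewrite <- G'. ring. }
  exists P1. intros w Hw.
  destruct (open_ball_sub (ball ((x0, y0) : C) r) w (ball_open _ _) Hw) as [r' [Hr' Hsub]].
  apply (cder_of_partials P1 F w r'); auto.
  intros [x y] Hxy; simpl fst; simpl snd. apply Hsub in Hxy.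
  assert (Hxy' := Hxy). cball Hxy' Hx Hy.
  set (rx := r - Rabs (x - x0)). set (ry := r - Rabs (y - y0)).
  assert (Hrx : 0 < rx) by (unfold rx; lra). assert (Hry : 0 < ry) by (unfold ry; lra).
  split.
  - apply (rder_ext_loc (fun s => P2 (s, y)) _ _ _ rx); auto.
    + intros s Hs. symmetry; apply E, Cball_iff; simpl; split; auto.
      unfold rx in Hs. replace (s - x0) with ((s - x) + (x - x0)) by ring.
      eapply Rle_lt_trans; [apply Rabs_triang|lra].
    + unfold P2; simpl. eapply rder_eq.
      * apply rder_plus; [apply rder_const|]. apply (rder_CInt _ _ _ rx); auto.
        intros t Ht. apply continuous_horizontal, Hc, Cball_iff; simpl; split; auto.
        unfold rx in Ht. unfold Rmin, Rmax, Rabs in *.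
        destruct (Rle_dec x0 x); destruct (Rcase_abs (x - x0)); destruct (Rcase_abs (t - x0)); lra.
      * simpl; ring.
  - unfold P1; simpl. eapply rder_eq.
    + apply rder_plus; [apply rder_const|]. apply rder_mult; [apply rder_const|].
      apply (rder_CInt _ _ _ ry); auto.
      intros t Ht. apply continuous_vertical, Hc, Cball_iff; simpl; split; auto.
      unfold ry in Ht. unfold Rmin, Rmax, Rabs in *.
      destruct (Rle_dec y0 y); destruct (Rcase_abs (y - y0)); destruct (Rcase_abs (t - y0)); lra.
    + simpl; ring.
Qed.

(** * Cauchy's formula and the identity theorem *)

Lemma cont_between_bounded (f : R -> C) (a b : R) : a <= b -> cont_between f a b ->
  exists M, 0 <= M /\ forall t, a <= t <= b -> Cmod (f t) <= M.
Proof.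
  intros Hab H.
  destruct (continuity_ab_maj (fun t => Cmod (f t)) a b Hab) as [x [Hx1 Hx2]].
  - intros t Ht. apply continuity_pt_filterlim. apply (@continuous_Cmod R_UniformSpace f t).
    apply H. unfold between. now rewrite Rmin_left, Rmax_right.
  - exists (Cmod (f x)); split; [apply Cmod_ge_0|exact Hx1].
Qed.

(** The quadratic remainder is uniform in [t], so it integrates to at most [2 M |b - a| |w - z|^2],
    which is of lower order than [|w - z|]. *)
Lemma cder_CInt (k k' : C -> R -> C) (a b : R) (z : C) (r M : R) : 0 < r -> 0 <= M ->
  (forall w, ball z r w -> cont_between (k w) a b) -> cont_between (k' z) a b ->
  (forall w t, ball z r w -> between a b t ->
     Cmod (k w t - k z t - (w - z) * k' z t) <= M * Cmod (w - z) ^ 2) ->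
  cder (fun w => CInt (k w) a b) z (CInt (k' z) a b).
Proof.
  intros Hr HM C1 C2 H. apply cder_eps. intros e He.
  assert (Hz : ball z r z) by now apply ball_self.
  set (L := 1 + 2 * M * Rabs (b - a)).
  assert (P := Rabs_pos (b - a)).
  assert (HL : 0 < L) by (unfold L; nra).
  set (d := Rmin r (e / (2 * L))).
  assert (Hd : 0 < d) by (apply Rmin_glb_lt; auto; apply Rdiv_lt_0_compat; lra).
  exists d; split; auto. intros w Hw.
  assert (D : 2 * d * L <= e).
  { apply Rle_trans with (2 * (e / (2 * L)) * L); [|right; field; lra].
    apply Rmult_le_compat_r; [lra|]. apply Rmult_le_compat_l; [lra|apply Rmin_r]. }
  assert (Hw1 := proj1 (ball_Rmin _ _ _ _ Hw)). apply Cmod_of_Cball in Hw.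
  rewrite <- CInt_scal by auto. rewrite <- CInt_minus, <- CInt_minus; auto.
  2:{ apply cont_between_minus; auto. }
  2:{ apply cont_between_mult; auto. apply cont_between_const. }
  eapply Rle_trans.
  - apply CInt_bound with (M := M * Cmod (w - z) ^ 2).
    + apply cont_between_minus; [apply cont_between_minus; auto|].
      apply cont_between_mult; auto. apply cont_between_const.
    + intros t Ht. now apply H.
  - assert (Q := Cmod_ge_0 (w - z)).
    apply Rle_trans with (L * Cmod (w - z) * Cmod (w - z)).
    + unfold L. assert (0 <= Cmod (w - z) * Cmod (w - z)) by nra.
      simpl. ring_simplify. lra.
    + apply Rmult_le_compat_r; auto. apply Rle_trans with (2 * d * L); [|exact D].
      rewrite Rmult_comm. apply Rmult_le_compat_r; lra.
Qed.

(* For [a = 1 / (zeta - z)], [b = 1 / (zeta - w)], [v = w - z]: the first order Taylor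
   expansion of the kernel [(zeta - z)^-n], uniformly in [zeta]. *)
Lemma power_expansion (n : nat) (m : R) : 0 < m -> exists K, 0 <= K /\
  forall a b v : C, Cmod a <= / m -> Cmod b <= / m -> (b = a + v * (a * b))%C ->
  Cmod (b ^ n - a ^ n - v * (RtoC (INR n) * a ^ S n)) <= K * Cmod v ^ 2.
Proof.
  intros Hm. assert (Hi : 0 < / m) by now apply Rinv_0_lt_compat.
  induction n as [|n [K [HK IH]]].
  - exists 0; split; [lra|]. intros a b v _ _ _.
    replace (b ^ 0 - a ^ 0 - v * (RtoC (INR 0) * a ^ 1))%C with (RtoC 0)
      by (simpl; ring).
    rewrite Cmod_0; lra.
  - exists (K * / m + INR (S n) * (/ m) ^ (S (S n)) * / m).
    assert (HS : 0 <= INR (S n)) by apply pos_INR.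
    assert (Hp : 0 < (/ m) ^ S (S n)) by (apply pow_lt; auto).
    split; [apply Rplus_le_le_0_compat; apply Rmult_le_pos; try lra; apply Rmult_le_pos; lra|].
    intros a b v Ha Hb E.
    (* The remainder for [n] is multiplied by [b]; substituting [b = a + v a b] where a single [b]
       remains leaves the new term [(n + 1) v^2 a^(n+2) b]. *)
    replace (b ^ S n - a ^ S n - v * (RtoC (INR (S n)) * a ^ S (S n)))%C
      with (b * (b ^ n - a ^ n - v * (RtoC (INR n) * a ^ S n))
            + RtoC (INR (S n)) * (v * v) * (a ^ S (S n) * b))%C.
    2:{ rewrite S_INR, RtoC_plus.
        assert (E' : (b * a ^ n)%C = (a ^ S n + v * (a ^ S n * b))%C).
        { rewrite E at 1. simpl. ring. }
        assert (E2 : (v * (v * (a ^ S (S n) * b)))%C = (v * (a ^ S n * b) - v * a ^ S (S n))%C).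
        { rewrite E at 2. simpl. ring. }
        transitivity (b * b ^ n - b * a ^ n - v * (RtoC (INR n) * (a ^ S n * b))
           + (RtoC (INR n) + RtoC 1) * (v * (v * (a ^ S (S n) * b))))%C; [ring|].
        rewrite E', E2. simpl. ring. }
    eapply Rle_trans; [apply Cmod_triangle|]. rewrite !Cmod_mult, Cmod_R, Cmod_pow.
    rewrite (Rabs_pos_eq _ HS).
    specialize (IH a b v Ha Hb E).
    assert (Pv := Cmod_ge_0 v). assert (Pa := Cmod_ge_0 a). assert (Pb := Cmod_ge_0 b).
    assert (Q1 : Cmod b * Cmod (b ^ n - a ^ n - v * (RtoC (INR n) * a ^ S n)) <= / m * (K * Cmod v ^ 2)).
    { apply Rmult_le_compat; auto. apply Cmod_ge_0. }
    assert (Q2 : Cmod a ^ S (S n) * Cmod b <= (/ m) ^ S (S n) * / m).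
    { apply Rmult_le_compat; auto; [apply pow_le; auto|]. apply pow_incr; auto. }
    assert (Q3 : INR (S n) * (Cmod v * Cmod v) * (Cmod a ^ S (S n) * Cmod b) <=
       INR (S n) * (Cmod v * Cmod v) * ((/ m) ^ S (S n) * / m)).
    { apply Rmult_le_compat_l; auto. apply Rmult_le_pos; auto. nra. }
    nra.
Qed.

(** * Cauchy integrals over circles *)

Definition circle (c : C) (r t : R) : C := (c + ((r * cos t)%R, (r * sin t)%R))%C.
Definition circle' (r t : R) : C := (- (r * sin t), r * cos t).

Lemma circle_rder c r t : rder (circle c r) t (circle' r t).
Proof.
  split; unfold circle, circle'; simpl.
  - auto_derive; auto. ring.
  - auto_derive; auto. ring.
Qed.

Lemma circle_Cmod c r t : 0 <= r -> Cmod (circle c r t - c) = r.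
Proof.
  intro Hr. replace (circle c r t - c)%C with ((r * cos t, r * sin t) : C) by (unfold circle; apply injective_projections; simpl; ring).
  unfold Cmod; simpl. replace (r * cos t * (r * cos t * 1) + r * sin t * (r * sin t * 1))
    with (r * r * (Rsqr (sin t) + Rsqr (cos t))) by (unfold Rsqr; ring).
  rewrite sin2_cos2, Rmult_1_r. apply sqrt_square; auto.
Qed.

Lemma circle_continuous c r t : Rcont (circle c r) t.
Proof. eapply rder_cont, circle_rder. Qed.

Lemma circle'_continuous r t : Rcont (circle' r) t.
Proof.
  unfold circle'. apply continuous_pairC.
  - apply (continuous_opp (fun t => r * sin t)).
    apply (@continuous_mult R_UniformSpace R_AbsRing); [apply continuous_const|apply continuous_sin].
  - apply (@continuous_mult R_UniformSpace R_AbsRing); [apply continuous_const|apply continuous_cos].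
Qed.

Lemma circle_closed c r : circle c r (2 * PI) = circle c r 0.
Proof. unfold circle. now rewrite sin_2PI, cos_2PI, sin_0, cos_0. Qed.

Lemma circle_gap c r z w t : 0 <= r -> Cmod (w - z) <= (r - Cmod (z - c)) / 2 ->
  (r - Cmod (z - c)) / 2 <= Cmod (circle c r t - w).
Proof.
  intros Hr Hw. assert (E := circle_Cmod c r t Hr).
  assert (T1 := Cmod_triangle (circle c r t - w) (w - z)).
  assert (T2 := Cmod_triangle (circle c r t - w + (w - z)) (z - c)).
  replace (circle c r t - w + (w - z) + (z - c))%C with (circle c r t - c)%C in T2 by ring. lra.
Qed.

Lemma circle_neq c r z t : 0 <= r -> Cmod (z - c) < r -> (circle c r t - z)%C <> RtoC 0.
Proof.
  intros Hr Hz. apply Cmod_gt_0. eapply Rlt_le_trans; [|apply (circle_gap c r z z t); auto].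
  - lra.
  - rewrite Cmod_diag. lra.
Qed.

(** Integral of Cauchy type with an arbitrary density; a line integral in [zeta] puts the factor
    [circle'] into [phi]. *)
Definition cauchy_int (phi : R -> C) (c : C) (r : R) (n : nat) (z : C) : C :=
  CInt (fun t => phi t * (/ (circle c r t - z)) ^ n)%C 0 (2 * PI).

Lemma two_PI_pos : 0 <= 2 * PI.
Proof. assert (H := PI_RGT_0); lra. Qed.

Lemma continuous_Cpow {U : UniformSpace} (f : U -> C) (x : U) (n : nat) :
  @continuous U C_UniformSpace f x -> @continuous U C_UniformSpace (fun y => f y ^ n)%C x.
Proof.
  intro H. induction n; simpl; [apply continuous_const|]. now apply continuous_Cmult.
Qed.

Lemma cauchy_kernel_continuous phi c r n z : 0 <= r -> Cmod (z - c) < r ->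
  cont_between phi 0 (2 * PI) ->
  cont_between (fun t => phi t * (/ (circle c r t - z)) ^ n)%C 0 (2 * PI).
Proof.
  intros Hr Hz H. apply cont_between_mult; auto. intros t _.
  apply continuous_Cpow, (@continuous_Cinv R_UniformSpace); [|now apply circle_neq].
  ccont. apply circle_continuous.
Qed.

(** Differentiating the kernel raises its exponent, for any continuous density; this is the source
    of all higher differentiability below. *)
Lemma cauchy_int_cder phi c r n z : 0 <= r -> Cmod (z - c) < r ->
  cont_between phi 0 (2 * PI) ->
  cder (cauchy_int phi c r n) z (RtoC (INR n) * cauchy_int phi c r (S n) z)%C.
Proof.
  intros Hr Hz H.
  (* Half the distance from [z] to the circle: points within [m] of [z] stay at distance at least
     [m] from the circle, which bounds the kernels by [/ m]. *)
  set (m := (r - Cmod (z - c)) / 2). assert (Hm : 0 < m) by (unfold m; lra).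
  destruct (cont_between_bounded _ _ _ two_PI_pos H) as [B [HB0 HB]].
  destruct (power_expansion n m Hm) as [K [HK EK]].
  assert (Hdisc : forall w, ball z (m / 2) w -> Cmod (w - z) <= m /\ Cmod (w - c) < r).
  { intros w Hw. apply Cmod_of_Cball in Hw. split; [lra|].
    replace (w - c)%C with ((w - z) + (z - c))%C by ring.
    eapply Rle_lt_trans; [apply Cmod_triangle|]. unfold m in *; lra. }
  unfold cauchy_int at 2. rewrite <- CInt_scal by now apply cauchy_kernel_continuous.
  apply (cder_CInt (fun w t => phi t * (/ (circle c r t - w)) ^ n)%C
    (fun w t => RtoC (INR n) * (phi t * (/ (circle c r t - w)) ^ S n))%C _ _ z (m / 2) (B * K)).
  - lra.
  - now apply Rmult_le_pos.
  - intros w Hw. apply cauchy_kernel_continuous; auto. now apply Hdisc.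
  - apply cont_between_mult; [apply cont_between_const|now apply cauchy_kernel_continuous].
  - intros w t Hw Ht. destruct (Hdisc w Hw) as [W1 W2].
    assert (N1 := circle_neq c r z t Hr Hz). assert (N2 := circle_neq c r w t Hr W2).
    assert (G1 : m <= Cmod (circle c r t - z)).
    { apply circle_gap; auto. rewrite Cmod_diag. unfold m in *; lra. }
    assert (G2 : m <= Cmod (circle c r t - w)) by (apply circle_gap; auto).
    set (a := (/ (circle c r t - z))%C). set (b := (/ (circle c r t - w))%C).
    replace (phi t * b ^ n - phi t * a ^ n - (w - z) * (RtoC (INR n) * (phi t * a ^ S n)))%C
      with (phi t * (b ^ n - a ^ n - (w - z) * (RtoC (INR n) * a ^ S n)))%C by ring.
    rewrite Cmod_mult, Rmult_assoc. apply between_le in Ht; [|apply two_PI_pos].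
    apply Rmult_le_compat; auto using Cmod_ge_0.
    apply EK.
    + unfold a. rewrite Cmod_inv by auto. apply Rinv_le_contravar; auto.
    + unfold b. rewrite Cmod_inv by auto. apply Rinv_le_contravar; auto.
    + unfold a, b. field; auto.
Qed.

Lemma disc_segment c z r t : Cmod (z - c) < r -> 0 <= t <= 1 -> Cmod (segment c z t - c) < r.
Proof.
  intros H Ht. replace (segment c z t - c)%C with (RtoC t * (z - c))%C by (unfold segment; ring).
  rewrite Cmod_mult, Cmod_R, Rabs_pos_eq by lra. assert (P := Cmod_ge_0 (z - c)). nra.
Qed.

Definition two_pi_i : C := (RtoC (2 * PI) * Ci)%C.

(** The derivative in [z] integrates [(zeta - z)^-2], which has the primitive [-1 / (zeta - z)] and
    so gives 0 on a closed curve. At the centre the integrand is the constant [Ci]. *)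
Lemma winding_number c r z : 0 < r -> Cmod (z - c) < r ->
  cauchy_int (circle' r) c r 1 z = two_pi_i.
Proof.
  intros Hr Hz.
  assert (Hc : cont_between (circle' r) 0 (2 * PI)) by (intros t _; apply circle'_continuous).
  assert (E : cauchy_int (circle' r) c r 1 c = cauchy_int (circle' r) c r 1 z).
  { transitivity (cauchy_int (circle' r) c r 1 (segment c z 0)); [now rewrite segment_0|].
    transitivity (cauchy_int (circle' r) c r 1 (segment c z 1)); [|now rewrite segment_1].
    apply (rder_zero_const (fun t => cauchy_int (circle' r) c r 1 (segment c z t))).
    intros t Ht. rewrite Rmin_left, Rmax_right in Ht by lra.
    assert (W := disc_segment c z r t Hz Ht).
    eapply rder_eq; [apply rder_segment_cder, cauchy_int_cder; auto; lra|].
    replace (cauchy_int (circle' r) c r 2 (segment c z t)) with (RtoC 0); [simpl; ring|].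
    symmetry. set (w := segment c z t) in *. unfold cauchy_int.
    rewrite (CInt_derive (fun s => - / (circle c r s - w))%C).
    - rewrite circle_closed. ring.
    - intros s _. assert (N := circle_neq c r w s (Rlt_le _ _ Hr) W).
      eapply rder_eq.
      + apply rder_opp. apply (rder_comp_cder Cinv); [now apply cder_inv_id|].
        apply rder_minus; [apply circle_rder|apply rder_const].
      + simpl. field; auto.
    - apply cauchy_kernel_continuous; auto; lra. }
  rewrite <- E. unfold cauchy_int. rewrite (CInt_ext _ (fun _ => Ci)).
  - rewrite CInt_const, Rminus_0_r. reflexivity.
  - intros t _. assert (N : (circle c r t - c)%C <> RtoC 0).
    { apply circle_neq; [lra|]. replace (c - c)%C with (RtoC 0) by ring. now rewrite Cmod_0. }
    replace (circle' r t) with (Ci * (circle c r t - c))%C.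
    + simpl. field; auto.
    + unfold circle', circle. apply injective_projections; simpl; ring.
Qed.

Lemma two_pi_i_neq : two_pi_i <> RtoC 0.
Proof.
  unfold two_pi_i. intro E. apply (f_equal snd) in E. simpl in E. assert (H := PI_RGT_0). lra.
Qed.

(* The integral of [P (z + l (zeta - z)) / (zeta - z)] over the circle does not depend on
   [l] in [0, 1], because its [l]-derivative integrates an exact differential. *)
Lemma cauchy_formula (P F : C -> C) (c z : C) (r R0 : R) : 0 < r < R0 ->
  (forall w, ball c R0 w -> cder P w (F w) /\ Ccont F w) -> Cmod (z - c) < r ->
  cauchy_int (fun t => P (circle c r t) * circle' r t)%C c r 1 z = (two_pi_i * P z)%C.
Proof.
  intros [Hr HR] H Hz.
  assert (Hr' : 0 <= r) by lra.
  set (I := fun l : R => CInt (fun t => P (segment z (circle c r t) l) * circle' r t * / (circle c r t - z))%C 0 (2 * PI)).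
  (* The parameter [l] must move slightly beyond [0, 1] for two-sided derivatives;
     [2 * eta * r = (R0 - r) / 2] keeps the points inside radius [R0]. *)
  set (eta := (R0 - r) / (4 * r)).
  assert (Heta : 0 < eta) by (apply Rdiv_lt_0_compat; lra).
  assert (Eeta : eta * r = (R0 - r) / 4) by (unfold eta; field; lra).
  assert (Hin : forall l t, - eta < l < 1 + eta -> ball c R0 (segment z (circle c r t) l)).
  { intros l t Hl. apply Cball_of_Cmod.
    replace (segment z (circle c r t) l - c)%C with (RtoC (1 - l) * (z - c) + RtoC l * (circle c r t - c))%C
      by (unfold segment; rewrite RtoC_minus; ring).
    eapply Rle_lt_trans; [apply Cmod_triangle|]. rewrite !Cmod_mult, !Cmod_R, circle_Cmod by auto.
    assert (P1 := Cmod_ge_0 (z - c)).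
    assert (Q : Rabs (1 - l) + Rabs l <= 1 + 2 * eta).
    { unfold Rabs; destruct (Rcase_abs (1 - l)); destruct (Rcase_abs l); lra. }
    assert (Q1 : Rabs (1 - l) * Cmod (z - c) <= Rabs (1 - l) * r).
    { apply Rmult_le_compat_l; [apply Rabs_pos|lra]. }
    nra. }
  assert (Dseg : forall l t, rder (fun l => segment z (circle c r t) l) l (circle c r t - z)%C)
    by (intros; apply rder_segment).
  assert (E : I 0 = I 1).
  { apply rder_zero_const. intros l Hl. rewrite Rmin_left, Rmax_right in Hl by lra.
    eapply rder_eq.
    - apply (rder_CInt_param
        (fun l t => P (segment z (circle c r t) l) * circle' r t * / (circle c r t - z))%C
        (fun l t => F (segment z (circle c r t) l) * circle' r t)%C 0 (2 * PI) l eta); auto.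
      + intros x t Hx _. apply Rabs_def2 in Hx as [X1 X2].
        assert (B := Hin x t ltac:(lra)). destruct (H _ B) as [DP CF].
        assert (N := circle_neq c r z t Hr' Hz).
        split.
        * eapply rder_eq.
          -- apply rder_mult; [|apply rder_const]. apply rder_mult; [|apply rder_const].
             apply (rder_comp_cder P); [exact DP|apply Dseg].
          -- simpl. field; auto.
        * ccont; [|apply circle'_continuous|].
          -- apply (continuous_Ccomp P (fun t => segment z (circle c r t) x)).
             ++ unfold segment. ccont. apply circle_continuous.
             ++ eapply cder_cont; exact DP.
          -- apply (@continuous_Cinv R_UniformSpace); auto. ccont. apply circle_continuous.
      + intros t _.
        assert (C1 : @continuous C_UniformSpace C_UniformSpace (fun p => circle c r (snd p)) (l, t)).
        { apply (@continuous_comp C_UniformSpace R_UniformSpace C_UniformSpace snd); [apply continuous_snd|apply circle_continuous]. }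
        ccont.
        * apply (continuous_Ccomp F (fun p => segment z (circle c r (snd p)) (fst p))).
          -- unfold segment. ccont. apply continuous_RtoC, (@continuous_fst R_UniformSpace R_UniformSpace).
          -- apply H. simpl. apply Hin; lra.
        * apply (@continuous_comp C_UniformSpace R_UniformSpace C_UniformSpace snd); [apply continuous_snd|apply circle'_continuous].
    - simpl.
      assert (CF : cont_between (fun t => F (segment z (circle c r t) l) * circle' r t)%C 0 (2 * PI)).
      { intros t _. ccont; [|apply circle'_continuous].
        apply (continuous_Ccomp F (fun t => segment z (circle c r t) l)).
        - unfold segment. ccont. apply circle_continuous.
        - apply H, Hin; lra. }
      (* For [l <> 0] the integrand has the primitive [P (segment z zeta l) / l]; for [l = 0] it is
         a constant times [circle']. *)
      destruct (Req_dec l 0) as [->|L0].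
      + rewrite (CInt_derive (fun t => F z * circle c r t)%C); auto.
        * rewrite circle_closed. ring.
        * intros t _. rewrite segment_0. eapply rder_eq.
          -- apply rder_mult; [apply rder_const|apply circle_rder].
          -- simpl; ring.
      + rewrite (CInt_derive (fun t => / RtoC l * P (segment z (circle c r t) l))%C); auto.
        * rewrite circle_closed. ring.
        * intros t _. eapply rder_eq.
          -- apply rder_mult; [apply rder_const|].
             apply (rder_comp_cder P); [apply H, Hin; lra|].
             unfold segment. apply rder_plus; [apply rder_const|].
             apply rder_mult; [apply rder_const|].
             apply rder_minus; [apply circle_rder|apply rder_const].
          -- simpl. field. intro E0; apply L0. now apply (f_equal fst) in E0. }
  unfold I in E. unfold cauchy_int.
  rewrite (CInt_ext _ (fun t => P (segment z (circle c r t) 1) * circle' r t * / (circle c r t - z))%C).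
  2:{ intros t _. rewrite segment_1. simpl. ring. }
  rewrite <- E.
  rewrite (CInt_ext _ (fun t => P z * (circle' r t * (/ (circle c r t - z)) ^ 1))%C).
  2:{ intros t _. rewrite segment_0. simpl. ring. }
  rewrite CInt_scal.
  - fold (cauchy_int (circle' r) c r 1 z). rewrite winding_number; auto. ring.
  - apply cauchy_kernel_continuous; auto. intros t _; apply circle'_continuous.
Qed.

(** * Differentiability of derivatives, and the identity theorem *)

Definition holo (X : C -> Prop) (f : C -> C) : Prop := forall z, X z -> exists l, cder f z l.

Lemma C_derive_cder f z l : cder f z l -> cder f z (C_derive f z).
Proof. intro H. now rewrite (is_C_derive_unique f z l H). Qed.

(** Cauchy's formula wants a continuous derivative, which [F] is not yet known to have; its
    primitive [P] has one, namely [F]. So [P], [F] and [F'] are Cauchy integrals with exponents 1, 2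
    and 3, and the last one is differentiable again. *)
Lemma holo_C_derive_ball (F : C -> C) (z : C) (r : R) : 0 < r -> holo (ball z r) F ->
  exists l, cder (C_derive F) z l.
Proof.
  intros Hr H. destruct (holomorphic_primitive F z r Hr H) as [P HP].
  set (s := r / 2). assert (Hs : 0 < s < r) by (unfold s; lra).
  assert (CF : forall w, ball z r w -> Ccont F w).
  { intros w Hw. destruct (H w Hw). eapply cder_cont; eauto. }
  set (phi := fun t => (P (circle z s t) * circle' s t)%C).
  assert (Cphi : cont_between phi 0 (2 * PI)).
  { intros t _. unfold phi. ccont; [|apply circle'_continuous].
    apply (continuous_Ccomp P (circle z s)); [apply circle_continuous|].
    eapply cder_cont, HP, Cball_of_Cmod. rewrite circle_Cmod; lra. }
  assert (F0 : forall w, Cmod (w - z) < s -> cauchy_int phi z s 1 w = (two_pi_i * P w)%C).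
  { intros w Hw. apply (cauchy_formula P F z w s r); auto. }
  assert (Hdisc : forall w, Cmod (w - z) < s -> exists e, 0 < e /\ forall v, ball w e v -> Cmod (v - z) < s).
  { intros w Hw. exists ((s - Cmod (w - z)) / 2). split; [lra|]. intros v Hv. apply Cmod_of_Cball in Hv.
    replace (v - z)%C with ((v - w) + (w - z))%C by ring. eapply Rle_lt_trans; [apply Cmod_triangle|lra]. }
  assert (N := two_pi_i_neq).
  assert (F1 : forall w, Cmod (w - z) < s -> F w = (/ two_pi_i * cauchy_int phi z s 2 w)%C).
  { intros w Hw. destruct (Hdisc w Hw) as [e [He Hd]].
    apply (cder_unique P w); [apply HP, Cball_of_Cmod; lra|].
    apply (cder_ext_loc (fun w => / two_pi_i * cauchy_int phi z s 1 w)%C _ _ _ e); auto.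
    - intros v Hv. rewrite F0 by auto. field; auto.
    - eapply cder_eq; [apply cder_scal, cauchy_int_cder; auto; lra|]. simpl. ring. }
  assert (F2 : forall w, Cmod (w - z) < s -> cder F w (/ two_pi_i * (RtoC 2 * cauchy_int phi z s 3 w))%C).
  { intros w Hw. destruct (Hdisc w Hw) as [e [He Hd]].
    apply (cder_ext_loc (fun w => / two_pi_i * cauchy_int phi z s 2 w)%C _ _ _ e); auto.
    - intros v Hv. rewrite F1 by auto. reflexivity.
    - eapply cder_eq; [apply cder_scal, cauchy_int_cder; auto; lra|].
      replace (INR 2) with 2 by (simpl; ring). reflexivity. }
  assert (Hz : Cmod (z - z) < s) by (replace (z - z)%C with (RtoC 0) by ring; rewrite Cmod_0; lra).
  destruct (Hdisc z Hz) as [e [He Hd]].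
  eexists. eapply (cder_ext_loc (fun w => / two_pi_i * (RtoC 2 * cauchy_int phi z s 3 w))%C _ _ _ e); auto.
  - intros v Hv. symmetry. apply is_C_derive_unique, F2, Hd, Hv.
  - apply cder_scal, cder_scal, cauchy_int_cder; auto; lra.
Qed.

Lemma holo_C_derive (X : C -> Prop) (F : C -> C) : @open C_UniformSpace X -> holo X F ->
  holo X (C_derive F).
Proof.
  intros HX H z Hz. destruct (open_ball_sub X z HX Hz) as [r [Hr Hsub]].
  apply (holo_C_derive_ball F z r Hr). intros w Hw; apply H, Hsub, Hw.
Qed.

(* Each induction step divides [D] by [w - c], which is harmless since [D] vanishes near [c]
   and gains a factor [|z - c| / r]. *)
Lemma identity_disc_bound (c z : C) (r R0 e0 : R) (n : nat) : 0 < r < R0 -> 0 < e0 -> Cmod (z - c) < r ->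
  forall (D : C -> C) (M : R), holo (ball c R0) D -> (forall w, ball c e0 w -> D w = RtoC 0) ->
  (forall t, 0 <= t <= 2 * PI -> Cmod (D (circle c r t)) <= M) ->
  Cmod (two_pi_i * D z) <= (Cmod (z - c) / r) ^ n * (2 * (M * r * / ((r - Cmod (z - c)) / 2)) * (2 * PI)).
Proof.
  intros Hr He Hz. set (m := (r - Cmod (z - c)) / 2). assert (Hm : 0 < m) by (unfold m; lra).
  induction n as [|n IH]; intros D M HD H0 HM.
  - rewrite pow_O, Rmult_1_l.
    rewrite <- (cauchy_formula D (C_derive D) c z r R0); auto.
    2:{ intros w Hw. destruct (HD w Hw) as [l Hl]. split; [eapply C_derive_cder; eauto|].
        destruct (holo_C_derive _ D (ball_open c R0) HD w Hw). eapply cder_cont; eauto. }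
    unfold cauchy_int. rewrite <- (Rabs_pos_eq (2 * PI)) at 2 by apply two_PI_pos.
    rewrite <- (Rminus_0_r (2 * PI)) at 2.
    apply CInt_bound.
    + apply cauchy_kernel_continuous; auto; [lra|].
      intros t _. ccont; [|apply circle'_continuous].
      apply (continuous_Ccomp D (circle c r)); [apply circle_continuous|].
      destruct (HD (circle c r t)); [|eapply cder_cont; eauto].
      apply Cball_of_Cmod. rewrite circle_Cmod; lra.
    + intros t Ht. apply between_le in Ht; [|apply two_PI_pos]. assert (N := circle_neq c r z t ltac:(lra) Hz).
      rewrite !Cmod_mult, Cmod_pow, pow_1, Cmod_inv by auto.
      replace (Cmod (circle' r t)) with r.
      * apply Rmult_le_compat.
        -- apply Rmult_le_pos; [apply Cmod_ge_0|lra].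
        -- left. apply Rinv_0_lt_compat. now apply Cmod_gt_0.
        -- apply Rmult_le_compat_r; [lra|auto].
        -- apply Rinv_le_contravar; auto. apply circle_gap; [lra|].
           rewrite Cmod_diag. lra.
      * replace (circle' r t) with (Ci * (circle c r t - c))%C.
        -- rewrite Cmod_mult, Cmod_Ci, circle_Cmod; lra.
        -- unfold circle', circle. apply injective_projections; simpl; ring.
  - set (E := fun w => (D w / (w - c))%C).
    assert (Dc : D c = RtoC 0) by (now apply H0, ball_self).
    assert (HE : holo (ball c R0) E).
    (* At [c] the quotient is 0 divided by 0, which evaluates to 0 and agrees with the values of [E]
       near [c], where [D] vanishes. *)
    { intros w Hw. destruct (Ceq_dec w c) as [->|Nw].
      - exists (RtoC 0). apply (cder_ext_loc (fun _ => RtoC 0) _ _ _ e0); auto; [|apply cder_const].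
        intros v Hv. unfold E. rewrite H0 by auto. unfold Cdiv. now rewrite Cmult_0_l.
      - destruct (HD w Hw) as [l Hl]. eexists. apply cder_div; [exact Hl| |].
        + apply cder_minus; [apply cder_id|apply cder_const].
        + intro E0. apply Nw. replace w with ((w - c) + c)%C by ring. rewrite E0. ring. }
    assert (HE0 : forall w, ball c e0 w -> E w = RtoC 0).
    { intros w Hw. unfold E. rewrite H0 by auto. unfold Cdiv. now rewrite Cmult_0_l. }
    assert (HEM : forall t, 0 <= t <= 2 * PI -> Cmod (E (circle c r t)) <= M / r).
    { intros t Ht. unfold E. assert (N := circle_neq c r c t ltac:(lra)).
      replace (c - c)%C with (RtoC 0) in N by ring. rewrite Cmod_0 in N. specialize (N ltac:(lra)).
      rewrite Cmod_div by auto. rewrite circle_Cmod by lra.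
      apply Rmult_le_compat_r; auto. left; apply Rinv_0_lt_compat; lra. }
    specialize (IH E (M / r) HE HE0 HEM).
    assert (ED : (two_pi_i * D z)%C = ((z - c) * (two_pi_i * E z))%C).
    { destruct (Ceq_dec z c) as [->|Nz].
      - rewrite Dc. ring.
      - unfold E. field. intro E0. apply Nz. replace z with ((z - c) + c)%C by ring. rewrite E0. ring. }
    rewrite ED, Cmod_mult.
    assert (P := Cmod_ge_0 (z - c)).
    apply (Rmult_le_compat_l (Cmod (z - c))) in IH; auto.
    eapply Rle_trans; [exact IH|]. right. simpl. field. split; lra.
Qed.

Lemma identity_disc (D : C -> C) (c z : C) (r R0 e0 : R) : 0 < r < R0 -> 0 < e0 -> Cmod (z - c) < r ->
  holo (ball c R0) D -> (forall w, ball c e0 w -> D w = RtoC 0) -> D z = RtoC 0.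
Proof.
  intros Hr He Hz HD H0.
  destruct (cont_between_bounded (fun t => D (circle c r t)) 0 (2 * PI) two_PI_pos) as [M0 [_ HM0]].
  { intros t _.
    apply (continuous_Ccomp D (circle c r)); [apply circle_continuous|].
    destruct (HD (circle c r t)); [|eapply cder_cont; eauto].
    apply Cball_of_Cmod. rewrite circle_Cmod; lra. }
  set (K := 2 * (M0 * r * / ((r - Cmod (z - c)) / 2)) * (2 * PI)).
  set (x := Cmod (z - c) / r).
  assert (Hx : Rabs x < 1).
  { unfold x. rewrite Rabs_pos_eq by (apply Rdiv_le_0_compat; [apply Cmod_ge_0|lra]).
    apply (Rmult_lt_reg_r r); [lra|]. replace (Cmod (z - c) / r * r) with (Cmod (z - c)) by (field; lra). lra. }
  assert (E : (two_pi_i * D z)%C = RtoC 0).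
  { apply (Cmod_small_0 _ K). intros e Hpos.
    destruct (pow_lt_1_zero x Hx e Hpos) as [n Hn]. specialize (Hn n (le_n n)).
    eapply Rle_trans; [apply (identity_disc_bound c z r R0 e0 n Hr He Hz D M0); auto|].
    fold x K. apply Rmult_le_compat_r; [|apply Rabs_def2 in Hn; lra].
    assert (0 <= M0).
    { eapply Rle_trans; [|apply (HM0 0)]; [apply Cmod_ge_0|]. split; [lra|apply two_PI_pos]. }
    assert (P := two_PI_pos). unfold K.
    assert (0 < / ((r - Cmod (z - c)) / 2)) by (apply Rinv_0_lt_compat; lra).
    apply Rmult_le_pos; auto. apply Rmult_le_pos; [lra|]. apply Rmult_le_pos; [|lra]. apply Rmult_le_pos; lra. }
  replace (D z) with (/ two_pi_i * (two_pi_i * D z))%C by (field; apply two_pi_i_neq).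
  rewrite E. ring.
Qed.

(** The set [U] of points near which [D] vanishes is open, and so is its complement in [X]: if a
    point of [U] lies close enough to [w], then [identity_disc] about it makes [D] vanish near
    [w]. *)
Lemma identity_theorem (X : C -> Prop) (D : C -> C) (z0 : C) (e0 : R) :
  @open C_UniformSpace X -> connected_set X -> holo X D -> X z0 -> 0 < e0 ->
  (forall w, ball z0 e0 w -> D w = RtoC 0) -> forall z, X z -> D z = RtoC 0.
Proof.
  intros HX Hconn HD Hz0 He H0 z Hz.
  set (U := fun w => exists e, 0 < e /\ forall v, ball w e v -> D v = RtoC 0).
  apply NNPP. intro Nz.
  destruct (Hconn U (fun w => X w /\ ~ U w)) as [w [_ [W1 [_ W2]]]]; auto.
  - intros w [e [He' Hw]]. exists (mkposreal e He'). intros v Hv.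
    destruct (open_ball_sub _ v (ball_open w e) Hv) as [e' [He'' Hs]].
    exists e'; split; auto.
  - intros w [Xw Uw]. destruct (open_ball_sub X w HX Xw) as [r [Hr Hs]].
    (* Both [v] and the points [p] below lie within [r / 8] of [w] in modulus, so [|p - v| < r / 4],
       well inside the circle of radius [3 r / 8] about [v], which lies in [X]. *)
    assert (Hr16 : 0 < r / 16) by lra.
    exists (mkposreal _ Hr16). intros v Hv. simpl in Hv.
    assert (Sub : forall p, ball v (r / 2) p -> X p).
    { intros p Hp. apply Hs. eapply ball_le; [|exact (ball_triangle _ _ _ _ _ Hv Hp)]. lra. }
    split; [apply Sub, ball_self; lra|].
    intros [e [He' Hv0]]. apply Uw. exists (r / 16); split; auto.
    intros p Hp. apply (identity_disc D v p (3 * r / 8) (r / 2) e); auto; try lra.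
    + apply Cmod_of_Cball in Hv. apply Cmod_of_Cball in Hp.
      replace (p - v)%C with ((p - w) - (v - w))%C by ring.
      eapply Rle_lt_trans; [apply Cmod_triangle_minus|lra].
    + intros q Hq. apply HD, Sub, Hq.
  - intros w Xw. destruct (classic (U w)); auto.
  - exists z0; split; auto. exists e0; auto.
  - exists z; repeat split; auto. intros [e [He' Hv]]. now apply Nz, Hv, ball_self.
Qed.

(** * Local solutions of P' = a P + c conj P *)

Lemma summable_limit_R (v : nat -> R) (B : R) : 0 <= B ->
  (forall n, Rabs (v (S n) - v n) <= B / 2 ^ n) ->
  exists x, forall n, Rabs (v n - x) <= 2 * B / 2 ^ n.
Proof.
  intros HB H.
  (* The geometric tail from [n] on is at most [2 B / 2^n], so the intervals of this radius about
     [v n] are nested. *)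
  destruct (nested_lim (fun n => v n - 2 * B / 2 ^ n) (4 * B) ltac:(lra)) as [x Hx].
  - intro n. assert (P := pow2_pos n).
    replace (2 * B / 2 ^ S n) with (B / 2 ^ n) by (simpl; field; lra).
    replace (4 * B / 2 ^ S n) with (B / 2 ^ n + B / 2 ^ n) by (simpl; field; lra).
    replace (2 * B / 2 ^ n) with (B / 2 ^ n + B / 2 ^ n) by (field; lra).
    assert (Hn := H n). apply Rabs_le_between in Hn. lra.
  - exists x. intro n. specialize (Hx n).
    assert (P := pow2_pos n).
    replace (4 * B / 2 ^ n) with (2 * B / 2 ^ n + 2 * B / 2 ^ n) in Hx by (field; lra).
    apply Rabs_le. lra.
Qed.

Lemma summable_limit (u : nat -> C) (B : R) : 0 <= B ->
  (forall n, Cmod (u (S n) - u n) <= B / 2 ^ n) ->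
  exists l, forall n, Cmod (u n - l) <= 4 * B / 2 ^ n.
Proof.
  intros HB H.
  destruct (summable_limit_R (fun n => fst (u n)) B HB) as [x Hx].
  { intro n. eapply Rle_trans; [|apply H]. exact (fst_le_Cmod (u (S n) - u n)). }
  destruct (summable_limit_R (fun n => snd (u n)) B HB) as [y Hy].
  { intro n. eapply Rle_trans; [|apply H]. exact (snd_le_Cmod (u (S n) - u n)). }
  exists (x, y). intro n. eapply Rle_trans; [apply Cmod_le_sum|].
  specialize (Hx n). specialize (Hy n).
  assert (P := pow2_pos n).
  change (Rabs (fst (u n) - x) + Rabs (snd (u n) - y) <= 4 * B / 2 ^ n).
  replace (4 * B / 2 ^ n) with (2 * B / 2 ^ n + 2 * B / 2 ^ n) by (field; lra). lra.
Qed.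

Lemma continuous_uniform_limit (u : nat -> C -> C) (P : C -> C) (B : R) : 0 <= B ->
  (forall n z, Ccont (u n) z) -> (forall n z, Cmod (u n z - P z) <= B / 2 ^ n) ->
  forall z, Ccont P z.
Proof.
  intros HB Hu H z. apply continuous_of_C_eps. intros e He.
  destruct (pow2_small B (e / 4) ltac:(lra)) as [n Hn].
  destruct (continuous_C_eps _ _ (Hu n z) (e / 4) ltac:(lra)) as [d [Hd K]].
  exists d; split; auto. intros y Hy. specialize (K y Hy).
  assert (H1 := H n y). assert (H2 := H n z).
  replace (P y - P z)%C with ((u n y - u n z) - (u n y - P y) + (u n z - P z))%C by ring.
  eapply Rle_lt_trans; [apply Cmod_triangle|].
  assert (T := Cmod_triangle_minus (u n y - u n z) (u n y - P y)). lra.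
Qed.

Lemma uniform_on_vertical (W : C -> C) (x0 lo hi e : R) : (forall w, Ccont W w) -> 0 < e ->
  exists d, 0 < d /\ forall x t, Rabs (x - x0) < d -> lo <= t <= hi ->
    Cmod (W (x, t) - W (x0, t)) <= e.
Proof.
  intros H He.
  assert (U : forall g : C -> R, (forall z, @continuous C_UniformSpace R_UniformSpace g z) ->
    exists d : posreal, forall x t, Rabs (x - x0) < d -> lo <= t <= hi ->
      Rabs (g (x, t) - g (x0, t)) < e / 2).
  { intros g Hg.
    destruct (uniform_continuity_2d_1d' (fun u v => g (u, v)) lo hi x0) with (eps := mkposreal (e / 2) ltac:(lra))
      as [d Hd].
    - intros t _. apply continuity_2d_pt_filterlim.
      apply (continuous_ext g (fun z : R * R => g (fst z, snd z))); [intros []; reflexivity|apply Hg].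
    - exists d. intros x t Hx Ht. assert (P := cond_pos d). apply Rabs_def2 in Hx.
      apply Hd; auto; try lra. rewrite Rminus_diag, Rabs_R0. exact P. }
  destruct (U (fun z => fst (W z))) as [d1 U1]; [intro z; now apply (@continuous_fst_C C_UniformSpace)|].
  destruct (U (fun z => snd (W z))) as [d2 U2]; [intro z; now apply (@continuous_snd_C C_UniformSpace)|].
  exists (Rmin d1 d2). split; [apply Rmin_glb_lt; apply cond_pos|]. intros x t Hx Ht.
  assert (V1 := U1 x t (Rlt_le_trans _ _ _ Hx (Rmin_l _ _)) Ht).
  assert (V2 := U2 x t (Rlt_le_trans _ _ _ Hx (Rmin_r _ _)) Ht).
  eapply Rle_trans; [apply Cmod_le_sum|].
  change (Rabs (fst (W (x, t)) - fst (W (x0, t))) + Rabs (snd (W (x, t)) - snd (W (x0, t))) <= e). lra.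
Qed.

(** For the vertical leg of the Picard operator, where moving the point changes both the integrand
    and the upper limit. *)
Lemma continuous_vertical_int (W : C -> C) (b : R) (z : C) : (forall w, Ccont W w) ->
  Ccont (fun p : C => CInt (fun t => W (fst p, t)) b (snd p)) z.
Proof.
  intros H. destruct z as [x0 y0]. apply continuous_of_C_eps. intros e He.
  assert (Cv : forall x a' b', cont_between (fun t => W (x, t)) a' b').
  { intros x a' b' t _. apply continuous_vertical, H. }
  set (L := Rabs (y0 - b) + 1). assert (HL : 0 < L) by (unfold L; assert (P := Rabs_pos (y0 - b)); lra).
  (* Changing the integrand by at most [e1] over a length at most [L] changes the integral by at
     most [2 e1 L = e / 2]. *)
  set (e1 := e / (4 * L)). assert (He1 : 0 < e1) by (apply Rdiv_lt_0_compat; lra).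
  destruct (uniform_on_vertical W x0 (Rmin b y0 - 1) (Rmax b y0 + 1) e1 H He1) as [d1 [Hd1 U1]].
  assert (R1 : Rcont (fun y => CInt (fun t => W (x0, t)) b y) y0).
  { eapply rder_cont, (rder_CInt _ _ _ 1); [lra|]. intros; apply continuous_vertical, H. }
  destruct (continuous_C_eps _ _ R1 (e / 2) ltac:(lra)) as [d2 [Hd2 U2]].
  exists (Rmin 1 (Rmin d2 d1)); split; [repeat apply Rmin_glb_lt; lra|].
  intros [x y] Hxy. simpl fst; simpl snd.
  apply ball_Rmin in Hxy as [B1 B2]. apply ball_Rmin in B2 as [B2 B3].
  cball B1 X1 Y1. cball B2 X2 Y2. cball B3 X3 Y3.
  replace (CInt (fun t => W (x, t)) b y - CInt (fun t => W (x0, t)) b y0)%C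
    with (CInt (fun t => W (x, t) - W (x0, t))%C b y +
          (CInt (fun t => W (x0, t)) b y - CInt (fun t => W (x0, t)) b y0))%C
    by (rewrite CInt_minus by auto; ring).
  eapply Rle_lt_trans; [apply Cmod_triangle|].
  assert (Q1 : Cmod (CInt (fun t => W (x, t) - W (x0, t))%C b y) <= 2 * e1 * Rabs (y - b)).
  { apply CInt_bound; [apply cont_between_minus; auto|]. intros t Ht. apply U1; auto.
    apply between_iff in Ht. apply Rabs_def2 in Y1. unfold Rmin, Rmax. destruct (Rle_dec b y0); lra. }
  assert (Q2 := U2 y Y2). simpl in Q2.
  assert (Q3 : Rabs (y - b) <= L).
  { unfold L. replace (y - b) with ((y - y0) + (y0 - b)) by ring.
    eapply Rle_trans; [apply Rabs_triang|lra]. }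
  assert (Q4 : 2 * e1 * Rabs (y - b) <= e / 2).
  { apply Rle_trans with (2 * e1 * L); [apply Rmult_le_compat_l; lra|].
    right. unfold e1. field. lra. }
  lra.
Qed.

Lemma Rabs_diam (z x y d : R) : Rabs (x - z) <= d -> Rabs (y - z) <= d -> Rabs (x - y) <= 2 * d.
Proof.
  intros H1 H2. apply Rabs_le_between in H1. apply Rabs_le_between in H2. apply Rabs_le; lra.
Qed.

(* Composing the coefficients with the projection onto a closed square makes them continuous
   and bounded on the whole plane, so that the Picard iterates need no domain. *)
Definition clamp (x d s : R) : R := Rmax (x - d) (Rmin (x + d) s).

Lemma clamp_in x d s : 0 <= d -> Rabs (clamp x d s - x) <= d.
Proof.
  intro H. unfold clamp, Rmax, Rmin.
  destruct (Rle_dec (x + d) s); destruct (Rle_dec _ _); apply Rabs_le; lra.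
Qed.

Lemma clamp_id x d s : Rabs (s - x) <= d -> clamp x d s = s.
Proof.
  intro H. apply Rabs_le_between in H. unfold clamp, Rmax, Rmin.
  destruct (Rle_dec (x + d) s); destruct (Rle_dec _ _); lra.
Qed.

Lemma clamp_continuous x d s : continuous (clamp x d) s.
Proof.
  assert (L : forall u v, Rabs (clamp x d u - clamp x d v) <= Rabs (u - v)).
  { intros u v. unfold clamp, Rmax, Rmin, Rabs.
    repeat (destruct (Rle_dec _ _)); repeat (destruct (Rcase_abs _)); lra. }
  intros P [e He]. exists e. intros y Hy. apply He.
  change (Rabs (clamp x d y - clamp x d s) < e). eapply Rle_lt_trans; [apply L|exact Hy].
Qed.

Definition clamp_square (z0 : C) (d : R) (z : C) : C :=
  (clamp (fst z0) d (fst z), clamp (snd z0) d (snd z)).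

Lemma clamp_square_continuous z0 d z : Ccont (clamp_square z0 d) z.
Proof.
  apply (@continuous_pairC C_UniformSpace).
  - apply (@continuous_comp C_UniformSpace R_UniformSpace R_UniformSpace fst); [|apply clamp_continuous].
    destruct z; apply (@continuous_fst R_UniformSpace R_UniformSpace).
  - apply (@continuous_comp C_UniformSpace R_UniformSpace R_UniformSpace snd); [|apply clamp_continuous].
    destruct z; apply (@continuous_snd R_UniformSpace R_UniformSpace).
Qed.

Lemma clamp_square_id z0 d z : ball z0 d z -> clamp_square z0 d z = z.
Proof.
  intro H. cball H H1 H2. unfold clamp_square. rewrite !clamp_id by lra. now destruct z.
Qed.

Section Picard.
Variables (a c : C -> C) (K d : R) (z0 b p0 : C).
Hypothesis Hd : 0 < d.
Hypothesis HK : 0 < K.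
Hypothesis HKd : 32 * K * d <= 1.
Hypothesis Ca : forall z, Ccont a z.
Hypothesis Cc : forall z, Ccont c z.
Hypothesis Ba : forall z, Cmod (a z) <= K.
Hypothesis Bc : forall z, Cmod (c z) <= K.
Hypothesis Hb : ball z0 d b.

Definition rhs (P : C -> C) (z : C) : C := (a z * P z + c z * Cconj (P z))%C.

(** Integral of [rhs P] from [b] along an L-shaped path, horizontal leg first. As long as [rhs P] is
    not known to be holomorphic the choice of path matters, and a fixed point is only known to
    satisfy the vertical equation. *)
Definition picard_step (P : C -> C) (z : C) : C :=
  let x := clamp (fst z0) d (fst z) in
  let y := clamp (snd z0) d (snd z) in
  (p0 + CInt (fun s => rhs P (s, snd b)) (fst b) x
      + Ci * CInt (fun t => rhs P (x, t)) (snd b) y)%C.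

Lemma rhs_continuous P z : Ccont P z -> Ccont (rhs P) z.
Proof.
  intro H. unfold rhs. ccont.
Qed.

Lemma rhs_bound P M z : Cmod (P z) <= M -> Cmod (rhs P z) <= 2 * K * M.
Proof.
  intro H. unfold rhs. eapply Rle_trans; [apply Cmod_triangle|].
  rewrite !Cmod_mult, Cmod_conj.
  assert (A1 := Ba z). assert (A2 := Bc z). assert (A3 := Cmod_ge_0 (a z)). assert (A4 := Cmod_ge_0 (c z)).
  assert (A5 := Cmod_ge_0 (P z)).
  assert (Cmod (a z) * Cmod (P z) <= K * M) by (apply Rmult_le_compat; auto).
  assert (Cmod (c z) * Cmod (P z) <= K * M) by (apply Rmult_le_compat; auto).
  lra.
Qed.

Lemma rhs_minus P Q z : (rhs P z - rhs Q z)%C = rhs (fun w => P w - Q w)%C z.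
Proof. unfold rhs. rewrite Cminus_conj. ring. Qed.

Lemma picard_step_continuous P : (forall z, Ccont P z) -> forall z, Ccont (picard_step P) z.
Proof.
  intros H z.
  set (V := fun p : C => (p0 + CInt (fun s => rhs P (s, snd b)) (fst b) (fst p)
      + Ci * CInt (fun t => rhs P (fst p, t)) (snd b) (snd p))%C).
  change (Ccont (fun z => V (clamp_square z0 d z)) z).
  apply (continuous_Ccomp V (clamp_square z0 d)).
  - apply clamp_square_continuous.
  - unfold V. ccont.
    + apply (@continuous_comp C_UniformSpace R_UniformSpace C_UniformSpace fst
        (fun x => CInt (fun s => rhs P (s, snd b)) (fst b) x)).
      * destruct (clamp_square z0 d z); apply (@continuous_fst R_UniformSpace R_UniformSpace).
      * eapply rder_cont, (rder_CInt _ _ _ 1); [lra|].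
        intros; apply continuous_horizontal, rhs_continuous, H.
    + apply continuous_vertical_int. intro w. apply rhs_continuous, H.
Qed.

(** Each leg has length at most [2 d] and integrand at most [2 K M], hence contributes at most
    [8 K d M]; both together give [16 K d M <= M / 2], the reason for [32 * K * d <= 1]. *)
Lemma picard_contraction P Q M : (forall z, Ccont P z) -> (forall z, Ccont Q z) ->
  (forall z, Cmod (P z - Q z) <= M) ->
  forall z, Cmod (picard_step P z - picard_step Q z) <= M / 2.
Proof.
  intros HP HQ H z. unfold picard_step.
  set (x := clamp (fst z0) d (fst z)). set (y := clamp (snd z0) d (snd z)).
  assert (Hx : Rabs (x - fst z0) <= d) by (apply clamp_in; lra).
  assert (Hy : Rabs (y - snd z0) <= d) by (apply clamp_in; lra).
  cball Hb B1 B2.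
  assert (Hxb : Rabs (x - fst b) <= 2 * d) by (apply (Rabs_diam (fst z0)); lra).
  assert (Hyb : Rabs (y - snd b) <= 2 * d) by (apply (Rabs_diam (snd z0)); lra).
  assert (HM : 0 <= M) by (eapply Rle_trans; [apply Cmod_ge_0|apply (H z)]).
  assert (Ch : forall P y a' b', (forall z, Ccont P z) -> cont_between (fun s => rhs P (s, y)) a' b').
  { intros P' y' a' b' HP' t _. apply continuous_horizontal, rhs_continuous, HP'. }
  assert (Cv : forall P x a' b', (forall z, Ccont P z) -> cont_between (fun s => rhs P (x, s)) a' b').
  { intros P' y' a' b' HP' t _. apply continuous_vertical, rhs_continuous, HP'. }
  match goal with |- Cmod (p0 + ?a1 + Ci * ?b1 - (p0 + ?a2 + Ci * ?b2)) <= _ =>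
    replace (p0 + a1 + Ci * b1 - (p0 + a2 + Ci * b2))%C with ((a1 - a2) + Ci * (b1 - b2))%C by ring end.
  rewrite <- !CInt_minus by auto.
  eapply Rle_trans; [apply Cmod_triangle|]. rewrite Cmod_mult, Cmod_Ci, Rmult_1_l.
  assert (E1 : Cmod (CInt (fun t => rhs P (t, snd b) - rhs Q (t, snd b))%C (fst b) x) <= 2 * (2 * K * M) * Rabs (x - fst b)).
  { apply CInt_bound; [apply cont_between_minus; auto|]. intros t _. rewrite rhs_minus. now apply rhs_bound. }
  assert (E2 : Cmod (CInt (fun t => rhs P (x, t) - rhs Q (x, t))%C (snd b) y) <= 2 * (2 * K * M) * Rabs (y - snd b)).
  { apply CInt_bound; [apply cont_between_minus; auto|]. intros t _. rewrite rhs_minus. now apply rhs_bound. }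
  assert (KM : 0 <= K * M) by (apply Rmult_le_pos; lra).
  assert (F1 : K * M * Rabs (x - fst b) <= K * M * (2 * d)) by (apply Rmult_le_compat_l; auto).
  assert (F2 : K * M * Rabs (y - snd b) <= K * M * (2 * d)) by (apply Rmult_le_compat_l; auto).
  assert (F3 : 32 * K * d * M <= 1 * M) by (apply Rmult_le_compat_r; auto).
  lra.
Qed.

Fixpoint picard_iter (n : nat) : C -> C :=
  match n with O => fun _ => p0 | S k => picard_step (picard_iter k) end.

Lemma picard_fixpoint : exists P, (forall z, Ccont P z) /\ (exists M, forall z, Cmod (P z) <= M) /\
  forall z, P z = picard_step P z.
Proof.
  assert (Cit : forall n z, Ccont (picard_iter n) z).
  { induction n; simpl; [intro; apply continuous_const|]. now apply picard_step_continuous. }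
  assert (B0 : 0 <= Cmod p0) by apply Cmod_ge_0.
  assert (Z : forall z, picard_step (fun _ => RtoC 0) z = p0).
  { intro z. unfold picard_step. rewrite (CInt_ext _ (fun _ => RtoC 0)).
    - rewrite CInt_const. rewrite (CInt_ext _ (fun _ => RtoC 0)), CInt_const; [ring|].
      intros t _. unfold rhs. apply injective_projections; simpl; ring.
    - intros t _. unfold rhs. apply injective_projections; simpl; ring. }
  assert (D : forall n z, Cmod (picard_iter (S n) z - picard_iter n z) <= Cmod p0 / 2 ^ n).
  { induction n as [|n IH]; intro z.
    - simpl pow. simpl picard_iter. rewrite Rdiv_1_r.
      assert (Q0 : (p0 - RtoC 0)%C = p0) by ring.
      (* The first increment is estimated by contraction against the zero function, whose image is
         the constant [p0]. *)
      assert (Q := picard_contraction (fun _ => p0) (fun _ => RtoC 0) (Cmod p0)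
        (fun z => continuous_const _ z) (fun z => continuous_const _ z)
        (fun _ => Req_le _ _ (f_equal Cmod Q0)) z).
      rewrite Z in Q. eapply Rle_trans; [exact Q|lra].
    - assert (P2 := pow2_pos n).
      replace (Cmod p0 / 2 ^ S n) with ((Cmod p0 / 2 ^ n) / 2) by (simpl; field; lra).
      apply (picard_contraction (picard_iter (S n)) (picard_iter n)); auto. }
  assert (L : forall z, exists l, forall n, Cmod (picard_iter n z - l) <= 4 * Cmod p0 / 2 ^ n).
  { intro z. apply summable_limit; auto. }
  set (P := fun z => proj1_sig (constructive_indefinite_description _ (L z))).
  assert (HP : forall n z, Cmod (picard_iter n z - P z) <= 4 * Cmod p0 / 2 ^ n).
  { intros n z. unfold P. exact (proj2_sig (constructive_indefinite_description _ (L z)) n). }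
  assert (CP : forall z, Ccont P z).
  { apply (continuous_uniform_limit picard_iter P (4 * Cmod p0)); auto. lra. }
  exists P. split; [exact CP|]. split.
  - exists (5 * Cmod p0). intro z. specialize (HP 0%nat z). simpl in HP. rewrite Rdiv_1_r in HP.
    assert (T := Cmod_sub_lower (P z) p0). rewrite Cmod_minus_sym in T. lra.
  - intro z.
    apply Cminus_0_eq.
    apply (Cmod_small_0 _ 1). intros e He.
      destruct (pow2_small (8 * Cmod p0) e He) as [n Hn].
      replace (P z - picard_step P z)%C
        with ((picard_step (picard_iter n) z - picard_step P z) - (picard_iter (S n) z - P z))%C
        by (simpl; ring).
      eapply Rle_trans; [apply Cmod_triangle_minus|].
      assert (H1 := picard_contraction (picard_iter n) P _ (Cit n) CP (HP n) z).
      assert (H2 := HP (S n) z).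
      assert (P2 := pow2_pos n).
      replace (4 * Cmod p0 / 2 ^ S n) with (2 * Cmod p0 / 2 ^ n) in H2 by (simpl; field; lra).
      replace (4 * Cmod p0 / 2 ^ n / 2) with (2 * Cmod p0 / 2 ^ n) in H1 by (field; lra).
      replace (8 * Cmod p0 / 2 ^ n) with (4 * (2 * Cmod p0 / 2 ^ n)) in Hn by (field; lra).
      assert (0 <= 2 * Cmod p0 / 2 ^ n) by (apply Rdiv_le_0_compat; lra).
      lra.
Qed.
End Picard.

Definition C1_partials (X : C -> Prop) (a ax ay : C -> C) : Prop := forall w, X w ->
  rder (fun s => a (s, snd w)) (fst w) (ax w) /\ rder (fun s => a (fst w, s)) (snd w) (ay w) /\
  Ccont ax w /\ Ccont ay w /\ Ccont a w.

Lemma Rball_inner (x b w d : R) : Rabs (b - x) < d -> Rabs (w - x) < d ->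
  exists r, 0 < r /\ forall p, Rmin b w - r < p < Rmax b w + r -> Rabs (p - x) < d.
Proof.
  intros Hb Hw. exists (d - Rmax (Rabs (b - x)) (Rabs (w - x))).
  split; [apply Rlt_0_minus; now apply Rmax_lub_lt|]. intros p Hp.
  assert (L1 := Rmax_l (Rabs (b - x)) (Rabs (w - x))). assert (L2 := Rmax_r (Rabs (b - x)) (Rabs (w - x))).
  set (m := Rmax (Rabs (b - x)) (Rabs (w - x))) in *. clearbody m.
  apply Rabs_le_between in L1. apply Rabs_le_between in L2.
  unfold Rmin, Rmax in Hp. apply Rabs_def1; destruct (Rle_dec b w); lra.
Qed.

(** Supplies the margin that [rder_CInt_param] requires around the rectangle spanned by [b] and
    [w]. *)
Lemma ball_inner (z0 : C) (d : R) (b w : C) : ball z0 d b -> ball z0 d w ->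
  exists r, 0 < r /\ forall p : C,
    Rmin (fst b) (fst w) - r < fst p < Rmax (fst b) (fst w) + r ->
    Rmin (snd b) (snd w) - r < snd p < Rmax (snd b) (snd w) + r -> ball z0 d p.
Proof.
  intros Hb Hw. cball Hb B1 B2. cball Hw W1 W2.
  destruct (Rball_inner _ _ _ _ B1 W1) as [r1 [R1 K1]]. destruct (Rball_inner _ _ _ _ B2 W2) as [r2 [R2 K2]].
  assert (L1 := Rmin_l r1 r2). assert (L2 := Rmin_r r1 r2).
  exists (Rmin r1 r2). split; [now apply Rmin_glb_lt|].
  intros p P1 P2. apply Cball_iff; split; [apply K1|apply K2]; lra.
Qed.

(** * Compatibility: the Picard fixed point is holomorphic *)

Section Flat.
Variables (a ax ay c cx cy : C -> C) (K d : R) (z0 b p0 : C).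
Hypothesis Hd : 0 < d.
Hypothesis HK : 0 < K.
Hypothesis HKd : 32 * K * d <= 1.
Hypothesis Hd1 : d <= 1 / 4.
Hypothesis Da : C1_partials (ball z0 d) a ax ay.
Hypothesis Dc : C1_partials (ball z0 d) c cx cy.
Hypothesis Bax : forall w, ball z0 d w -> Cmod (ax w) <= K.
Hypothesis Bcx : forall w, ball z0 d w -> Cmod (cx w) <= K.
Hypothesis Ba : forall w, ball z0 d w -> Cmod (a w) <= K.
Hypothesis Bc : forall w, ball z0 d w -> Cmod (c w) <= K.
Hypothesis Hb : ball z0 d b.
(** As [i d/dx - d/dy = 2 i d/dzbar], the two conditions read [a_zbar = - |c|^2] and
    [c_zbar = - c conj a]. *)
Hypothesis flat_a : forall w, ball z0 d w -> (Ci * ax w - ay w)%C = (- (RtoC 2 * Ci * c w * Cconj (c w)))%C.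
Hypothesis flat_c : forall w, ball z0 d w -> (Ci * cx w - cy w)%C = (- (RtoC 2 * Ci * c w * Cconj (a w)))%C.
(** [W] is the right-hand side with clamped coefficients: continuous on the whole plane, so that its
    integrals exist without side conditions, and equal to [rhs a c P] on the ball. *)
Variables (W P : C -> C) (M0 : R).
Hypothesis CW : forall z, Ccont W z.
Hypothesis CP : forall z, Ccont P z.
Hypothesis BP : forall z, Cmod (P z) <= M0.
Hypothesis BW : forall z, Cmod (W z) <= 2 * K * M0.
Hypothesis WE : forall z, ball z0 d z -> W z = rhs a c P z.
Hypothesis PE : forall z, ball z0 d z ->
  P z = (p0 + CInt (fun s => W (s, snd b)) (fst b) (fst z) + Ci * CInt (fun t => W (fst z, t)) (snd b) (snd z))%C.

(* [P] solves the equation in the y-direction by construction.  [Pt] solves it in the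
   x-direction, and by the compatibility conditions their difference [G] obeys a homogeneous
   linear integral inequality in [y], hence vanishes. *)
Let Pt (z : C) : C := (P (fst b, snd z) + CInt (fun s => W (s, snd z)) (fst b) (fst z))%C.
Let G (z : C) : C := (Pt z - P z)%C.

Let cWh : forall y a' b', cont_between (fun s => W (s, y)) a' b'.
Proof. intros y a' b' t _. apply continuous_horizontal, CW. Qed.
Let Bl (w : C) (Hw : ball z0 d w) : ball z0 d ((fst b, snd w) : C).
Proof.
  apply (ball_box z0 b w); auto; simpl; apply between_iff; lra.
Qed.

Let Pt_x (x y : R) : rder (fun s => Pt (s, y)) x (W (x, y)).
Proof.
  unfold Pt; simpl. eapply rder_eq.
  - apply rder_plus; [apply rder_const|]. apply (rder_CInt _ _ _ 1); [lra|].
    intros; apply continuous_horizontal, CW.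
  - simpl; ring.
Qed.

Let P_y (x y : R) : ball z0 d ((x, y) : C) -> rder (fun t => P (x, t)) y (Ci * W (x, y))%C.
Proof.
  intro Hw. destruct (open_ball_sub _ _ (ball_open z0 d) Hw) as [r [Hr Hs]].
  apply (rder_ext_loc (fun t => (p0 + CInt (fun s => W (s, snd b)) (fst b) x + Ci * CInt (fun t => W (x, t)) (snd b) t)%C) _ _ _ r); auto.
  - intros t Ht. rewrite PE; auto. apply Hs, Cball_iff; simpl. rewrite Rminus_diag, Rabs_R0; auto.
  - eapply rder_eq.
    + apply rder_plus; [apply rder_const|]. apply rder_mult; [apply rder_const|].
      apply (rder_CInt _ _ _ 1); [lra|]. intros; apply continuous_vertical, CW.
    + simpl; ring.
Qed.

Let Wy (z : C) : C :=
  (ay z * P z + a z * (Ci * W z) + cy z * Cconj (P z) + c z * Cconj (Ci * W z))%C.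

Let W_y (x y : R) : ball z0 d ((x, y) : C) -> rder (fun t => W (x, t)) y (Wy (x, y)).
Proof.
  intro Hw. destruct (open_ball_sub _ _ (ball_open z0 d) Hw) as [r [Hr Hs]].
  apply (rder_ext_loc (fun t => rhs a c P (x, t)) _ _ _ r); auto.
  - intros t Ht. rewrite WE; auto. apply Hs, Cball_iff; simpl. rewrite Rminus_diag, Rabs_R0; auto.
  - destruct (Da _ Hw) as (_ & D1 & _). destruct (Dc _ Hw) as (_ & D2 & _). simpl in D1, D2.
    unfold rhs. eapply rder_eq.
    + apply rder_plus; apply rder_mult; [exact D1|now apply P_y|exact D2|apply rder_conj; now apply P_y].
    + unfold Wy. ring.
Qed.

Let Wy_cont (z : C) : ball z0 d z -> Ccont Wy z.
Proof.
  intro Hz. destruct (Da _ Hz) as (_ & _ & _ & C1 & C2). destruct (Dc _ Hz) as (_ & _ & _ & C3 & C4).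
  unfold Wy. ccont.
Qed.

Let G_base (x : R) : ball z0 d ((x, snd b) : C) -> G (x, snd b) = RtoC 0.
Proof.
  intro H. unfold G, Pt; simpl.
  rewrite (PE _ H). assert (E := PE _ (Bl _ Hb)). simpl in E. rewrite E. simpl.
  rewrite !CInt_point. ring.
Qed.

(** Under the integral, the compatibility conditions turn [Wy] into [Ci * I1 - Ci * I2]. Here [I1]
    is the x-derivative of [rhs a c Pt] and integrates to boundary terms, while [I2] involves [G]
    alone. *)
Let G_y (z : C) : ball z0 d z -> rder (fun t => G (fst z, t)) (snd z)
  (Ci * (a z * G z + c z * Cconj (G z)) -
   Ci * CInt (fun s => ax (s, snd z) * G (s, snd z) + cx (s, snd z) * Cconj (G (s, snd z))) (fst b) (fst z))%C.
Proof.
  intro Hz. destruct z as [x y]. simpl fst; simpl snd.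
  assert (Hin : forall s, between (fst b) x s -> ball z0 d ((s, y) : C)).
  { intros s Hs. apply (ball_box z0 b (x, y)); auto. apply between_iff; simpl; lra. }
  destruct (ball_inner z0 d b (x, y) Hb Hz) as [r [Hr Hri]]. simpl in Hri.
  assert (Ptc : forall s, Rcont (fun s => Pt (s, y)) s) by (intro s; eapply rder_cont, Pt_x).
  assert (Pc : forall s, Rcont (fun s => P (s, y)) s) by (intro s; apply continuous_horizontal, CP).
  assert (Wc : forall s, Rcont (fun s => W (s, y)) s) by (intro s; apply continuous_horizontal, CW).
  assert (Gc : forall s, Rcont (fun s => G (s, y)) s) by (intro s; apply (@continuous_Cminus R_UniformSpace); auto).
  set (I1 := fun s => (ax (s, y) * Pt (s, y) + a (s, y) * W (s, y) + (cx (s, y) * Cconj (Pt (s, y)) + c (s, y) * Cconj (W (s, y))))%C).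
  set (I2 := fun s => (ax (s, y) * G (s, y) + cx (s, y) * Cconj (G (s, y)))%C).
  assert (CI1 : cont_between I1 (fst b) x).
  { intros s Hs. destruct (Da _ (Hin s Hs)) as (_ & _ & C1 & _ & C2). destruct (Dc _ (Hin s Hs)) as (_ & _ & C3 & _ & C4).
    apply continuous_horizontal in C1, C2, C3, C4.
    unfold I1. ccont. }
  assert (CI2 : cont_between I2 (fst b) x).
  { intros s Hs. destruct (Da _ (Hin s Hs)) as (_ & _ & C1 & _ & C2). destruct (Dc _ (Hin s Hs)) as (_ & _ & C3 & _ & C4).
    apply continuous_horizontal in C1, C2, C3, C4.
    unfold I2. ccont. }
  assert (E1 : CInt I1 (fst b) x = (rhs a c Pt (x, y) - rhs a c Pt (fst b, y))%C).
  { apply (CInt_derive (fun s => rhs a c Pt (s, y))); auto.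
    intros s Hs. destruct (Da _ (Hin s Hs)) as (D1 & _). destruct (Dc _ (Hin s Hs)) as (D2 & _).
    simpl in D1, D2. unfold rhs, I1. eapply rder_eq.
    - apply rder_plus; apply rder_mult; [exact D1|apply Pt_x|exact D2|apply rder_conj, Pt_x].
    - cbn beta; ring. }
  assert (E2 : CInt (fun s => Wy (s, y)) (fst b) x = (Ci * CInt I1 (fst b) x - Ci * CInt I2 (fst b) x)%C).
  { rewrite <- !CInt_scal, <- CInt_minus; auto; try (apply cont_between_mult; [apply cont_between_const|auto]).
    apply CInt_ext. intros s Hs. assert (Hw := Hin s Hs).
    assert (Fa := flat_a _ Hw). assert (Fc := flat_c _ Hw).
    assert (Fa' : ay (s, y) = (Ci * ax (s, y) + RtoC 2 * Ci * c (s, y) * Cconj (c (s, y)))%C).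
    { replace (ay (s, y)) with (Ci * ax (s, y) - (Ci * ax (s, y) - ay (s, y)))%C by ring. rewrite Fa. ring. }
    assert (Fc' : cy (s, y) = (Ci * cx (s, y) + RtoC 2 * Ci * c (s, y) * Cconj (a (s, y)))%C).
    { replace (cy (s, y)) with (Ci * cx (s, y) - (Ci * cx (s, y) - cy (s, y)))%C by ring. rewrite Fc. ring. }
    unfold Wy, I1, I2. rewrite (WE _ Hw), Fa', Fc'. unfold rhs, G.
    rewrite ?Cplus_conj, ?Cmult_conj, ?Cminus_conj, ?Cplus_conj, ?Cmult_conj, ?Cconj_conj.
    replace (Cconj Ci) with (- Ci)%C by (apply injective_projections; simpl; ring).
    ring. }
  assert (Hl := Bl _ Hz). simpl in Hl.
  unfold G at 1, Pt. simpl fst; simpl snd.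
  eapply rder_eq.
  - apply rder_minus; [|apply P_y; auto]. apply rder_plus; [apply P_y; auto|].
    apply (rder_CInt_param (fun y s => W (s, y)) (fun y s => Wy (s, y)) (fst b) x y r); auto.
    + intros y' s Hy' Hs. split; [|apply continuous_horizontal, CW].
      apply W_y. apply Hri; simpl; auto.
      apply Rabs_def2 in Hy' as [? ?]. assert (T1 := Rmin_r (snd b) y). assert (T2 := Rmax_r (snd b) y). lra.
    + intros s Hs. apply (continuous_to_pair Wy snd fst (y, s)).
      * apply (@continuous_snd R_UniformSpace R_UniformSpace).
      * apply (@continuous_fst R_UniformSpace R_UniformSpace).
      * simpl. apply Wy_cont, Hin, Hs.
  - cbn beta. rewrite E2, E1. fold I2.
    assert (EP : Pt (fst b, y) = P (fst b, y)) by (unfold Pt; simpl; rewrite CInt_point; ring).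
    rewrite (WE _ Hl), (WE _ Hz). unfold rhs. rewrite EP. unfold G.
    rewrite Cminus_conj. ring.
Qed.

(** The y-derivative of [G] is at most [4 K M]: [2 K M] from the pointwise term, and
    [8 K M d <= 2 K M] from the integral because [d <= 1 / 4]. Starting from [G_base], a height of
    at most [2 d] gives [16 K d M <= M / 2]. *)
Let G_halve (M : R) : (forall z, ball z0 d z -> Cmod (G z) <= M) ->
  forall z, ball z0 d z -> Cmod (G z) <= M / 2.
Proof.
  intros HM z Hz.
  assert (M0' : 0 <= M) by (eapply Rle_trans; [apply Cmod_ge_0|apply (HM z Hz)]).
  assert (KM : 0 <= K * M) by (apply Rmult_le_pos; lra).
  cball Hz Z1 Z2. cball Hb B1 B2.
  assert (D1 : Rabs (fst z - fst b) <= 2 * d) by (apply (Rabs_diam (fst z0)); lra).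
  assert (D2 : Rabs (snd z - snd b) <= 2 * d) by (apply (Rabs_diam (snd z0)); lra).
  assert (Hcol : forall t, between (snd b) (snd z) t -> ball z0 d ((fst z, t) : C)).
  { intros t Ht. apply (ball_box z0 b z); auto. apply between_iff; simpl; lra. }
  assert (Bd : forall u v g : C, Cmod u <= K -> Cmod v <= K -> Cmod g <= M -> Cmod (u * g + v * Cconj g) <= 2 * K * M).
  { intros u v g Hu Hv Hg. eapply Rle_trans; [apply Cmod_triangle|]. rewrite !Cmod_mult, Cmod_conj.
    assert (Cmod u * Cmod g <= K * M) by (apply Rmult_le_compat; auto; apply Cmod_ge_0).
    assert (Cmod v * Cmod g <= K * M) by (apply Rmult_le_compat; auto; apply Cmod_ge_0). lra. }
  assert (E : Cmod (G (fst z, snd z) - G (fst z, snd b)) <= 2 * (4 * K * M) * Rabs (snd z - snd b)).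
  { apply (rder_bound (fun t => G (fst z, t)) (fun t =>
      (Ci * (a (fst z, t) * G (fst z, t) + c (fst z, t) * Cconj (G (fst z, t))) -
       Ci * CInt (fun s => ax (s, t) * G (s, t) + cx (s, t) * Cconj (G (s, t))) (fst b) (fst z))%C)).
    - intros t Ht. apply (G_y (fst z, t)). now apply Hcol.
    - intros t Ht. assert (Hw := Hcol t Ht).
      assert (Hrow : forall s, between (fst b) (fst z) s -> ball z0 d ((s, t) : C)).
      { intros s Hs. apply (ball_box z0 b (fst z, t)); auto. apply between_iff; simpl; lra. }
      eapply Rle_trans; [apply Cmod_triangle_minus|]. rewrite !Cmod_mult, Cmod_Ci, !Rmult_1_l.
      assert (Q1 := Bd _ _ _ (Ba _ Hw) (Bc _ Hw) (HM _ Hw)).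
      assert (Q2 : Cmod (CInt (fun s => ax (s, t) * G (s, t) + cx (s, t) * Cconj (G (s, t)))%C (fst b) (fst z)) <= 2 * (2 * K * M) * Rabs (fst z - fst b)).
      { apply CInt_bound.
        - intros s Hs. destruct (Da _ (Hrow s Hs)) as (_ & _ & C1 & _ & _). destruct (Dc _ (Hrow s Hs)) as (_ & _ & C3 & _ & _).
          apply continuous_horizontal in C1, C3.
          assert (Gc : Rcont (fun s => G (s, t)) s).
          { apply (@continuous_Cminus R_UniformSpace); [eapply rder_cont, Pt_x|apply continuous_horizontal, CP]. }
          ccont.
        - intros s Hs. assert (Hs' := Hrow s Hs). apply Bd; auto. }
      assert (Q3 : K * M * Rabs (fst z - fst b) <= K * M * (2 * d)) by (apply Rmult_le_compat_l; auto).
      assert (Q4 : K * M * d <= K * M * (1 / 4)) by (apply Rmult_le_compat_l; auto).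
      lra. }
  rewrite G_base in E by (apply Hcol; apply between_iff; lra).
  replace (G (fst z, snd z) - RtoC 0)%C with (G z) in E by (destruct z; simpl; ring).
  assert (Q3 : K * M * Rabs (snd z - snd b) <= K * M * (2 * d)) by (apply Rmult_le_compat_l; auto).
  assert (Q4 : 32 * K * d * M <= 1 * M) by (apply Rmult_le_compat_r; auto).
  lra.
Qed.

Let G_zero (z : C) : ball z0 d z -> G z = RtoC 0.
Proof.
  intro Hz.
  set (M := 2 * M0 + 2 * (2 * K * M0) * (2 * d)).
  assert (B0 : forall w, ball z0 d w -> Cmod (G w) <= M).
  { intros w Hw. unfold G, Pt.
    cball Hw Z1 Z2. cball Hb B1 B2.
    assert (D1 : Rabs (fst w - fst b) <= 2 * d) by (apply (Rabs_diam (fst z0)); lra).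
    eapply Rle_trans; [apply Cmod_triangle_minus|].
    eapply Rle_trans; [apply Rplus_le_compat_r, Cmod_triangle|].
    assert (Q1 := BP (fst b, snd w)). assert (Q2 := BP w).
    assert (Q3 : Cmod (CInt (fun s => W (s, snd w)) (fst b) (fst w)) <= 2 * (2 * K * M0) * Rabs (fst w - fst b)).
    { apply CInt_bound; auto. }
    assert (M0p : 0 <= M0) by (eapply Rle_trans; [apply Cmod_ge_0|apply (BP w)]).
    assert (KM : 0 <= 2 * (2 * K * M0)) by (repeat apply Rmult_le_pos; lra).
    assert (Q4 := Rmult_le_compat_l _ _ _ KM D1). unfold M. lra. }
  assert (Bn : forall n w, ball z0 d w -> Cmod (G w) <= M / 2 ^ n).
  { induction n as [|n IH]; intros w Hw.
    - simpl. rewrite Rdiv_1_r. auto.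
    - replace (M / 2 ^ S n) with ((M / 2 ^ n) / 2) by (simpl; field; apply pow_nonzero; lra).
      apply G_halve; auto. }
  apply (Cmod_small_0 _ 1). intros e He. destruct (pow2_small M e He) as [n Hn].
  specialize (Bn n z Hz). lra.
Qed.

(** Since [G] vanishes, [P] coincides with [Pt] and inherits its x-derivative [W]; with the
    y-derivative [Ci * W] these are the Cauchy-Riemann equations. *)
Lemma flat_solution (z : C) : ball z0 d z -> cder P z (rhs a c P z).
Proof.
  intro Hz. rewrite <- WE by auto.
  destruct (open_ball_sub _ _ (ball_open z0 d) Hz) as [r [Hr Hs]].
  apply (cder_of_partials P W z r); auto.
  intros [x y] Hw. apply Hs in Hw. simpl fst; simpl snd. split; [|now apply P_y].
  destruct (open_ball_sub _ _ (ball_open z0 d) Hw) as [r' [Hr' Hs']].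
  apply (rder_ext_loc (fun s => Pt (s, y)) _ _ _ r'); auto.
  intros s Hs0. apply Cminus_0_eq. apply G_zero, Hs', Cball_iff; simpl. rewrite Rminus_diag, Rabs_R0; auto.
Qed.
End Flat.

Lemma local_bound (f : C -> C) (z : C) : Ccont f z ->
  exists r, 0 < r /\ forall w, ball z r w -> Cmod (f w) <= Cmod (f z) + 1.
Proof.
  intro H. destruct (continuous_C_eps _ _ H 1 Rlt_0_1) as [r [Hr K]].
  exists r; split; auto. intros w Hw. assert (T := Cmod_sub_lower (f w) (f z)). specialize (K w Hw). lra.
Qed.

Definition solves (a c P : C -> C) (X : C -> Prop) : Prop := forall w, X w -> cder P w (rhs a c P w).

(** Initial values may be prescribed at any point [b], not just at the centre, so that continuation
    can enter a ball anywhere. The bound [K] serves uniqueness by Gronwall's inequality. *)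
Definition good_ball (a c : C -> C) (z0 : C) (d : R) : Prop :=
  0 < d /\ (exists K, forall w, ball z0 d w -> Cmod (a w) <= K /\ Cmod (c w) <= K) /\
  forall b p0, ball z0 d b -> exists P, solves a c P (ball z0 d) /\ P b = p0.

Lemma local_solution (a ax ay c cx cy : C -> C) (z0 : C) (r0 : R) : 0 < r0 ->
  C1_partials (ball z0 r0) a ax ay -> C1_partials (ball z0 r0) c cx cy ->
  (forall w, ball z0 r0 w -> (Ci * ax w - ay w)%C = (- (RtoC 2 * Ci * c w * Cconj (c w)))%C) ->
  (forall w, ball z0 r0 w -> (Ci * cx w - cy w)%C = (- (RtoC 2 * Ci * c w * Cconj (a w)))%C) ->
  exists d, d <= r0 /\ good_ball a c z0 d.
Proof.
  intros Hr Da Dc Fa Fc.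
  assert (Hz : ball z0 r0 z0) by now apply ball_self.
  destruct (Da z0 Hz) as (_ & _ & C1 & _ & C2). destruct (Dc z0 Hz) as (_ & _ & C3 & _ & C4).
  destruct (local_bound _ _ C1) as [r1 [R1 L1]]. destruct (local_bound _ _ C2) as [r2 [R2 L2]].
  destruct (local_bound _ _ C3) as [r3 [R3 L3]]. destruct (local_bound _ _ C4) as [r4 [R4 L4]].
  set (K := 1 + Cmod (ax z0) + Cmod (a z0) + Cmod (cx z0) + Cmod (c z0)).
  assert (A1 := Cmod_ge_0 (ax z0)). assert (A2 := Cmod_ge_0 (a z0)).
  assert (A3 := Cmod_ge_0 (cx z0)). assert (A4 := Cmod_ge_0 (c z0)).
  assert (HK : 0 < K) by (unfold K; lra).
  set (dd := Rmin (Rmin r0 (Rmin r1 (Rmin r2 (Rmin r3 r4)))) (Rmin (1 / 4) (/ (32 * K)))).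
  assert (Hdd : 0 < dd).
  { repeat apply Rmin_glb_lt; auto; try lra. apply Rinv_0_lt_compat; lra. }
  (* Clamping maps onto the closed square of radius [d], which has to lie in the open ball of radius
     [dd] where the bounds hold. *)
  set (d := dd / 2).
  assert (Hd : 0 < d) by (unfold d; lra).
  assert (S0 : forall w, ball z0 dd w -> ball z0 r0 w /\ ball z0 r1 w /\ ball z0 r2 w /\ ball z0 r3 w /\ ball z0 r4 w).
  { intros w Hw. apply ball_Rmin in Hw as [Hw _]. apply ball_Rmin in Hw as [W0 Hw].
    apply ball_Rmin in Hw as [W1 Hw]. apply ball_Rmin in Hw as [W2 Hw]. apply ball_Rmin in Hw as [W3 W4]. auto. }
  assert (Sd : forall w, ball z0 d w -> ball z0 dd w).
  { intros w Hw. eapply ball_le; [|exact Hw]. unfold d; lra. }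
  assert (E1 : dd <= 1 / 4) by (eapply Rle_trans; [apply Rmin_r|apply Rmin_l]).
  assert (E2 : dd <= / (32 * K)) by (eapply Rle_trans; [apply Rmin_r|apply Rmin_r]).
  assert (E3 : 32 * K * dd <= 1).
  { apply Rle_trans with (32 * K * / (32 * K)); [apply Rmult_le_compat_l; lra|right; field; lra]. }
  assert (E4 : dd <= r0) by (eapply Rle_trans; [apply Rmin_l|apply Rmin_l]).
  assert (KE : 32 * K * d <= 1).
  { apply Rle_trans with (32 * K * dd); auto. apply Rmult_le_compat_l; [lra|unfold d; lra]. }
  assert (Bd : forall w, ball z0 dd w -> Cmod (ax w) <= K /\ Cmod (a w) <= K /\ Cmod (cx w) <= K /\ Cmod (c w) <= K).
  { intros w Hw. destruct (S0 w Hw) as (_ & W1 & W2 & W3 & W4).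
    specialize (L1 w W1). specialize (L2 w W2). specialize (L3 w W3). specialize (L4 w W4). unfold K; repeat split; lra. }
  exists d. split; [unfold d; lra|]. split; [exact Hd|]. split.
  { exists K. intros w Hw. split; apply Bd, Sd, Hw. }
  intros b p0 Hb.
  set (pi := clamp_square z0 d).
  assert (Hpi : forall z, ball z0 dd (pi z)).
  { intro z. apply Cball_iff. unfold pi, clamp_square; simpl.
    assert (T1 := clamp_in (fst z0) d (fst z) (Rlt_le _ _ Hd)). assert (T2 := clamp_in (snd z0) d (snd z) (Rlt_le _ _ Hd)).
    unfold d in *; split; lra. }
  set (a' := fun z => a (pi z)). set (c' := fun z => c (pi z)).
  assert (Ca' : forall z, Ccont a' z).
  { intro z. apply (continuous_Ccomp a pi); [apply clamp_square_continuous|].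
    apply Da. now apply S0. }
  assert (Cc' : forall z, Ccont c' z).
  { intro z. apply (continuous_Ccomp c pi); [apply clamp_square_continuous|].
    apply Dc. now apply S0. }
  assert (Ba' : forall z, Cmod (a' z) <= K) by (intro z; apply Bd, Hpi).
  assert (Bc' : forall z, Cmod (c' z) <= K) by (intro z; apply Bd, Hpi).
  destruct (picard_fixpoint a' c' K d z0 b p0) as [P [CP [[M0 BP] PE]]]; auto.
  assert (Epi : forall z, ball z0 d z -> pi z = z) by (intros z Hz'; now apply clamp_square_id).
  assert (PE' : forall z, ball z0 d z ->
    P z = (p0 + CInt (fun s => rhs a' c' P (s, snd b)) (fst b) (fst z)
           + Ci * CInt (fun t => rhs a' c' P (fst z, t)) (snd b) (snd z))%C).
  { intros z Hz'. rewrite PE at 1. unfold picard_step. cball Hz' Z1 Z2. now rewrite !clamp_id by lra. }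
  exists P. split.
  - intros w Hw.
    apply (flat_solution a ax ay c cx cy K d z0 b p0) with (W := rhs a' c' P) (M0 := M0); auto.
    + unfold d; lra.
    + intros v Hv. apply Da. now apply S0, Sd.
    + intros v Hv. apply Dc. now apply S0, Sd.
    + intros v Hv. apply Bd; auto.
    + intros v Hv. apply Bd; auto.
    + intros v Hv. apply Bd; auto.
    + intros v Hv. apply Bd; auto.
    + intros v Hv. apply Fa. now apply S0, Sd.
    + intros v Hv. apply Fc. now apply S0, Sd.
    + intro z. now apply rhs_continuous.
    + intro z. now apply rhs_bound.
    + intros z Hz'. unfold rhs, a', c'. now rewrite Epi.
  - rewrite PE' by auto. rewrite !CInt_point. apply injective_projections; simpl; ring.
Qed.

(** * Global solutions on simply connected domains *)

(** The factor [exp (- K * t)] makes the product with [e] nonincreasing. *)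
Lemma gronwall (e e' : R -> R) (K : R) :
  (forall t, 0 <= t <= 1 -> is_derive e t (e' t)) ->
  (forall t, 0 <= t <= 1 -> e' t <= K * e t) -> e 0 = 0 -> e 1 <= 0.
Proof.
  intros D B E0.
  assert (De : forall t, is_derive (fun t => exp (- K * t)) t (- K * exp (- K * t))).
  { intro t. auto_derive; auto. ring. }
  destruct (MVT_gen (fun t => e t * exp (- K * t)) 0 1
    (fun t => (e' t - K * e t) * exp (- K * t))) as [x [Hx Ex]].
  - intros t Ht. rewrite Rmin_left, Rmax_right in Ht by lra.
    replace ((e' t - K * e t) * exp (- K * t)) with (e' t * exp (- K * t) + e t * (- K * exp (- K * t))) by ring.
    apply (is_derive_Rmult e (fun t => exp (- K * t))); [apply D; lra|apply De].
  - intros t Ht. rewrite Rmin_left, Rmax_right in Ht by lra.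
    apply derivable_continuous_pt.
    exists ((e' t - K * e t) * exp (- K * t)). apply is_derive_Reals.
    replace ((e' t - K * e t) * exp (- K * t)) with (e' t * exp (- K * t) + e t * (- K * exp (- K * t))) by ring.
    apply (is_derive_Rmult e (fun t => exp (- K * t))); [apply D; lra|apply De].
  - rewrite Rmin_left, Rmax_right in Hx by lra. rewrite E0, Rmult_0_l, !Rminus_0_r in Ex.
    assert (Bx := B x Hx). assert (P1 := exp_pos (- K * x)). assert (P2 := exp_pos (- K * 1)).
    assert (Q : e 1 * exp (- K * 1) <= 0) by (rewrite Ex; nra).
    nra.
Qed.

Lemma rder_Cmod_sqr (f : R -> C) (t : R) (l : C) : rder f t l ->
  is_derive (fun s => Cmod (f s) ^ 2) t (2 * (fst (f t) * fst l + snd (f t) * snd l)).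
Proof.
  intros [H1 H2].
  apply (is_derive_ext (fun s => fst (f s) * fst (f s) + snd (f s) * snd (f s))).
  { intro s. rewrite Cmod_sqr. simpl. ring. }
  replace (2 * (fst (f t) * fst l + snd (f t) * snd l)) with
   ((fst l * fst (f t) + fst (f t) * fst l) + (snd l * snd (f t) + snd (f t) * snd l)) by ring.
  apply (@is_derive_plus R_AbsRing R_NormedModule); now apply is_derive_Rmult.
Qed.

Lemma dot_le (u v : C) : fst u * fst v + snd u * snd v <= Cmod u * Cmod v.
Proof.
  replace (fst u * fst v + snd u * snd v) with (fst (Cconj u * v)%C) by (simpl; ring).
  rewrite <- (Cmod_conj u), <- Cmod_mult. eapply Rle_trans; [apply Rle_abs|apply fst_le_Cmod].
Qed.

Lemma Cmod_sqr_le_0 (z : C) : Cmod z ^ 2 <= 0 -> z = RtoC 0.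
Proof.
  intro H. apply Cmod_eq_0. assert (P := Cmod_ge_0 z). nra.
Qed.

(** [rhs] is real-linear, so the difference solves the same equation. Gronwall's inequality is
    applied along the segment to the squared modulus, which unlike the modulus is differentiable at
    zeros. *)
Lemma solves_unique (a c P Q : C -> C) (X : C -> Prop) (K : R) (z w : C) : convex_set X ->
  (forall w, X w -> Cmod (a w) <= K /\ Cmod (c w) <= K) ->
  solves a c P X -> solves a c Q X -> X z -> X w -> P z = Q z -> P w = Q w.
Proof.
  intros HX HK HP HQ Hz Hw E.
  set (D := fun t => (P (segment z w t) - Q (segment z w t))%C).
  set (D' := fun t => (rhs a c (fun v => P v - Q v) (segment z w t) * (w - z))%C).
  assert (HD : forall t, 0 <= t <= 1 -> rder D t (D' t)).
  { intros t Ht. assert (Xt := HX z w t Hz Hw Ht). unfold D, D'. rewrite <- rhs_minus.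
    eapply rder_eq.
    - apply rder_minus; apply rder_segment_cder; [apply HP|apply HQ]; auto.
    - ring. }
  assert (G : Cmod (D 1) ^ 2 <= 0).
  { apply (gronwall (fun t => Cmod (D t) ^ 2) (fun t => 2 * (fst (D t) * fst (D' t) + snd (D t) * snd (D' t)))
      (4 * K * Cmod (w - z))).
    - intros t Ht. now apply rder_Cmod_sqr, HD.
    - intros t Ht. assert (Xt := HX z w t Hz Hw Ht). destruct (HK _ Xt) as [Ka Kc].
      assert (B1 := dot_le (D t) (D' t)).
      assert (B2 : Cmod (D' t) <= 2 * K * Cmod (D t) * Cmod (w - z)).
      { unfold D'. rewrite Cmod_mult. apply Rmult_le_compat_r; [apply Cmod_ge_0|].
        unfold rhs. fold (D t). eapply Rle_trans; [apply Cmod_triangle|].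
        rewrite !Cmod_mult, Cmod_conj. assert (P0 := Cmod_ge_0 (D t)).
        assert (Cmod (a (segment z w t)) * Cmod (D t) <= K * Cmod (D t)) by (apply Rmult_le_compat_r; auto).
        assert (Cmod (c (segment z w t)) * Cmod (D t) <= K * Cmod (D t)) by (apply Rmult_le_compat_r; auto).
        lra. }
      assert (P0 := Cmod_ge_0 (D t)).
      apply (Rmult_le_compat_l (Cmod (D t))) in B2; auto.
      replace (Cmod (D t) ^ 2) with (Cmod (D t) * Cmod (D t)) by ring. lra.
    - unfold D. rewrite segment_0, E. replace (Q z - Q z)%C with (RtoC 0) by ring. rewrite Cmod_0. ring. }
  apply Cmod_sqr_le_0 in G. unfold D in G. rewrite segment_1 in G. now apply Cminus_0_eq.
Qed.

(** Continuous induction: near the supremum of the points satisfying [Q], the property passes to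
    points on its right, so the supremum is [y]. *)
Lemma interval_induction (Q : R -> Prop) (x y : R) : x <= y -> Q x ->
  (forall t, x <= t <= y -> exists eta, 0 < eta /\ forall s s', x <= s <= y -> x <= s' <= y ->
     Rabs (s - t) < eta -> Rabs (s' - t) < eta -> Q s -> Q s') -> Q y.
Proof.
  intros Hxy Hx H.
  destruct (completeness (fun t => x <= t <= y /\ Q t)) as [m [M1 M2]].
  - exists y. intros t [Ht _]; lra.
  - exists x; split; auto; lra.
  - assert (Hm : x <= m <= y).
    { split; [apply M1; split; auto; lra|apply M2; intros t [Ht _]; lra]. }
    destruct (H m Hm) as [eta [He K]].
    assert (Hs : exists s, (x <= s <= y /\ Q s) /\ m - eta < s).
    { apply NNPP. intro N. assert (m <= m - eta); [|lra].
      apply M2. intros t Ht. apply Rnot_lt_le. intro L. apply N. exists t; auto. }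
    destruct Hs as [s [[Hs1 Hs2] Hs3]].
    assert (Hsm : s <= m) by (apply M1; auto).
    (* A point beyond [m] unless [m = y], and close enough to [m] for [Q] to pass to it from [s]. *)
    set (s' := Rmin y (m + eta / 2)).
    assert (S1 : s' <= y) by apply Rmin_l. assert (S2 : s' <= m + eta / 2) by apply Rmin_r.
    assert (S3 : m <= s') by (apply Rmin_glb; lra).
    assert (Q' : Q s').
    { apply (K s s'); auto; try lra; apply Rabs_def1; lra. }
    assert (s' <= m) by (apply M1; split; auto; lra).
    assert (s' = y).
    { unfold s', Rmin in *. destruct (Rle_dec y (m + eta / 2)); lra. }
    congruence.
Qed.

(** * Continuation of solutions along paths *)

Section Transport.
Variables (a c : C -> C).

(** A relation, as local solutions are only known to exist; [transport_fun] shows that the value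
    does not depend on the ball or the solution. *)
Definition transport (z v z' v' : C) : Prop := exists z0 d S, good_ball a c z0 d /\
  ball z0 d z /\ ball z0 d z' /\ solves a c S (ball z0 d) /\ S z = v /\ S z' = v'.

(** Two squares meet in a convex set, so agreement at one common point spreads over the whole
    overlap. *)
Lemma solves_unique_inter z1 d1 S1 z2 d2 S2 z w : good_ball a c z1 d1 -> good_ball a c z2 d2 ->
  solves a c S1 (ball z1 d1) -> solves a c S2 (ball z2 d2) ->
  ball z1 d1 z -> ball z2 d2 z -> ball z1 d1 w -> ball z2 d2 w -> S1 z = S2 z -> S1 w = S2 w.
Proof.
  intros (_ & [K HK] & _) _ H1 H2 Z1 Z2 W1 W2 E.
  apply (solves_unique a c S1 S2 (fun p => ball z1 d1 p /\ ball z2 d2 p) K z w); auto.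
  - apply convex_inter; apply ball_convex.
  - intros p [Hp _]; auto.
  - intros p [Hp _]; auto.
  - intros p [_ Hp]; auto.
Qed.

Lemma transport_fun z v z' v1 v2 : transport z v z' v1 -> transport z v z' v2 -> v1 = v2.
Proof.
  intros (p1 & d1 & S1 & G1 & A1 & B1 & H1 & E1 & F1) (p2 & d2 & S2 & G2 & A2 & B2 & H2 & E2 & F2).
  rewrite <- F1, <- F2. apply (solves_unique_inter p1 d1 S1 p2 d2 S2 z z'); auto. congruence.
Qed.

Lemma transport_sym z v z' v' : transport z v z' v' -> transport z' v' z v.
Proof. intros (p & d & S & H). exists p, d, S. tauto. Qed.

Lemma transport_exists p d z z' v : good_ball a c p d -> ball p d z -> ball p d z' ->
  exists v', transport z v z' v'.
Proof.
  intros G Hz Hz'. assert (G' := G). destruct G' as (G1 & G2 & G3). destruct (G3 z v Hz) as [S [HS E]].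
  exists (S z'), p, d, S. repeat (split; [solve [auto]|]); auto.
Qed.

Lemma transport_in p d z v z' v' S : good_ball a c p d -> solves a c S (ball p d) ->
  ball p d z -> ball p d z' -> S z = v -> transport z v z' v' -> S z' = v'.
Proof.
  intros G HS Hz Hz' E (p2 & d2 & S2 & G2 & A2 & B2 & H2 & E2 & F2).
  rewrite <- F2. apply (solves_unique_inter p d S p2 d2 S2 z z'); auto. congruence.
Qed.

Lemma transport_cell p d z00 z01 z10 z11 v00 v01 v10 v11 : good_ball a c p d ->
  ball p d z00 -> ball p d z01 -> ball p d z10 -> ball p d z11 ->
  transport z00 v00 z01 v01 -> transport z00 v00 z10 v10 -> transport z10 v10 z11 v11 ->
  transport z01 v01 z11 v11.
Proof.
  intros G H00 H01 H10 H11 T1 T2 T3. assert (G' := G). destruct G' as (_ & _ & G3).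
  destruct (G3 z00 v00 H00) as [S [HS E]].
  exists p, d, S. repeat (split; [solve [auto]|]). split.
  - apply (transport_in p d z00 v00 z01 v01 S); auto.
  - apply (transport_in p d z10 v10 z11 v11 S); auto.
    apply (transport_in p d z00 v00 z10 v10 S); auto.
Qed.

(** Continuation along [gamma]: locally in time, [L] is one local solution composed with [gamma].
    Time is the whole real line, so that no endpoint needs separate treatment. *)
Definition is_lift (gamma L : R -> C) : Prop := forall t, exists z0 d S,
  good_ball a c z0 d /\ solves a c S (ball z0 d) /\
  exists eta, 0 < eta /\ forall s, Rabs (s - t) < eta -> ball z0 d (gamma s) /\ L s = S (gamma s).

Lemma lift_affine gamma L alpha beta : is_lift gamma L ->
  is_lift (fun t => gamma (alpha * t + beta)) (fun t => L (alpha * t + beta)).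
Proof.
  intros H t. destruct (H (alpha * t + beta)) as (z0 & d & S & G & HS & eta & He & K).
  (* [alpha] may be negative, which reverses the path, or 0 for a path of duration 0; adding 1 keeps
     the divisor positive. *)
  exists z0, d, S. split; auto. split; auto. exists (eta / (Rabs alpha + 1)).
  assert (P := Rabs_pos alpha). split; [apply Rdiv_lt_0_compat; lra|].
  intros s Hs. apply K. replace (alpha * s + beta - (alpha * t + beta)) with (alpha * (s - t)) by ring.
  rewrite Rabs_mult. assert (P' := Rabs_pos (s - t)).
  apply Rle_lt_trans with ((Rabs alpha + 1) * Rabs (s - t)); [nra|].
  apply Rlt_le_trans with ((Rabs alpha + 1) * (eta / (Rabs alpha + 1))).
  - apply Rmult_lt_compat_l; lra.
  - right; field; lra.
Qed.

(** The link from continuous to discrete continuation: while the path stays in one good ball, the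
    lift follows a single solution on that ball. *)
Lemma lift_transport gamma L p d s1 s2 : is_lift gamma L -> good_ball a c p d -> s1 <= s2 ->
  (forall t, s1 <= t <= s2 -> ball p d (gamma t)) -> transport (gamma s1) (L s1) (gamma s2) (L s2).
Proof.
  intros HL G Hs Hin. assert (G' := G). destruct G' as (_ & _ & G3).
  destruct (G3 (gamma s1) (L s1) (Hin s1 ltac:(lra))) as [S [HS E]].
  exists p, d, S. repeat (split; [solve [auto | apply Hin; lra]|]).
  symmetry. apply (interval_induction (fun t => L t = S (gamma t)) s1 s2); auto.
  intros t Ht. destruct (HL t) as (z0 & d0 & S0 & G0 & HS0 & eta & He & K).
  exists eta; split; auto. intros s s' I1 I2 J1 J2 Q.
  destruct (K s J1) as [A1 B1]. destruct (K s' J2) as [A2 B2].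
  rewrite B2. apply (solves_unique_inter z0 d0 S0 p d S (gamma s) (gamma s')); auto. congruence.
Qed.

Variables (Omega : C -> Prop) (z0 v0 : C).
Hypothesis HOmega : simply_connected_domain Omega.
Hypothesis Hgood : forall z, Omega z -> exists d, good_ball a c z d /\ forall w, ball z d w -> Omega w.
Hypothesis Hz0 : Omega z0.

(* Paths are constant before time 0 and after time [n], so that following [g1] to [z] and then
   [g2] backwards is the sum of the two reparametrised paths minus [z]. *)
Definition lifted_path (gamma L : R -> C) (n : R) (z v : C) : Prop :=
  0 <= n /\ (forall t, Rcont gamma t) /\ (forall t, Omega (gamma t)) /\ is_lift gamma L /\
  (forall t, t <= 0 -> gamma t = z0) /\ (forall t, n <= t -> gamma t = z) /\ L 0 = v0 /\ L n = v.

Definition reach (z v : C) : Prop := exists gamma L n, lifted_path gamma L n z v.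

Let good_center z d : good_ball a c z d -> ball z d z.
Proof. intros [H _]. now apply ball_self. Qed.

Lemma reach_base : reach z0 v0.
Proof.
  exists (fun _ => z0), (fun _ => v0), 0. split; [lra|]. split; [intro; apply continuous_const|].
  split; auto. split; [|repeat split; auto].
  intro t. destruct (Hgood z0 Hz0) as [d [G Hs]].
  assert (G' := G). destruct G' as (_ & _ & G3).
  destruct (G3 z0 v0 (good_center _ _ G)) as [S [HS E]].
  exists z0, d, S. split; auto. split; auto. exists 1. split; [lra|]. intros; split; auto.
Qed.

(** The segment from [z] to [w] is appended to the path, inside the ball on which [S] is defined. *)
Lemma reach_extend z v w v' p d S : reach z v -> good_ball a c p d -> (forall w, ball p d w -> Omega w) ->
  solves a c S (ball p d) -> ball p d z -> ball p d w -> S z = v -> S w = v' -> reach w v'.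
Proof.
  intros (gamma & L & n & Hn & Hc & HO & HL & H0 & H1 & E0 & E1) G Hsub HS Hz Hw Ez Ew.
  (* Clock of the appended segment: 0 up to time [n], 1 from time [n + 1] on. *)
  set (cl := fun t => Rmax 0 (Rmin 1 (t - n))).
  assert (Cl0 : forall t, t <= n -> cl t = 0).
  { intros t Ht. unfold cl, Rmax, Rmin. destruct (Rle_dec 1 (t - n)); destruct (Rle_dec _ _); lra. }
  assert (Cl1 : forall t, n + 1 <= t -> cl t = 1).
  { intros t Ht. unfold cl, Rmax, Rmin. destruct (Rle_dec 1 (t - n)); destruct (Rle_dec _ _); lra. }
  assert (Cl : forall t, 0 <= cl t <= 1).
  { intros t. unfold cl, Rmax, Rmin. destruct (Rle_dec 1 (t - n)); destruct (Rle_dec _ _); lra. }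
  assert (Clc : forall t, continuous cl t).
  { intro t. intros P [e He]. exists e. intros s Hs. apply He. change (Rabs (cl s - cl t) < e).
    eapply Rle_lt_trans; [|exact Hs]. change (Rabs (cl s - cl t) <= Rabs (s - t)).
    unfold cl, Rmax, Rmin, Rabs. repeat (destruct (Rle_dec _ _)); repeat (destruct (Rcase_abs _)); lra. }
  set (g := fun t => (gamma t + RtoC (cl t) * (w - z))%C).
  set (L' := fun t => if Rle_dec t n then L t else S (g t)).
  assert (gl : forall t, t <= n -> g t = gamma t).
  { intros t Ht. unfold g. rewrite Cl0 by auto. ring. }
  assert (gr : forall t, n <= t -> g t = segment z w (cl t)).
  { intros t Ht. unfold g, segment. now rewrite H1. }
  assert (gc : forall t, Rcont g t).
  { intro t. unfold g. ccont. now apply continuous_RtoC. }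
  assert (gB : forall t, n <= t -> ball p d (g t)).
  { intros t Ht. rewrite gr by auto. apply ball_convex; auto. }
  exists g, L', (n + 1). split; [lra|]. split; auto. split.
  { intro t. destruct (Rle_dec t n) as [Ht|Ht]; [rewrite gl; auto|]. apply Hsub, gB. lra. }
  split; [|split; [|split; [|split]]].
  - intro t. destruct (Rtotal_order t n) as [Ht|[Ht|Ht]].
    + destruct (HL t) as (z1 & d1 & S1 & G1 & HS1 & eta & He & K).
      exists z1, d1, S1. split; auto. split; auto. exists (Rmin eta (n - t)).
      split; [apply Rmin_glb_lt; lra|]. intros s Hs.
      assert (s <= n). { assert (T := Rlt_le_trans _ _ _ Hs (Rmin_r _ _)). apply Rabs_def2 in T; lra. }
      rewrite gl by auto. unfold L'. destruct (Rle_dec s n); [|lra].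
      apply K. eapply Rlt_le_trans; [exact Hs|apply Rmin_l].
    (* At the junction the old lift must be expressed by [S] for times just before [n]; both local
       solutions take the value [v] at [z], so they agree on the overlap. *)
    + subst t. destruct (HL n) as (z1 & d1 & S1 & G1 & HS1 & eta & He & K).
      exists p, d, S. split; auto. split; auto.
      destruct (open_ball_sub _ _ (ball_open p d) (gB n (Rle_refl _))) as [r [Hr Hrs]].
      destruct (continuous_C_eps g n (gc n) r Hr) as [e2 [He2 K2]].
      exists (Rmin eta e2). split; [now apply Rmin_glb_lt|]. intros s Hs.
      assert (Hs1 := Rlt_le_trans _ _ _ Hs (Rmin_l _ _)). assert (Hs2 := Rlt_le_trans _ _ _ Hs (Rmin_r _ _)).
      assert (Bs : ball p d (g s)) by (apply Hrs, Cball_of_Cmod, K2, Hs2).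
      split; auto. unfold L'. destruct (Rle_dec s n) as [Hsn|Hsn]; auto.
      rewrite gl in Bs |- * by auto.
      destruct (K s Hs1) as [A1 B1]. rewrite B1.
      destruct (K n ltac:(rewrite Rminus_diag, Rabs_R0; auto)) as [A2 B2].
      apply (solves_unique_inter z1 d1 S1 p d S (gamma n) (gamma s)); auto.
      * rewrite H1 by lra; auto.
      * rewrite <- B2, E1, H1 by lra. auto.
    + exists p, d, S. split; auto. split; auto. exists (t - n). split; [lra|]. intros s Hs.
      apply Rabs_def2 in Hs. unfold L'. destruct (Rle_dec s n); [lra|]. split; auto. apply gB; lra.
  - intros t Ht. rewrite gl by lra. auto.
  - intros t Ht. rewrite gr by lra. rewrite Cl1 by lra. apply segment_1.
  - unfold L'. destruct (Rle_dec 0 n); [auto|lra].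
  - unfold L'. destruct (Rle_dec (n + 1) n); [lra|]. rewrite gr, Cl1, segment_1 by lra. auto.
Qed.

(** A good ball about a point is reachable as a whole as soon as one of its points is; hence
    reachable and unreachable points form two open sets, and connectedness applies. *)
Lemma reach_all z : Omega z -> exists v, reach z v.
Proof.
  intro Hz. destruct HOmega as [[_ [HOo Hconn]] _].
  apply NNPP. intro N.
  destruct (Hconn (fun w => Omega w /\ exists v, reach w v) (fun w => Omega w /\ ~ exists v, reach w v))
    as [w [_ [[_ W1] [_ W2]]]]; auto.
  - intros w [Hw [v Hv]]. destruct (Hgood w Hw) as [d [G Hs]].
    assert (G' := G). destruct G' as (Hd & _ & G3).
    exists (mkposreal d Hd). intros p Hp. simpl in Hp. split; auto.
    destruct (G3 w v (good_center _ _ G)) as [S [HS E]].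
    exists (S p). apply (reach_extend w v p (S p) w d S); auto.
  - intros w [Hw Nw]. destruct (Hgood w Hw) as [d [G Hs]].
    assert (G' := G). destruct G' as (Hd & _ & G3).
    exists (mkposreal d Hd). intros p Hp. simpl in Hp. split; auto. intros [v Hv].
    apply Nw. destruct (G3 p v Hp) as [S [HS E]].
    exists (S w). apply (reach_extend p v w (S w) w d S); auto.
  - intros w Hw. destruct (classic (exists v, reach w v)); [left|right]; split; auto.
  - exists z0; repeat split; auto. exists v0. apply reach_base.
  - exists z; repeat split; auto.
Qed.

(** A Lebesgue number for the covering of the parameter square by preimages of good balls. *)
Lemma grid_cover (H : R * R -> C) :
  @continuous_on (prod_UniformSpace R_UniformSpace R_UniformSpace) C_UniformSpace unit_square H ->
  maps_to H unit_square Omega ->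
  exists eta, 0 < eta /\ forall s t, unit_square (s, t) -> exists p d, good_ball a c p d /\
    forall s' t', unit_square (s', t') -> Rabs (s' - s) <= eta -> Rabs (t' - t) <= eta -> ball p d (H (s', t')).
Proof.
  intros Hc Hm.
  (* The radius is doubled because compactness places [(s, t)] within [delta] of some [(u, v)],
     while a point near [(s, t)] must still be mapped into the ball chosen for [(u, v)]. *)
  assert (Loc : forall s t, exists delta : posreal, unit_square (s, t) -> exists p d, good_ball a c p d /\
    forall s' t', unit_square (s', t') -> Rabs (s' - s) < 2 * delta -> Rabs (t' - t) < 2 * delta ->
      ball p d (H (s', t'))).
  { intros s t. destruct (classic (unit_square (s, t))) as [U|U].
    - destruct (Hgood _ (Hm _ U)) as [d [G Hs]].
      destruct (Hc (s, t) U (ball (H (s, t)) d)) as [e He].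
      { destruct G as [Gd _]. exists (mkposreal d Gd). auto. }
      assert (Hp : 0 < e / 2) by (destruct e as [e0 Pe]; simpl; lra).
      exists (mkposreal (e / 2) Hp). intros _. exists (H (s, t)), d. split; auto.
      intros s' t' U' H1 H2. simpl in H1, H2. apply He; auto.
      split; [change (Rabs (s' - s) < e)|change (Rabs (t' - t) < e)]; lra.
    - exists (mkposreal 1 Rlt_0_1). tauto. }
  set (delta := fun s t => proj1_sig (constructive_indefinite_description _ (Loc s t))).
  destruct (compactness_value_2d 0 1 0 1 delta) as [d Hd].
  exists (d / 2). split; [apply is_pos_div_2|]. intros s t U.
  apply NNPP. intro N. apply (Hd s t (proj1 U) (proj2 U)). intros (u & v & Hu & Hv & D1 & D2 & D3).
  apply N.
  assert (X := proj2_sig (constructive_indefinite_description _ (Loc u v))). unfold delta in D1, D2, D3.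
  destruct X as (p & d0 & G & K); [split; auto|].
  exists p, d0. split; auto. intros s' t' U' S1 S2.
  assert (Pd := cond_pos d).
  apply K; auto.
  - replace (s' - u) with ((s' - s) + (s - u)) by ring. eapply Rle_lt_trans; [apply Rabs_triang|lra].
  - replace (t' - v) with ((t' - t) + (t - v)) by ring. eapply Rle_lt_trans; [apply Rabs_triang|lra].
Qed.

(* [H] is a homotopy contracting a loop at [z0], sampled on a grid so fine that every cell lies
   in a good ball: transport along consecutive rows then agrees, and the last row is constant. *)
Section Grid.
Variables (H : R * R -> C) (N : nat).
Hypothesis HN : (0 < N)%nat.
Let g (j k : nat) : C := H (INR j / INR N, INR k / INR N).
Hypothesis Hcell : forall j k, (j < N)%nat -> (k < N)%nat -> exists p d, good_ball a c p d /\
  ball p d (g j k) /\ ball p d (g j (S k)) /\ ball p d (g (S j) k) /\ ball p d (g (S j) (S k)).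
Hypothesis Hleft : forall j, (j <= N)%nat -> g j 0 = z0.
Hypothesis Hright : forall j, (j <= N)%nat -> g j N = z0.
Hypothesis Htop : forall k, (k <= N)%nat -> g N k = z0.

Definition row (j : nat) (v : nat -> C) : Prop :=
  v 0%nat = v0 /\ forall k, (k < N)%nat -> transport (g j k) (v k) (g j (S k)) (v (S k)).

Lemma row_exists j : (j <= N)%nat -> exists v, row j v.
Proof.
  intro Hj.
  assert (A : forall m, (m <= N)%nat -> exists v, v 0%nat = v0 /\
    forall k, (k < m)%nat -> transport (g j k) (v k) (g j (S k)) (v (S k))).
  { induction m as [|m IH]; intro Hm.
    - exists (fun _ => v0). split; auto. intros; lia.
    - destruct IH as [v [Hv0 Hv]]; [lia|].
      assert (T : exists v', transport (g j m) (v m) (g j (S m)) v').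
      (* The last row starts no cells of its own; it is the far side of the cells of index
         [N - 1]. *)
      { destruct (Nat.eq_dec j N) as [->|Nj].
        - destruct N as [|N']; [lia|].
          destruct (Hcell N' m) as (p & d & G & _ & _ & B3 & B4); [lia|lia|].
          now apply (transport_exists p d).
        - destruct (Hcell j m) as (p & d & G & B1 & B2 & _ & _); [lia|lia|].
          now apply (transport_exists p d). }
      destruct T as [v' T].
      exists (fun k => if Nat.eq_dec k (S m) then v' else v k). split.
      + destruct (Nat.eq_dec 0 (S m)); [lia|auto].
      + intros k Hk. destruct (Nat.eq_dec (S k) (S m)) as [E|E].
        * assert (k = m) by lia. subst k. destruct (Nat.eq_dec m (S m)); [lia|auto].
        * destruct (Nat.eq_dec k (S m)); [lia|]. apply Hv; lia. }
  apply (A N (le_n N)).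
Qed.

Lemma row_step j v v' : (j < N)%nat -> row j v -> row (S j) v' -> v N = v' N.
Proof.
  intros Hj [V0 V] [V0' V'].
  destruct (Hgood z0 Hz0) as [d [G Hs]].
  assert (T : forall k, (k <= N)%nat -> transport (g j k) (v k) (g (S j) k) (v' k)).
  { induction k as [|k IH]; intro Hk.
    - rewrite V0, V0', !Hleft by lia. assert (G' := G). destruct G' as (G1 & G2 & G3).
      destruct (G3 z0 v0 (good_center _ _ G)) as [S [HS E]].
      exists z0, d, S. repeat (split; [solve [auto]|]); auto.
    - destruct (Hcell j k) as (p & e & G' & B1 & B2 & B3 & B4); [lia|lia|].
      apply (transport_cell p e (g j k) (g j (S k)) (g (S j) k) (g (S j) (S k)) (v k) (v (S k)) (v' k) (v' (S k))); auto.
      apply IH; lia. }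
  (* In the last column both points are [z0], so the transport between the rows is the identity. *)
  specialize (T N (le_n N)). rewrite !Hright in T by lia.
  destruct T as (p & e & S & _ & _ & _ & _ & E1 & E2). congruence.
Qed.

Lemma row_end v : row 0 v -> v N = v0.
Proof.
  (* Induction from the last row, where the homotopy is constant and transport does nothing, back to
     the row of the original loop. *)
  assert (A : forall i v, (i <= N)%nat -> row (N - i) v -> v N = v0).
  { induction i as [|i IH]; intros w Hi [W0 W].
    - rewrite Nat.sub_0_r in W.
      assert (B : forall k, (k <= N)%nat -> w k = v0).
      { induction k as [|k IHk]; intro Hk; auto.
        rewrite <- IHk by lia. specialize (W k ltac:(lia)). rewrite !Htop in W by lia.
        destruct W as (p & e & S & _ & _ & _ & _ & E1 & E2). congruence. }
      apply B; auto.
    - destruct (row_exists (N - i)) as [v' Hv']; [lia|].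
      rewrite (row_step (N - S i) w v').
      + apply IH; [lia|auto].
      + lia.
      + split; auto.
      + replace (S (N - S i)) with (N - i)%nat by lia. auto. }
  intro Hv. apply (A N v (le_n N)). now rewrite Nat.sub_diag.
Qed.
End Grid.

(** Following the first path out and the second one back gives a loop at [z0], along which transport
    returns to [v0]. Comparing with [L1] from the start and with [L2] from the end, the values meet
    over [z]. *)
Lemma reach_unique z v v' : reach z v -> reach z v' -> v = v'.
Proof.
  intros (g1 & L1 & n1 & P1 & C1 & O1 & F1 & A1 & B1 & D1 & E1)
         (g2 & L2 & n2 & P2 & C2 & O2 & F2 & A2 & B2 & D2 & E2).
  set (gamma := fun t : R => (g1 (2 * n1 * t + 0)%R + g2 (- (2 * n2) * t + 2 * n2)%R - z)%C).
  assert (Gl : forall t, t <= 1 / 2 -> gamma t = g1 (2 * n1 * t + 0)).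
  { intros t Ht. unfold gamma. rewrite B2; [ring|nra]. }
  assert (Gr : forall t, 1 / 2 <= t -> gamma t = g2 (- (2 * n2) * t + 2 * n2)).
  { intros t Ht. unfold gamma. rewrite B1; [ring|nra]. }
  assert (Gc : forall t, Rcont gamma t).
  { intro t. unfold gamma. ccont.
    - apply (@continuous_comp R_UniformSpace R_UniformSpace C_UniformSpace (fun t => 2 * n1 * t + 0) g1); auto.
      apply (@ex_derive_continuous R_AbsRing R_NormedModule). auto_derive; auto.
    - apply (@continuous_comp R_UniformSpace R_UniformSpace C_UniformSpace (fun t => - (2 * n2) * t + 2 * n2) g2); auto.
      apply (@ex_derive_continuous R_AbsRing R_NormedModule). auto_derive; auto. }
  assert (G0 : gamma 0 = z0) by (rewrite Gl, A1 by lra; auto).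
  assert (G1 : gamma 1 = z0) by (rewrite Gr, A2 by lra; auto).
  destruct HOmega as [_ Hsc].
  destruct (Hsc gamma) as (H & Hc & Hm & H0 & H1 & Hs).
  { split; [|split].
    - intros t _ P HP. apply filter_le_within, Gc, HP.
    - intros t _. destruct (Rle_dec t (1 / 2)); [rewrite Gl by auto; auto|rewrite Gr by lra; auto].
    - congruence. }
  destruct (grid_cover H Hc Hm) as [eta [Heta Hcov]].
  destruct (INR_unbounded (/ eta)) as [m0 Hm0].
  (* An even number of steps makes the turning point [t = 1 / 2] a grid point, so no grid interval
     mixes the two paths. *)
  set (m := S m0). set (N := (2 * m)%nat).
  assert (HN : (0 < N)%nat) by (unfold N, m; lia).
  assert (Rm : 0 < INR m) by (apply lt_0_INR; unfold m; lia).
  assert (RN : INR N = 2 * INR m) by (unfold N; rewrite mult_INR; simpl; ring).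
  assert (RN0 : 0 < INR N) by lra.
  assert (Hstep : / INR N <= eta).
  { assert (Q : / eta <= INR N).
    { rewrite RN. assert (INR m0 <= INR m) by (apply le_INR; unfold m; lia).
      assert (0 < / eta) by (apply Rinv_0_lt_compat; auto). lra. }
    rewrite <- (Rinv_inv eta). apply Rinv_le_contravar; auto. apply Rinv_0_lt_compat; auto. }
  assert (Unit : forall k, (k <= N)%nat -> unit_interval (INR k / INR N)).
  { intros k Hk. apply le_INR in Hk. assert (P := pos_INR k). split.
    - apply Rdiv_le_0_compat; lra.
    - apply (Rmult_le_reg_r (INR N)); auto. field_simplify; lra. }
  assert (Sk : forall k, INR (S k) / INR N = INR k / INR N + / INR N).
  { intro k. rewrite S_INR. field. lra. }
  assert (I0 : 0 < / INR N) by (apply Rinv_0_lt_compat; auto).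
  assert (Cell : forall j k, (j < N)%nat -> (k < N)%nat -> exists p d, good_ball a c p d /\
    forall s t, INR j / INR N <= s <= INR (S j) / INR N -> INR k / INR N <= t <= INR (S k) / INR N -> ball p d (H (s, t))).
  { intros j k Hj Hk.
    assert (Uj := Unit j ltac:(lia)). assert (Uk := Unit k ltac:(lia)).
    assert (Uj' := Unit (S j) ltac:(lia)). assert (Uk' := Unit (S k) ltac:(lia)).
    destruct (Hcov (INR j / INR N) (INR k / INR N)) as (p & d & G & K); [split; auto|].
    exists p, d. split; auto. intros s t Hs' Ht'.
    unfold unit_interval in *. assert (Sj := Sk j). assert (Sk' := Sk k).
    apply K.
    - split; unfold unit_interval; simpl; lra.
    - apply Rabs_le; lra.
    - apply Rabs_le; lra. }
  assert (Hcell : forall j k, (j < N)%nat -> (k < N)%nat -> exists p d, good_ball a c p d /\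
    ball p d (H (INR j / INR N, INR k / INR N)) /\ ball p d (H (INR j / INR N, INR (S k) / INR N)) /\
    ball p d (H (INR (S j) / INR N, INR k / INR N)) /\ ball p d (H (INR (S j) / INR N, INR (S k) / INR N))).
  { intros j k Hj Hk. destruct (Cell j k Hj Hk) as (p & d & G & K). exists p, d. split; auto.
    assert (Sj := Sk j). assert (Sk' := Sk k). repeat (split; [apply K; lra|]); apply K; lra. }
  assert (Hleft : forall j, (j <= N)%nat -> H (INR j / INR N, INR 0 / INR N) = z0).
  { intros j Hj. change (INR 0) with 0. replace (0 / INR N) with 0 by (field; lra). rewrite <- G0. apply (proj1 (Hs _ (Unit j Hj))). }
  assert (Hright : forall j, (j <= N)%nat -> H (INR j / INR N, INR N / INR N) = z0).
  { intros j Hj. replace (INR N / INR N) with 1 by (field; lra). rewrite <- G0. apply (proj2 (Hs _ (Unit j Hj))). }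
  assert (Htop : forall k, (k <= N)%nat -> H (INR N / INR N, INR k / INR N) = z0).
  { intros k Hk. replace (INR N / INR N) with 1 by (field; lra). rewrite <- G0. now apply H1, Unit. }
  destruct (row_exists H N HN Hcell Hleft Hright Htop 0 (Nat.le_0_l N)) as [w Hw].
  assert (WN : w N = v0) by (apply (row_end H N HN Hcell Hleft Hright Htop); auto).
  assert (Row0 : forall k, (k < N)%nat -> transport (gamma (INR k / INR N)) (w k) (gamma (INR (S k) / INR N)) (w (S k))).
  { intros k Hk. destruct Hw as [_ Hw]. specialize (Hw k Hk).
    replace (INR 0 / INR N) with 0 in Hw by (change (INR 0) with 0; field; lra).
    rewrite !H0 in Hw by (apply Unit; lia). exact Hw. }
  assert (In0 : forall k, (k < N)%nat -> exists p d, good_ball a c p d /\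
     forall t, INR k / INR N <= t <= INR (S k) / INR N -> ball p d (gamma t)).
  { intros k Hk. destruct (Cell 0%nat k HN Hk) as (p & d & G & K). exists p, d; split; auto.
    intros t Ht. assert (U1 := Unit k ltac:(lia)). assert (U2 := Unit (S k) ltac:(lia)).
    rewrite <- H0 by (unfold unit_interval in *; lra).
    apply K; auto. rewrite (Sk 0%nat). change (INR 0) with 0. replace (0 / INR N) with 0 by (field; lra). lra. }
  assert (M1 : forall k, (k <= m)%nat -> w k = L1 (2 * n1 * (INR k / INR N) + 0)).
  { induction k as [|k IH]; intro Hk.
    - destruct Hw as [Hw _]. rewrite Hw. change (INR 0) with 0. replace (2 * n1 * (0 / INR N) + 0) with 0 by (field; lra). auto.
    - assert (Hkm : INR (S k) / INR N <= 1 / 2).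
      { rewrite RN. apply le_INR in Hk. apply (Rmult_le_reg_r (2 * INR m)); [lra|]. field_simplify; lra. }
      destruct (In0 k) as (p & d & G & K); [unfold N; lia|].
      assert (S0 := Sk k).
      assert (T := lift_transport _ _ p d (INR k / INR N) (INR (S k) / INR N) (lift_affine g1 L1 (2 * n1) 0 F1) G ltac:(lra)).
      cbn beta in T. rewrite <- !Gl, <- IH in T by (lra || lia).
      apply (transport_fun (gamma (INR k / INR N)) (w k) (gamma (INR (S k) / INR N))).
      + apply Row0. unfold N; lia.
      + apply T. intros t Ht. rewrite <- Gl by lra. auto. }
  assert (M2 : forall k, (k <= m)%nat -> w (N - k)%nat = L2 (- (2 * n2) * (INR (N - k) / INR N) + 2 * n2)).
  { induction k as [|k IH]; intro Hk.
    - rewrite Nat.sub_0_r, WN. replace (- (2 * n2) * (INR N / INR N) + 2 * n2) with 0 by (field; lra). auto.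
    - set (i := (N - S k)%nat). assert (Ei : (N - k)%nat = S i) by (unfold i, N, m in *; lia).
      rewrite Ei in IH.
      assert (Him : 1 / 2 <= INR i / INR N).
      { assert (Q : INR m <= INR i) by (apply le_INR; unfold i, N in *; lia).
        rewrite RN. apply (Rmult_le_reg_r (2 * INR m)); [lra|]. field_simplify; lra. }
      destruct (In0 i) as (p & d & G & K); [unfold i, N, m in *; lia|].
      assert (S0 := Sk i).
      assert (T := lift_transport _ _ p d (INR i / INR N) (INR (S i) / INR N) (lift_affine g2 L2 (- (2 * n2)) (2 * n2) F2) G ltac:(lra)).
      cbn beta in T. rewrite <- !Gr, <- IH in T by (lra || lia).
      apply (transport_fun (gamma (INR (S i) / INR N)) (w (S i)) (gamma (INR i / INR N))).
      + apply transport_sym, Row0. unfold i, N, m in *; lia.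
      + apply transport_sym, T. intros t Ht. rewrite <- Gr by lra. auto. }
  specialize (M1 m (le_n m)). specialize (M2 m (le_n m)).
  replace (N - m)%nat with m in M2 by (unfold N; lia).
  rewrite M1 in M2.
  replace (2 * n1 * (INR m / INR N) + 0) with n1 in M2 by (rewrite RN; field; lra).
  replace (- (2 * n2) * (INR m / INR N) + 2 * n2) with n2 in M2 by (rewrite RN; field; lra).
  congruence.
Qed.

Theorem global_solution : exists P, solves a c P Omega /\ P z0 = v0.
Proof.
  (* The value at [z] is any reachable one; [reach_unique] makes it single-valued and identifies it
     near each point with a local solution. *)
  set (P := fun z => epsilon (inhabits (RtoC 0)) (reach z)).
  assert (HP : forall z, Omega z -> reach z (P z)).
  { intros z Hz. apply epsilon_spec, reach_all, Hz. }
  exists P. split.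
  - intros z Hz. destruct (Hgood z Hz) as [d [G Hs]]. assert (G' := G). destruct G' as (Hd & _ & G3).
    destruct (G3 z (P z) (good_center _ _ G)) as [S [HS E]].
    assert (ES : forall w, ball z d w -> S w = P w).
    { intros w Hw. apply (reach_unique w); [|apply HP, Hs, Hw].
      apply (reach_extend z (P z) w (S w) z d S); auto. }
    apply (cder_ext_loc S P z _ d); auto.
    eapply cder_eq; [apply HS; auto|]. unfold rhs. now rewrite ES by auto.
  - apply (reach_unique z0); [apply HP, Hz0|apply reach_base].
Qed.
End Transport.

(** * Existence of the representation *)

Lemma locally_constant_connected {T : Type} (X : C -> Prop) (F : C -> T) : connected_set X ->
  (forall z, X z -> exists r, 0 < r /\ forall w, ball z r w -> X w /\ F w = F z) ->
  forall z w, X z -> X w -> F z = F w.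
Proof.
  intros Hconn H z w Hz Hw. apply NNPP. intro N.
  destruct (Hconn (fun p => X p /\ F z = F p) (fun p => X p /\ F z <> F p)) as [p [_ [[_ P1] [_ P2]]]]; auto.
  - intros p [Hp E]. destruct (H p Hp) as [r [Hr K]]. exists (mkposreal r Hr). intros q Hq.
    destruct (K q Hq). split; congruence.
  - intros p [Hp E]. destruct (H p Hp) as [r [Hr K]]. exists (mkposreal r Hr). intros q Hq.
    destruct (K q Hq). split; congruence.
  - intros p Hp. destruct (classic (F z = F p)); auto.
  - exists z; auto.
  - exists w; auto.
Qed.

Lemma is_derive_zero_const (f : R -> R) (x y : R) :
  (forall t, between x y t -> is_derive f t 0) -> f x = f y.
Proof.
  intro H. assert (E : RtoC (f x) = RtoC (f y)).
  { apply (rder_zero_const (fun t => RtoC (f t))). intros t Ht. apply rder_RtoC, H, Ht. }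
  now apply (f_equal fst) in E.
Qed.

Lemma is_derive_Rminus (f g : R -> R) (t l m : R) : is_derive f t l -> is_derive g t m ->
  is_derive (fun s => f s - g s) t (l - m).
Proof. exact (@is_derive_minus R_AbsRing R_NormedModule f g t l m). Qed.

Lemma is_derive_exp_comp (f : R -> R) (t l : R) : is_derive f t l ->
  is_derive (fun s => exp (f s)) t (l * exp (f t)).
Proof.
  intro H. apply (is_derive_comp exp f t (exp (f t)) l); auto.
  apply is_derive_Reals, derivable_pt_lim_exp.
Qed.

(** * The linear system attached to [u] and [h] *)

Section PDE.
Variables (Omega : C -> Prop) (h : C -> C) (u : C -> R).
Hypothesis HOmega : simply_connected_domain Omega.
Hypothesis Hh : holomorphic_on Omega h.
Hypothesis Hu : C2_on Omega u.
Hypothesis Hpde : forall z, Omega z -> laplacian u z = 4 * Cmod (h z) ^ 2 * exp (2 * u z).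

Let Oopen : @open C_UniformSpace Omega := proj1 (proj2 (proj1 HOmega)).

Lemma C1_on_x (v : C -> R) (w : C) : C1_on Omega v -> Omega w ->
  is_derive (fun s => v (s, snd w)) (fst w) (partial_x v w).
Proof. intros [H _] Hw. apply Derive_correct, H, Hw. Qed.

Lemma C1_on_y (v : C -> R) (w : C) : C1_on Omega v -> Omega w ->
  is_derive (fun s => v (fst w, s)) (snd w) (partial_y v w).
Proof. intros [H _] Hw. apply Derive_correct, H, Hw. Qed.

Lemma C1_on_cont_x (v : C -> R) (w : C) : C1_on Omega v -> Omega w ->
  @continuous C_UniformSpace R_UniformSpace (partial_x v) w.
Proof. intros (_ & H & _) Hw. apply (continuous_continuous_on Omega); auto. Qed.

Lemma C1_on_cont_y (v : C -> R) (w : C) : C1_on Omega v -> Omega w ->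
  @continuous C_UniformSpace R_UniformSpace (partial_y v) w.
Proof. intros (_ & _ & H) Hw. apply (continuous_continuous_on Omega); auto. Qed.

(** [C1_on] speaks of partial derivatives only; their existence near [w], with [partial_x v]
    continuous, gives total differentiability and thereby continuity. *)
Lemma C1_on_cont (v : C -> R) (w : C) : C1_on Omega v -> Omega w ->
  @continuous C_UniformSpace R_UniformSpace v w.
Proof.
  intros H Hw. destruct w as [x y].
  assert (F := is_derive_filterdiff (fun s t => v (s, t)) x y (fun s t => partial_x v (s, t)) (partial_y v (x, y))).
  assert (L : filterdiff (fun p : R * R => v (fst p, snd p)) (locally (x, y))
     (fun p : R * R => plus (scal (fst p) (partial_x v (x, y))) (scal (snd p) (partial_y v (x, y))))).
  { apply F.
    - destruct (open_ball_sub _ _ Oopen Hw) as [r [Hr Hs]]. exists (mkposreal r Hr). intros [s t] Hp.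
      apply (C1_on_x v (s, t)); auto.
    - apply (C1_on_y v (x, y)); auto.
    - apply (continuous_ext (partial_x v)); [intros []; reflexivity|]. now apply C1_on_cont_x. }
  apply (continuous_ext (fun p : R * R => v (fst p, snd p))); [intros []; reflexivity|].
  exact (filterdiff_continuous (fun p : R * R => v (fst p, snd p)) (x, y) (ex_intro _ _ L)).
Qed.

Let Hu1 : C1_on Omega u := proj1 Hu.
Let Hux : C1_on Omega (partial_x u) := proj1 (proj2 Hu).
Let Huy : C1_on Omega (partial_y u) := proj2 (proj2 Hu).

Lemma mixed_partials (w : C) : Omega w -> partial_x (partial_y u) w = partial_y (partial_x u) w.
Proof.
  intro Hw. destruct w as [x y].
  apply (Schwarz (fun s t => u (s, t)) x y).
  - destruct (open_ball_sub _ _ Oopen Hw) as [r [Hr Hs]]. exists (mkposreal r Hr). simpl. intros s t H1 H2.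
    assert (Hst : Omega (s, t)) by (apply Hs, Cball_iff; auto).
    split; [apply (proj1 Hu1 (s, t) Hst)|split; [apply (proj1 Hu1 (s, t) Hst)|split]].
    + apply (proj1 Huy (s, t) Hst).
    + apply (proj1 Hux (s, t) Hst).
  - apply continuity_2d_pt_filterlim.
    apply (continuous_ext (partial_x (partial_y u))); [intros []; reflexivity|]. now apply C1_on_cont_x.
  - apply continuity_2d_pt_filterlim.
    apply (continuous_ext (partial_y (partial_x u))); [intros []; reflexivity|]. now apply C1_on_cont_y.
Qed.

(* [coef_a = - u_z] and [coef_c 1 = h e^u]. *)
Definition coef_a (w : C) : C := (- partial_x u w / 2, partial_y u w / 2).
Definition coef_c (sg : R) (w : C) : C := (RtoC (sg * exp (u w)) * h w)%C.

Let hh : holo Omega h := Hh.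

Lemma continuous_half (f : C -> R) (w : C) : @continuous C_UniformSpace R_UniformSpace f w ->
  @continuous C_UniformSpace R_UniformSpace (fun z => f z / 2) w.
Proof.
  intro H. apply (@continuous_mult C_UniformSpace R_AbsRing f (fun _ => / 2)); auto. apply continuous_const.
Qed.

Lemma continuous_neg_half (f : C -> R) (w : C) : @continuous C_UniformSpace R_UniformSpace f w ->
  @continuous C_UniformSpace R_UniformSpace (fun z => - f z / 2) w.
Proof.
  intro H. apply continuous_half. now apply (@continuous_opp C_UniformSpace R_AbsRing R_NormedModule f).
Qed.

Lemma is_derive_half (f : R -> R) (t l : R) : is_derive f t l -> is_derive (fun s => f s / 2) t (l / 2).
Proof.
  intro H. replace (l / 2) with (l * / 2 + f t * 0) by field.
  apply (is_derive_Rmult f (fun _ => / 2)); auto. apply is_derive_Rconst.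
Qed.

Lemma is_derive_neg_half (f : R -> R) (t l : R) : is_derive f t l -> is_derive (fun s => - f s / 2) t (- l / 2).
Proof.
  intro H. apply is_derive_half. now apply (@is_derive_opp R_AbsRing R_NormedModule f).
Qed.

Lemma coef_a_C1 : C1_partials Omega coef_a
  (fun w => (- partial_x (partial_x u) w / 2, partial_x (partial_y u) w / 2))
  (fun w => (- partial_y (partial_x u) w / 2, partial_y (partial_y u) w / 2)).
Proof.
  intros w Hw. split; [|split; [|split; [|split]]].
  - split; simpl.
    + apply (is_derive_neg_half (fun s => partial_x u (s, snd w))). now apply C1_on_x.
    + apply (is_derive_half (fun s => partial_y u (s, snd w))). now apply C1_on_x.
  - split; simpl.
    + apply (is_derive_neg_half (fun s => partial_x u (fst w, s))). now apply C1_on_y.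
    + apply (is_derive_half (fun s => partial_y u (fst w, s))). now apply C1_on_y.
  - apply (@continuous_pairC C_UniformSpace); [apply continuous_neg_half|apply continuous_half]; now apply C1_on_cont_x.
  - apply (@continuous_pairC C_UniformSpace); [apply continuous_neg_half|apply continuous_half]; now apply C1_on_cont_y.
  - apply (@continuous_pairC C_UniformSpace); [apply continuous_neg_half|apply continuous_half];
      [now apply C1_on_cont_x|now apply C1_on_cont_y].
Qed.

Lemma coef_c_C1 sg : C1_partials Omega (coef_c sg)
  (fun w => RtoC (sg * exp (u w)) * (RtoC (partial_x u w) * h w + C_derive h w))%C
  (fun w => RtoC (sg * exp (u w)) * (RtoC (partial_y u w) * h w + Ci * C_derive h w))%C.
Proof.
  intros w Hw.
  assert (Dh : cder h w (C_derive h w)) by (destruct (hh w Hw); eapply C_derive_cder; eauto).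
  assert (Ch : Ccont h w) by (eapply cder_cont; eauto).
  assert (Ch' : Ccont (C_derive h) w).
  { destruct (holo_C_derive Omega h Oopen hh w Hw). eapply cder_cont; eauto. }
  assert (Ce : Ccont (fun w => RtoC (sg * exp (u w))) w).
  { apply continuous_RtoC. apply (@continuous_mult C_UniformSpace R_AbsRing); [apply continuous_const|].
    apply (@continuous_comp C_UniformSpace R_UniformSpace R_UniformSpace u exp); [now apply C1_on_cont|apply continuous_exp]. }
  split; [|split; [|split; [|split]]].
  - eapply rder_eq.
    + apply rder_mult; [|apply rder_horizontal; destruct w; exact Dh].
      apply rder_RtoC. apply (is_derive_Rmult (fun _ => sg) (fun s => exp (u (s, snd w)))); [apply is_derive_Rconst|].
      apply is_derive_exp_comp, C1_on_x; auto.
    + destruct w as [x y]; simpl. apply injective_projections; simpl; ring.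
  - eapply rder_eq.
    + apply rder_mult; [|apply rder_vertical; destruct w; exact Dh].
      apply rder_RtoC. apply (is_derive_Rmult (fun _ => sg) (fun s => exp (u (fst w, s)))); [apply is_derive_Rconst|].
      apply is_derive_exp_comp, C1_on_y; auto.
    + destruct w as [x y]; simpl. apply injective_projections; simpl; ring.
  - ccont. now apply continuous_RtoC, C1_on_cont_x.
  - ccont. now apply continuous_RtoC, C1_on_cont_y.
  - unfold coef_c. ccont.
Qed.

(** The compatibility condition for [coef_a] is the equation for [u], with [sg] entering only
    through its square. The one for [coef_c] is an identity, from the product rule and the
    holomorphy of [h]. *)
Lemma coef_good sg : sg * sg = 1 -> forall z, Omega z ->
  exists d, good_ball coef_a (coef_c sg) z d /\ forall w, ball z d w -> Omega w.
Proof.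
  intros Hsg z Hz. destruct (open_ball_sub _ _ Oopen Hz) as [r [Hr Hs]].
  destruct (local_solution coef_a _ _ (coef_c sg) _ _ z r Hr
      (fun w Hw => coef_a_C1 w (Hs w Hw)) (fun w Hw => coef_c_C1 sg w (Hs w Hw))) as [d [Hd G]].
  - intros w Hw. apply Hs in Hw. rewrite mixed_partials by auto.
    assert (L := Hpde w Hw). unfold laplacian in L. rewrite Cmod_sqr in L.
    replace (exp (2 * u w)) with (exp (u w) * exp (u w)) in L by (rewrite <- exp_plus; f_equal; ring).
    unfold coef_c. apply injective_projections; simpl.
    + field.
    + replace (partial_x (partial_x u) w) with (4 * (fst (h w) ^ 2 + snd (h w) ^ 2) * (exp (u w) * exp (u w)) - partial_y (partial_y u) w) by lra.
      transitivity (- 2 * (sg * sg) * (fst (h w) ^ 2 + snd (h w) ^ 2) * (exp (u w) * exp (u w))); [rewrite Hsg; field|ring].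
  - intros w Hw. unfold coef_c, coef_a. apply injective_projections; simpl; field.
  - exists d. split; auto. intros w Hw. apply Hs. eapply ball_le; [exact Hd|exact Hw].
Qed.

Lemma frame_exists (z0 : C) : Omega z0 -> exists A B : C -> C,
  (forall z, Omega z -> cder A z (coef_a z * A z + coef_c 1 z * Cconj (B z))%C) /\
  (forall z, Omega z -> cder B z (coef_a z * B z + coef_c 1 z * Cconj (A z))%C) /\
  A z0 = RtoC 0 /\ B z0 = RtoC (exp (- u z0 / 2)).
Proof.
  (* The normalisation [exp u * |B|^2 = 1] with [A = 0] at the base point; for [A + B] and [A - B]
     it means the initial values [b0] and [- b0]. *)
  intro Hz0. set (b0 := exp (- u z0 / 2)).
  destruct (global_solution coef_a (coef_c 1) Omega z0 (RtoC b0) HOmega (coef_good 1 ltac:(ring)) Hz0) as [P [HP P0]].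
  destruct (global_solution coef_a (coef_c (-1)) Omega z0 (RtoC (- b0)) HOmega (coef_good (-1) ltac:(ring)) Hz0) as [Q [HQ Q0]].
  exists (fun z => (RtoC (/ 2) * (P z + Q z))%C), (fun z => (RtoC (/ 2) * (P z - Q z))%C).
  split; [|split; [|split]].
  - intros z Hz. eapply cder_eq; [apply cder_scal, cder_plus; [apply HP|apply HQ]; auto|].
    unfold rhs, coef_c. apply injective_projections; simpl; ring.
  - intros z Hz. eapply cder_eq; [apply cder_scal, cder_minus; [apply HP|apply HQ]; auto|].
    unfold rhs, coef_c. apply injective_projections; simpl; ring.
  - rewrite P0, Q0. apply injective_projections; simpl; field.
  - rewrite P0, Q0. apply injective_projections; simpl; field.
Qed.

(** In both coordinate directions the [coef_a] terms cancel the derivative of [exp u]. The [coef_c]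
    terms of [|A|^2] and [|B|^2] are equal, since [c conj A conj B] is symmetric, and drop out of
    the difference. *)
Lemma frame_norm (A B : C -> C) (z0 : C) : Omega z0 ->
  (forall z, Omega z -> cder A z (coef_a z * A z + coef_c 1 z * Cconj (B z))%C) ->
  (forall z, Omega z -> cder B z (coef_a z * B z + coef_c 1 z * Cconj (A z))%C) ->
  A z0 = RtoC 0 -> B z0 = RtoC (exp (- u z0 / 2)) ->
  forall z, Omega z -> exp (u z) * (Cmod (B z) ^ 2 - Cmod (A z) ^ 2) = 1.
Proof.
  intros Hz0 HA HB A0 B0 z Hz.
  set (D := fun z => exp (u z) * (Cmod (B z) ^ 2 - Cmod (A z) ^ 2)).
  transitivity (D z0).
  2:{ unfold D. rewrite A0, B0, Cmod_0, Cmod_R, Rabs_pos_eq by (left; apply exp_pos).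
      replace (exp (- u z0 / 2) ^ 2) with (exp (- u z0)).
      - rewrite pow_i by lia. rewrite Rminus_0_r, <- exp_plus. replace (u z0 + - u z0) with 0 by ring. apply exp_0.
      - simpl. rewrite Rmult_1_r, <- exp_plus. f_equal. field. }
  apply (locally_constant_connected Omega D); auto; [apply HOmega|].
  assert (Dx : forall x y, Omega (x, y) -> is_derive (fun s => D (s, y)) x 0).
  { intros x y Hw. unfold D.
    assert (E1 := is_derive_exp_comp _ _ _ (C1_on_x u (x, y) Hu1 Hw)).
    assert (E2 := rder_Cmod_sqr _ _ _ (rder_horizontal _ _ _ _ (HB _ Hw))).
    assert (E3 := rder_Cmod_sqr _ _ _ (rder_horizontal _ _ _ _ (HA _ Hw))).
    simpl in E1.
    assert (E := is_derive_Rmult _ _ _ _ _ E1 (is_derive_Rminus _ _ _ _ _ E2 E3)).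
    match type of E with is_derive _ _ ?l => replace 0 with l; [exact E|] end.
    cbn beta.
    rewrite !Cmod_sqr. unfold coef_a, coef_c. simpl. field. }
  assert (Dy : forall x y, Omega (x, y) -> is_derive (fun s => D (x, s)) y 0).
  { intros x y Hw. unfold D.
    assert (E1 := is_derive_exp_comp _ _ _ (C1_on_y u (x, y) Hu1 Hw)).
    assert (E2 := rder_Cmod_sqr _ _ _ (rder_vertical _ _ _ _ (HB _ Hw))).
    assert (E3 := rder_Cmod_sqr _ _ _ (rder_vertical _ _ _ _ (HA _ Hw))).
    simpl in E1.
    assert (E := is_derive_Rmult _ _ _ _ _ E1 (is_derive_Rminus _ _ _ _ _ E2 E3)).
    match type of E with is_derive _ _ ?l => replace 0 with l; [exact E|] end.
    cbn beta.
    rewrite !Cmod_sqr. unfold coef_a, coef_c. simpl. field. }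
  intros p Hp. destruct (open_ball_sub _ _ Oopen Hp) as [r [Hr Hs]].
  exists r. split; auto. intros w Hw. split; [now apply Hs|].
  assert (Hpp : ball p r p) by now apply ball_self.
  destruct p as [x0 y0]. destruct w as [x y].
  transitivity (D (x0, y)).
  - symmetry. apply (is_derive_zero_const (fun s => D (s, y))). intros t Ht. apply Dx, Hs.
    apply (ball_box (x0, y0) (x0, y0) (x, y)); auto. apply between_iff; simpl; lra.
  - symmetry. apply (is_derive_zero_const (fun s => D (x0, s))). intros t Ht. apply Dy, Hs.
    apply (ball_box (x0, y0) (x0, y0) (x, y)); auto. apply between_iff; simpl; lra.
Qed.

Theorem representation_exists : exists f q : C -> C,
  holomorphic_on Omega f /\ maps_to f Omega unit_disk /\
  holomorphic_on Omega q /\ liouville_representation Omega h u f q.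
Proof.
  pose proof (proj1 (proj1 HOmega)) as [z0 Hz0].
  destruct (frame_exists z0 Hz0) as (A & B & HA & HB & A0 & B0).
  assert (N := frame_norm A B z0 Hz0 HA HB A0 B0).
  assert (Pos : forall z, Omega z -> Cmod (A z) ^ 2 < Cmod (B z) ^ 2 /\ B z <> RtoC 0).
  { intros z Hz. specialize (N z Hz). assert (E := exp_pos (u z)).
    assert (Q : Cmod (A z) ^ 2 < Cmod (B z) ^ 2) by nra. split; auto.
    apply Cmod_gt_0. assert (P := Cmod_ge_0 (B z)). assert (0 <= Cmod (A z) ^ 2) by apply pow2_ge_0.
    destruct (Req_dec (Cmod (B z)) 0) as [E0|]; [rewrite E0 in *; nra|lra]. }
  assert (Df : forall z, Omega z -> cder (fun z => A z / B z)%C z (h z * (/ B z * / B z))%C).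
  { intros z Hz. destruct (Pos z Hz) as [_ HB0]. eapply cder_eq; [apply cder_div; auto|].
    (* The Wronskian [A' B - A B'] is [coef_c 1] times [|B|^2 - |A|^2], and the normalisation turns
       this into [h]. *)
    assert (W : ((coef_a z * A z + coef_c 1 z * Cconj (B z)) * B z - A z * (coef_a z * B z + coef_c 1 z * Cconj (A z)))%C = h z).
    { transitivity (RtoC (exp (u z) * (Cmod (B z) ^ 2 - Cmod (A z) ^ 2)) * h z)%C.
      - rewrite !Cmod_sqr. unfold coef_c. apply injective_projections; simpl; ring.
      - rewrite (N z Hz). ring. }
    rewrite W. field; auto. }
  assert (Dq : forall z, Omega z -> exists l, cder (fun z => / B z * / B z)%C z l).
  { intros z Hz. destruct (Pos z Hz) as [_ HB0]. eexists. apply cder_mult; apply cder_inv; auto. }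
  exists (fun z => A z / B z)%C, (fun z => / B z * / B z)%C.
  split; [|split; [|split; [|split; [|split]]]].
  - intros z Hz. eexists; now apply Df.
  - intros z Hz. destruct (Pos z Hz) as [H1 H2]. unfold unit_disk.
    assert (P := proj1 (Cmod_gt_0 _) H2). assert (P' := Cmod_ge_0 (A z)).
    rewrite Cmod_div by auto. apply (Rmult_lt_reg_r (Cmod (B z))); auto.
    replace (Cmod (A z) / Cmod (B z) * Cmod (B z)) with (Cmod (A z)) by (field; lra). nra.
  - intros z Hz. now apply Dq.
  - intros z Hz P HP. apply filter_le_within.
    destruct (Dq z Hz) as [l Hl]. apply cder_cont in Hl. apply Hl, HP.
  - intros z Hz Hn. 
    replace (C_derive (fun z => A z / B z)%C z) with (h z * (/ B z * / B z))%C by (symmetry; apply is_C_derive_unique, Df, Hz).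
    field. split; auto. now apply Pos.
  - intros z Hz. destruct (Pos z Hz) as [H1 H2]. split.
    + apply Cmod_gt_0. rewrite Cmod_mult, Cmod_inv by auto.
      assert (0 < / Cmod (B z)) by (apply Rinv_0_lt_compat; now apply Cmod_gt_0). nra.
    + assert (P := proj1 (Cmod_gt_0 _) H2).
      rewrite Cmod_mult, Cmod_inv, Cmod_div by auto.
      replace (/ Cmod (B z) * / Cmod (B z) / (1 - (Cmod (A z) / Cmod (B z)) ^ 2)) with (exp (u z)); [now rewrite ln_exp|].
      replace (exp (u z)) with (/ (Cmod (B z) ^ 2 - Cmod (A z) ^ 2)).
      * field. repeat split; intro; nra.
      * specialize (N z Hz). apply (Rmult_eq_reg_r (Cmod (B z) ^ 2 - Cmod (A z) ^ 2)); [|lra].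
        rewrite N. field. lra.
Qed.
End PDE.

(** * Uniqueness of the representation *)

Lemma Cmult_integral (z w : C) : (z * w)%C = RtoC 0 -> z = RtoC 0 \/ w = RtoC 0.
Proof.
  intro E. apply (f_equal Cmod) in E. rewrite Cmod_mult, Cmod_0 in E.
  destruct (Rmult_integral _ _ E); [left|right]; now apply Cmod_eq_0.
Qed.

(** * Automorphisms of the disk *)

Definition mobius (a w : C) : C := ((w - a) / (RtoC 1 - Cconj a * w))%C.
Definition mobius' (a w : C) : C :=
  ((RtoC 1 - a * Cconj a) / ((RtoC 1 - Cconj a * w) * (RtoC 1 - Cconj a * w)))%C.

Lemma mobius_den (a w : C) : Cmod a < 1 -> Cmod w < 1 -> (RtoC 1 - Cconj a * w)%C <> RtoC 0.
Proof.
  intros Ha Hw E. assert (T := Cmod_sub_lower (RtoC 1) (Cconj a * w)).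
  rewrite E, Cmod_0, Cmod_1, Cmod_mult, Cmod_conj in T.
  assert (P := Cmod_ge_0 a). assert (Q := Cmod_ge_0 w). nra.
Qed.

Lemma mobius_cder (a w : C) : Cmod a < 1 -> Cmod w < 1 -> cder (mobius a) w (mobius' a w).
Proof.
  intros Ha Hw. assert (N := mobius_den a w Ha Hw). eapply cder_eq.
  - apply cder_div; auto.
    + apply cder_minus; [apply cder_id|apply cder_const].
    + apply cder_minus; [apply cder_const|apply cder_scal, cder_id].
  - unfold mobius'. simpl. field; auto.
Qed.

(** Invariance of the hyperbolic metric, from the identity [|1 - conj a w|^2 - |w - a|^2 = (1 -
    |a|^2)(1 - |w|^2)]. *)
Lemma mobius_density (a w : C) : Cmod a < 1 -> Cmod w < 1 ->
  Cmod (mobius' a w) * (1 - Cmod w ^ 2) = 1 - Cmod (mobius a w) ^ 2.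
Proof.
  intros Ha Hw. assert (N := mobius_den a w Ha Hw).
  assert (P := proj1 (Cmod_gt_0 _) N).
  unfold mobius', mobius. rewrite !Cmod_div, Cmod_mult; auto.
  2:{ intro E. apply Cmult_integral in E. tauto. }
  assert (E : Cmod (RtoC 1 - a * Cconj a) = 1 - Cmod a ^ 2).
  { rewrite <- Cmod2_conj. replace (RtoC 1 - RtoC (Cmod a ^ 2))%C with (RtoC (1 - Cmod a ^ 2)) by now rewrite RtoC_minus.
    rewrite Cmod_R, Rabs_pos_eq; auto. assert (Q := Cmod_ge_0 a). nra. }
  rewrite E.
  assert (K : Cmod (RtoC 1 - Cconj a * w) ^ 2 - Cmod (w - a) ^ 2 = (1 - Cmod a ^ 2) * (1 - Cmod w ^ 2)).
  { rewrite !Cmod_sqr. simpl. ring. }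
  unfold Rdiv. rewrite Rpow_mult_distr.
  apply (Rmult_eq_reg_r (Cmod (RtoC 1 - Cconj a * w) ^ 2)); [|nra].
  field_simplify; [|lra|lra]. lra.
Qed.

Lemma mobius'_neq (a w : C) : Cmod a < 1 -> Cmod w < 1 -> mobius' a w <> RtoC 0.
Proof.
  intros Ha Hw. assert (N := mobius_den a w Ha Hw). assert (N' := mobius_den a a Ha Ha).
  unfold mobius'. intro E. apply N'. 
  replace (RtoC 1 - Cconj a * a)%C with
    ((RtoC 1 - a * Cconj a) / ((RtoC 1 - Cconj a * w) * (RtoC 1 - Cconj a * w)) *
     ((RtoC 1 - Cconj a * w) * (RtoC 1 - Cconj a * w)))%C by (field; auto).
  rewrite E. ring.
Qed.

(** Read off from [mobius_density], whose left-hand side is positive. *)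
Lemma mobius_disk (a w : C) : Cmod a < 1 -> Cmod w < 1 -> Cmod (mobius a w) < 1.
Proof.
  intros Ha Hw. assert (D := mobius_density a w Ha Hw).
  assert (P := proj1 (Cmod_gt_0 _) (mobius'_neq a w Ha Hw)).
  assert (Q := Cmod_ge_0 w). assert (Q' := Cmod_ge_0 (mobius a w)).
  assert (0 < 1 - Cmod w ^ 2) by nra. nra.
Qed.

Lemma mobius_inverse (a w : C) : Cmod a < 1 -> Cmod w < 1 -> mobius (- a) (mobius a w) = w.
Proof.
  intros Ha Hw. assert (N := mobius_den a w Ha Hw). assert (N' := mobius_den a a Ha Ha).
  assert (D : (RtoC 1 - Cconj (- a) * mobius a w)%C = ((RtoC 1 - Cconj a * a) / (RtoC 1 - Cconj a * w))%C).
  { unfold mobius. rewrite Copp_conj. field; auto. }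
  unfold mobius at 1. rewrite D. unfold mobius. field. auto.
Qed.

Lemma mobius_zero (a : C) : mobius a a = RtoC 0.
Proof. unfold mobius, Cdiv. replace (a - a)%C with (RtoC 0) by ring. ring. Qed.

Lemma mobius_automorphism (a : C) : Cmod a < 1 -> disk_automorphism (mobius a).
Proof.
  intro Ha. assert (Ha' : Cmod (- a) < 1) by now rewrite Cmod_opp.
  split; [|split].
  - intros w Hw. eexists. now apply mobius_cder.
  - intros w Hw. now apply mobius_disk.
  - exists (mobius (- a)). split; [|split].
    + intros w Hw. eexists. now apply mobius_cder.
    + intros w Hw. now apply mobius_disk.
    + intros w Hw. split; [now apply mobius_inverse|].
      assert (E := mobius_inverse (- a) w Ha' Hw). replace (- - a)%C with a in E by ring. exact E.
Qed.

Lemma rotation_automorphism (l : C) : Cmod l = 1 -> disk_automorphism (fun w => l * w)%C.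
Proof.
  intro Hl. assert (L0 : l <> RtoC 0) by (apply Cmod_gt_0; lra).
  split; [|split].
  - intros w _. eexists. apply cder_scal, cder_id.
  - intros w Hw. unfold unit_disk in *. rewrite Cmod_mult, Hl. lra.
  - exists (fun w => / l * w)%C. split; [|split].
    + intros w _. eexists. apply cder_scal, cder_id.
    + intros w Hw. unfold unit_disk in *. rewrite Cmod_mult, Cmod_inv, Hl by auto. lra.
    + intros w _. split; field; auto.
Qed.

Lemma automorphism_comp (T S : C -> C) : disk_automorphism T -> disk_automorphism S ->
  disk_automorphism (fun w => T (S w)).
Proof.
  intros (T1 & T2 & T' & T3 & T4 & T5) (S1 & S2 & S' & S3 & S4 & S5).
  split; [|split].
  - intros w Hw. destruct (S1 w Hw) as [l Hl]. destruct (T1 (S w) (S2 w Hw)) as [m Hm].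
    exists (m * l)%C. exact (cder_comp T S w m l Hm Hl).
  - intros w Hw. apply T2, S2, Hw.
  - exists (fun w => S' (T' w)). split; [|split].
    + intros w Hw. destruct (T3 w Hw) as [l Hl]. destruct (S3 (T' w) (T4 w Hw)) as [m Hm].
      exists (m * l)%C. exact (cder_comp S' T' w m l Hm Hl).
    + intros w Hw. apply S4, T4, Hw.
    + intros w Hw. split.
      * rewrite (proj1 (T5 (S w) (S2 w Hw))). apply S5, Hw.
      * rewrite (proj2 (S5 (T' w) (T4 w Hw))). apply T5, Hw.
Qed.

(** * Rigidity of maps with equal pulled back hyperbolic metric *)

Lemma isometry_second_derivative (F F' G psi psi' : C -> C) (z0 : C) (r : R) (z : C) :
  (forall w, ball z0 r w -> cder F w (F' w) /\ cder G w (psi w * F' w)%C /\ cder psi w (psi' w) /\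
     psi w <> RtoC 0 /\ Cmod (F w) < 1 /\ Cmod (G w) < 1 /\
     Cmod (psi w) * (1 - Cmod (F w) ^ 2) = 1 - Cmod (G w) ^ 2) ->
  ball z0 r z ->
  psi' z = (RtoC 2 * psi z * F' z * (Cconj (F z) / RtoC (1 - Cmod (F z) ^ 2)
             - psi z * Cconj (G z) / RtoC (1 - Cmod (G z) ^ 2)))%C.
Proof.
  intros H Hz.
  (* The squared identity is a polynomial in real and imaginary parts, so it can be differentiated
     without a modulus. *)
  set (N := fun w => Cmod (psi w) ^ 2 * ((1 - Cmod (F w) ^ 2) * (1 - Cmod (F w) ^ 2)) -
                     (1 - Cmod (G w) ^ 2) * (1 - Cmod (G w) ^ 2)).
  assert (N0 : forall w, ball z0 r w -> N w = 0).
  { intros w Hw. destruct (H w Hw) as (_ & _ & _ & _ & _ & _ & E). unfold N. rewrite <- E. ring. }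
  (* The Wirtinger derivative of [N] in [z]: the partial derivatives of [N] are twice the real parts
     of [X] and [Ci * X], so both real parts vanish and [X = 0]. *)
  set (X := (Cconj (psi z) * psi' z * RtoC ((1 - Cmod (F z) ^ 2) * (1 - Cmod (F z) ^ 2))
     - RtoC (2 * Cmod (psi z) ^ 2 * (1 - Cmod (F z) ^ 2)) * (Cconj (F z) * F' z)
     + RtoC (2 * (1 - Cmod (G z) ^ 2)) * (Cconj (G z) * (psi z * F' z)))%C).
  assert (Dir : forall (gam : R -> C) (t : R) (v : C), gam t = z -> (exists e, 0 < e /\ forall s, Rabs (s - t) < e -> ball z0 r (gam s)) ->
     (forall (f : C -> C) (l : C), cder f z l -> rder (fun s => f (gam s)) t (v * l)%C) -> fst (v * X)%C = 0).
  { intros gam t v Eg [e [He Hin]] Hd.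
    destruct (H z Hz) as (DF & DG & Dp & _).
    assert (E1 := rder_Cmod_sqr _ _ _ (Hd _ _ DF)). assert (E2 := rder_Cmod_sqr _ _ _ (Hd _ _ DG)).
    assert (E3 := rder_Cmod_sqr _ _ _ (Hd _ _ Dp)). cbn beta in E1, E2, E3. rewrite Eg in E1, E2, E3.
    assert (E1' := is_derive_Rminus _ _ _ _ _ (is_derive_Rconst 1 t) E1).
    assert (E2' := is_derive_Rminus _ _ _ _ _ (is_derive_Rconst 1 t) E2).
    assert (E := is_derive_Rminus _ _ _ _ _ (is_derive_Rmult _ _ _ _ _ E3 (is_derive_Rmult _ _ _ _ _ E1' E1'))
       (is_derive_Rmult _ _ _ _ _ E2' E2')).
    cbn beta in E. rewrite Eg in E.
    assert (Z : is_derive (fun s => N (gam s)) t 0).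
    { apply (is_derive_ext_loc (fun _ => 0)); [|apply is_derive_Rconst].
      exists (mkposreal e He). intros s Hs. symmetry. apply N0, Hin, Hs. }
    apply is_derive_unique in E. apply is_derive_unique in Z. unfold N in Z. rewrite E in Z.
    unfold X. rewrite !Cmod_sqr in Z |- *. simpl in Z |- *. lra. }
  assert (HX : X = RtoC 0).
  { destruct (open_ball_sub _ _ (ball_open z0 r) Hz) as [e [He Hs]].
    assert (X1 : fst (RtoC 1 * X)%C = 0).
    { apply (Dir (fun s => (s, snd z)) (fst z)).
      - now destruct z.
      - exists e; split; auto. intros s Hs'. apply Hs, Cball_iff; simpl. rewrite Rminus_diag, Rabs_R0; auto.
      - intros f l Hl. eapply rder_eq; [apply rder_horizontal; destruct z; exact Hl|ring]. }
    assert (X2 : fst (Ci * X)%C = 0).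
    { apply (Dir (fun s => (fst z, s)) (snd z)).
      - now destruct z.
      - exists e; split; auto. intros s Hs'. apply Hs, Cball_iff; simpl. rewrite Rminus_diag, Rabs_R0; auto.
      - intros f l Hl. apply rder_vertical; destruct z; exact Hl. }
    destruct X as [x1 x2]. simpl in X1, X2. apply injective_projections; simpl; lra. }
  destruct (H z Hz) as (_ & _ & _ & P0 & B1 & B2 & E).
  assert (S1 : 0 < 1 - Cmod (F z) ^ 2) by (assert (Q := Cmod_ge_0 (F z)); nra).
  assert (S2 : 0 < 1 - Cmod (G z) ^ 2) by (assert (Q := Cmod_ge_0 (G z)); nra).
  unfold X in HX. rewrite <- E in HX |- *.
  set (s := 1 - Cmod (F z) ^ 2) in *. set (m := Cmod (psi z)) in *.
  assert (Hm : 0 < m) by (unfold m; now apply Cmod_gt_0).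
  assert (Em : (Cconj (psi z) * psi z)%C = (RtoC m * RtoC m)%C).
  { rewrite Cmult_comm, <- Cmod2_conj. fold m. rewrite <- RtoC_mult. f_equal. ring. }
  rewrite !RtoC_mult in *. rewrite ?RtoC_pow in HX.
  assert (Rs : RtoC s <> RtoC 0) by (apply RtoC_neq_0; lra).
  assert (Rm : RtoC m <> RtoC 0) by (apply RtoC_neq_0; lra).
  assert (Rc : Cconj (psi z) <> RtoC 0) by (apply Cmod_gt_0; rewrite Cmod_conj; auto).
  set (cp := Cconj (psi z)) in *. set (ps := psi z) in *. set (cF := Cconj (F z)) in *. set (cG := Cconj (G z)) in *.
  apply Cminus_0_eq.
  (* This is [X = 0] solved for [psi'], multiplied by the nonzero factors [conj psi] and [s^2], with
     [1 - |G|^2 = m s] inserted. *)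
  assert (K : (cp * (psi' z - RtoC 2 * ps * F' z * (cF / RtoC s - ps * cG / (RtoC m * RtoC s))) * (RtoC s * RtoC s))%C
     = RtoC 0).
  { transitivity (cp * psi' z * (RtoC s * RtoC s) - RtoC 2 * (cp * ps) * RtoC s * (cF * F' z)
       + RtoC 2 * ((cp * ps) / RtoC m) * RtoC s * (cG * (ps * F' z)))%C; [field; auto|].
    rewrite Em. rewrite <- HX. simpl. field. auto. }
  apply Cmult_integral in K as [K|K].
  - apply Cmult_integral in K as [K|K]; [tauto|exact K].
  - apply Cmult_integral in K; tauto.
Qed.

(** The Lipschitz estimate that feeds Gronwall's inequality: for moduli at most 1/2 the denominators
    are at least 3/4, and the crude factors [20 / 9] and [2 / 3] are both below 3. *)
Lemma gradient_difference (v w p : C) : Cmod v <= 1 / 2 -> Cmod w <= 1 / 2 ->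
  Cmod (Cconj v / RtoC (1 - Cmod v ^ 2) - p * Cconj w / RtoC (1 - Cmod w ^ 2))
    <= 3 * (Cmod (w - v) + Cmod (p - RtoC 1)).
Proof.
  intros B1 B2. assert (Q1 := Cmod_ge_0 v). assert (Q2 := Cmod_ge_0 w).
  assert (S1 : 3 / 4 <= 1 - Cmod v ^ 2) by nra. assert (S2 : 3 / 4 <= 1 - Cmod w ^ 2) by nra.
  assert (Ev : RtoC (1 - Cmod v ^ 2) = (RtoC 1 - v * Cconj v)%C) by now rewrite RtoC_minus, Cmod2_conj.
  assert (Ew : RtoC (1 - Cmod w ^ 2) = (RtoC 1 - w * Cconj w)%C) by now rewrite RtoC_minus, Cmod2_conj.
  set (s := 1 - Cmod v ^ 2) in *. set (t := 1 - Cmod w ^ 2) in *.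
  assert (Rs : RtoC s <> RtoC 0) by (apply RtoC_neq_0; lra).
  assert (Rt : RtoC t <> RtoC 0) by (apply RtoC_neq_0; lra).
  assert (I : forall k, 3 / 4 <= k -> RtoC k <> RtoC 0 -> Cmod (/ RtoC k) <= 4 / 3).
  { intros k Hk Nk. rewrite Cmod_inv, Cmod_R, Rabs_pos_eq by (auto || lra).
    replace (4 / 3) with (/ (3 / 4)) by field. apply Rinv_le_contravar; lra. }
  (* The numerator [conj v (1 - |w|^2) - conj w (1 - |v|^2)], rewritten so that the factor [v - w]
     is visible. *)
  set (X := (Cconj (v - w) + Cconj v * Cconj w * (v - w))%C).
  replace (Cconj v / RtoC s - p * Cconj w / RtoC t)%C
    with (X * (/ RtoC s * / RtoC t) - (p - RtoC 1) * (Cconj w * / RtoC t))%C.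
  2:{ replace X with (Cconj v * RtoC t - Cconj w * RtoC s)%C; [field; auto|].
      unfold X. rewrite Ev, Ew, Cminus_conj. ring. }
  set (x := Cmod (w - v)). set (y := Cmod (p - RtoC 1)).
  assert (X0 : 0 <= x) by apply Cmod_ge_0. assert (Y0 : 0 <= y) by apply Cmod_ge_0.
  assert (V1 : Cmod X <= 5 / 4 * x).
  { eapply Rle_trans; [apply Cmod_triangle|]. rewrite !Cmod_mult, !Cmod_conj, (Cmod_minus_sym v). fold x.
    assert (Cmod v * Cmod w <= 1 / 2 * (1 / 2)) by (apply Rmult_le_compat; auto). nra. }
  eapply Rle_trans; [apply Cmod_triangle_minus|]. rewrite !Cmod_mult, Cmod_conj. fold y.
  assert (U1 : Cmod (/ RtoC s) * Cmod (/ RtoC t) <= 4 / 3 * (4 / 3)) by (apply Rmult_le_compat; auto; apply Cmod_ge_0).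
  assert (U2 : Cmod w * Cmod (/ RtoC t) <= 1 / 2 * (4 / 3)) by (apply Rmult_le_compat; auto; apply Cmod_ge_0).
  assert (U3 : Cmod X * (Cmod (/ RtoC s) * Cmod (/ RtoC t)) <= 5 / 4 * x * (4 / 3 * (4 / 3))).
  { apply Rmult_le_compat; auto; [apply Cmod_ge_0|]. apply Rmult_le_pos; apply Cmod_ge_0. }
  assert (U4 := Rmult_le_compat_l _ _ _ Y0 U2). lra.
Qed.

(** Along segments from [z0], the pair [(G - F, psi - 1)] starts at 0 by the normalisations and
    satisfies a linear differential inequality. *)
Lemma isometry_rigidity (F G : C -> C) (z0 : C) (r : R) : 0 < r ->
  holo (ball z0 r) F -> holo (ball z0 r) G ->
  (forall w, ball z0 r w -> C_derive F w <> RtoC 0 /\ Cmod (F w) < 1 /\ Cmod (G w) < 1 /\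
     Cmod (C_derive F w) * (1 - Cmod (G w) ^ 2) = Cmod (C_derive G w) * (1 - Cmod (F w) ^ 2)) ->
  F z0 = RtoC 0 -> G z0 = RtoC 0 -> C_derive F z0 = C_derive G z0 ->
  exists rho, 0 < rho /\ forall w, ball z0 rho w -> F w = G w.
Proof.
  intros Hr HF HG H F0 G0 E0.
  assert (Hz0 : ball z0 r z0) by now apply ball_self.
  assert (DF : forall w, ball z0 r w -> cder F w (C_derive F w)).
  { intros w Hw. destruct (HF w Hw). eapply C_derive_cder; eauto. }
  assert (DG : forall w, ball z0 r w -> cder G w (C_derive G w)).
  { intros w Hw. destruct (HG w Hw). eapply C_derive_cder; eauto. }
  set (psi := fun w => (C_derive G w / C_derive F w)%C).
  assert (Dpsi : forall w, ball z0 r w -> cder psi w (C_derive psi w)).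
  { intros w Hw. destruct (holo_C_derive _ F (ball_open z0 r) HF w Hw) as [l Hl].
    destruct (holo_C_derive _ G (ball_open z0 r) HG w Hw) as [m Hm].
    eapply C_derive_cder. apply cder_div; eauto. now apply H. }
  assert (Hall : forall w, ball z0 r w -> cder F w (C_derive F w) /\ cder G w (psi w * C_derive F w)%C /\
     cder psi w (C_derive psi w) /\ psi w <> RtoC 0 /\ Cmod (F w) < 1 /\ Cmod (G w) < 1 /\
     Cmod (psi w) * (1 - Cmod (F w) ^ 2) = 1 - Cmod (G w) ^ 2).
  { intros w Hw. destruct (H w Hw) as (N & B1 & B2 & E).
    assert (PN := proj1 (Cmod_gt_0 _) N).
    assert (S2 : 0 < 1 - Cmod (G w) ^ 2) by (assert (Q := Cmod_ge_0 (G w)); nra).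
    assert (Em : Cmod (psi w) * (1 - Cmod (F w) ^ 2) = 1 - Cmod (G w) ^ 2).
    { unfold psi. rewrite Cmod_div by auto.
      replace (Cmod (C_derive G w) / Cmod (C_derive F w) * (1 - Cmod (F w) ^ 2))
        with ((Cmod (C_derive G w) * (1 - Cmod (F w) ^ 2)) / Cmod (C_derive F w)) by (field; lra).
      rewrite <- E. field. lra. }
    split; auto. split; [|split; [|split; [|split; [|split]]]]; auto.
    - eapply cder_eq; [now apply DG|]. unfold psi. field; auto.
    - intro Q. rewrite Q, Cmod_0 in Em. lra. }
  assert (P1 : psi z0 = RtoC 1).
  { unfold psi. rewrite <- E0. field. now apply H. }
  assert (CF : Ccont F z0) by (eapply cder_cont, DF; auto).
  assert (CG : Ccont G z0) by (eapply cder_cont, DG; auto).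
  assert (CP : Ccont psi z0) by (eapply cder_cont, Dpsi; auto).
  assert (CF' : Ccont (C_derive F) z0).
  { destruct (holo_C_derive _ F (ball_open z0 r) HF z0 Hz0). eapply cder_cont; eauto. }
  destruct (continuous_C_eps _ _ CF (1 / 2) ltac:(lra)) as [r1 [R1 K1]].
  destruct (continuous_C_eps _ _ CG (1 / 2) ltac:(lra)) as [r2 [R2 K2]].
  destruct (continuous_C_eps _ _ CP 1 ltac:(lra)) as [r3 [R3 K3]].
  destruct (local_bound _ _ CF') as [r4 [R4 K4]].
  set (K := Cmod (C_derive F z0) + 1) in *.
  assert (HK : 0 < K) by (unfold K; assert (Q := Cmod_ge_0 (C_derive F z0)); lra).
  set (rho := Rmin r (Rmin r1 (Rmin r2 (Rmin r3 r4)))).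
  assert (Hrho : 0 < rho) by (repeat apply Rmin_glb_lt; auto).
  assert (Bd : forall w, ball z0 rho w -> ball z0 r w /\ Cmod (F w) <= 1 / 2 /\ Cmod (G w) <= 1 / 2 /\
     Cmod (psi w) <= 2 /\ Cmod (C_derive F w) <= K).
  { intros w Hw. apply ball_Rmin in Hw as [W0 Hw]. apply ball_Rmin in Hw as [W1 Hw].
    apply ball_Rmin in Hw as [W2 Hw]. apply ball_Rmin in Hw as [W3 W4].
    specialize (K1 w W1). specialize (K2 w W2). specialize (K3 w W3). specialize (K4 w W4).
    assert (T1 := Cmod_sub_lower (F w) (F z0)). assert (T2 := Cmod_sub_lower (G w) (G z0)).
    assert (T3 := Cmod_sub_lower (psi w) (psi z0)).
    rewrite P1 in T3, K3. rewrite Cmod_1 in T3. rewrite F0 in T1, K1. rewrite G0 in T2, K2.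
    rewrite Cmod_0 in T1, T2. repeat (split; [solve [auto | lra]|]). lra. }
  (* The factor 12 K is [2 * 2 * K * 3], from [|psi| <= 2], [|F'| <= K] and
     [gradient_difference]. *)
  assert (Bpsi : forall w, ball z0 rho w ->
    Cmod (C_derive psi w) <= 12 * K * (Cmod (G w - F w) + Cmod (psi w - RtoC 1))).
  { intros w Hw. destruct (Bd w Hw) as (W & B1 & B2 & B3 & B4).
    rewrite (isometry_second_derivative F (C_derive F) G psi (C_derive psi) z0 r w Hall W).
    rewrite !Cmod_mult, Cmod_R, Rabs_pos_eq by lra.
    assert (V1 := gradient_difference (F w) (G w) (psi w) B1 B2).
    assert (V2 : Cmod (psi w) * Cmod (C_derive F w) <= 2 * K) by (apply Rmult_le_compat; auto; apply Cmod_ge_0).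
    eapply Rle_trans.
    - apply (Rmult_le_compat (2 * Cmod (psi w) * Cmod (C_derive F w)) (4 * K)); [| |lra|exact V1].
      + repeat apply Rmult_le_pos; try apply Cmod_ge_0; lra.
      + apply Cmod_ge_0.
    - lra. }
  exists rho; split; auto. intros w Hw.
  assert (Hc : ball z0 rho z0) by now apply ball_self.
  set (x := fun t => (G (segment z0 w t) - F (segment z0 w t))%C).
  set (y := fun t => (psi (segment z0 w t) - RtoC 1)%C).
  set (x' := fun t => ((psi (segment z0 w t) - RtoC 1) * C_derive F (segment z0 w t) * (w - z0))%C).
  set (y' := fun t => (C_derive psi (segment z0 w t) * (w - z0))%C).
  assert (Hx : forall t, 0 <= t <= 1 -> rder x t (x' t)).
  { intros t Ht. assert (B := ball_convex z0 rho z0 w t Hc Hw Ht). destruct (Bd _ B) as (B' & _).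
    destruct (Hall _ B') as (D1 & D2 & _). unfold x, x'. eapply rder_eq.
    - apply rder_minus; apply rder_segment_cder; [exact D2|exact D1].
    - ring. }
  assert (Hy : forall t, 0 <= t <= 1 -> rder y t (y' t)).
  { intros t Ht. assert (B := ball_convex z0 rho z0 w t Hc Hw Ht). destruct (Bd _ B) as (B' & _).
    destruct (Hall _ B') as (_ & _ & D1 & _). unfold y, y'. eapply rder_eq.
    - apply rder_minus; [apply rder_segment_cder; exact D1|apply rder_const].
    - ring. }
  assert (Gr : Cmod (x 1) ^ 2 + Cmod (y 1) ^ 2 <= 0).
  (* With moduli [X], [Y] and [d = |w - z0|] the derivative is at most [K d (26 X Y + 24 Y^2)],
     hence at most [37 K d (X^2 + Y^2)]; 40 is a round bound. *)
  { apply (gronwall (fun t => Cmod (x t) ^ 2 + Cmod (y t) ^ 2)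
      (fun t => 2 * (fst (x t) * fst (x' t) + snd (x t) * snd (x' t)) + 2 * (fst (y t) * fst (y' t) + snd (y t) * snd (y' t)))
      (40 * K * Cmod (w - z0))).
    - intros t Ht. apply (@is_derive_plus R_AbsRing R_NormedModule); apply rder_Cmod_sqr; auto.
    - intros t Ht. assert (B := ball_convex z0 rho z0 w t Hc Hw Ht).
      destruct (Bd _ B) as (B' & _ & _ & _ & BK). assert (BP := Bpsi _ B).
      assert (D1 := dot_le (x t) (x' t)). assert (D2 := dot_le (y t) (y' t)).
      set (d := Cmod (w - z0)). assert (Hd : 0 <= d) by apply Cmod_ge_0.
      assert (Px := Cmod_ge_0 (x t)). assert (Py := Cmod_ge_0 (y t)).
      assert (L1 : Cmod (x' t) <= K * d * Cmod (y t)).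
      { unfold x'. rewrite !Cmod_mult. fold (y t) d.
        assert (Cmod (y t) * Cmod (C_derive F (segment z0 w t)) * d <= Cmod (y t) * K * d).
        { apply Rmult_le_compat_r; auto. apply Rmult_le_compat_l; auto. }
        lra. }
      assert (L2 : Cmod (y' t) <= 12 * K * d * (Cmod (x t) + Cmod (y t))).
      { unfold y'. rewrite !Cmod_mult. fold d. fold (x t) (y t) in BP.
        assert (Q := Rmult_le_compat_r d _ _ Hd BP). lra. }
      set (X := Cmod (x t)) in *. set (Y := Cmod (y t)) in *.
      assert (KD : 0 <= K * d) by (apply Rmult_le_pos; lra).
      assert (M1 := Rmult_le_compat_l X _ _ Px L1). assert (M2 := Rmult_le_compat_l Y _ _ Py L2).
      assert (Am : 2 * (X * Y) <= X ^ 2 + Y ^ 2) by (assert (0 <= (X - Y) ^ 2) by apply pow2_ge_0; nra).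
      assert (Y2 : 0 <= Y ^ 2) by apply pow2_ge_0. assert (X2 : 0 <= X ^ 2) by apply pow2_ge_0.
      assert (M3 := Rmult_le_compat_l (K * d) _ _ KD Am).
      assert (M4 := Rmult_le_pos _ _ KD X2). assert (M5 := Rmult_le_pos _ _ KD Y2).
      replace (X ^ 2) with (X * X) in * by ring. replace (Y ^ 2) with (Y * Y) in * by ring. lra.
    - unfold x, y. rewrite segment_0, F0, G0, P1.
      replace (RtoC 0 - RtoC 0)%C with (RtoC 0) by ring. replace (RtoC 1 - RtoC 1)%C with (RtoC 0) by ring.
      rewrite Cmod_0. ring. }
  assert (X1 : Cmod (x 1) ^ 2 <= 0) by (assert (0 <= Cmod (y 1) ^ 2) by apply pow2_ge_0; lra).
  apply Cmod_sqr_le_0 in X1. unfold x in X1. rewrite segment_1 in X1. symmetry. now apply Cminus_0_eq.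
Qed.

(** Frees the representation from the logarithm and from [q]: away from the zeros of [h], the
    hyperbolic density pulled back by [f] depends on [u] and [h] only, hence is the same for all
    representing functions. *)
Lemma representation_density (X : C -> Prop) (h f q : C -> C) (u : C -> R) (z : C) :
  maps_to f X unit_disk -> liouville_representation X h u f q -> X z -> h z <> RtoC 0 ->
  C_derive f z <> RtoC 0 /\
  Cmod (C_derive f z) = exp (u z) * Cmod (h z) * (1 - Cmod (f z) ^ 2).
Proof.
  intros Hm (_ & H1 & H2) Hz Hh. destruct (H2 z Hz) as [Q0 E]. specialize (H1 z Hz Hh).
  assert (Dq : C_derive f z = (q z * h z)%C) by (rewrite H1; field; auto).
  split.
  - rewrite Dq. intro N. apply Cmult_integral in N. tauto.
  - rewrite Dq, Cmod_mult. specialize (Hm z Hz). unfold unit_disk in Hm.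
    assert (P := Cmod_ge_0 (f z)). assert (S1 : 0 < 1 - Cmod (f z) ^ 2) by nra.
    rewrite E, exp_ln; [field; lra|]. apply Rdiv_lt_0_compat; auto. now apply Cmod_gt_0.
Qed.

Theorem representation_unique (Omega : C -> Prop) (h : C -> C) (u : C -> R) (f g q p : C -> C) :
  Defs.domain Omega -> holomorphic_on Omega h -> (exists z, Omega z /\ h z <> RtoC 0) ->
  holomorphic_on Omega f -> maps_to f Omega unit_disk -> liouville_representation Omega h u f q ->
  holomorphic_on Omega g -> maps_to g Omega unit_disk -> liouville_representation Omega h u g p ->
  exists T : C -> C, disk_automorphism T /\ forall z, Omega z -> g z = T (f z).
Proof.
  intros (_ & HOo & Hconn) Hh (z0 & Hz0 & Hn0) Hf Mf Rf Hg Mg Rg.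
  assert (Ch : Ccont h z0) by (destruct (Hh z0 Hz0); eapply cder_cont; eauto).
  destruct (continuous_C_eps _ _ Ch (Cmod (h z0)) (proj1 (Cmod_gt_0 _) Hn0)) as [r1 [Hr1 K1]].
  destruct (open_ball_sub _ _ HOo Hz0) as [r2 [Hr2 K2]].
  set (r := Rmin r1 r2). assert (Hr : 0 < r) by now apply Rmin_glb_lt.
  assert (Hin : forall w, ball z0 r w -> Omega w /\ h w <> RtoC 0).
  { intros w Hw. apply ball_Rmin in Hw as [W1 W2]. split; auto. intro N. specialize (K1 w W1).
    rewrite N in K1. replace (RtoC 0 - h z0)%C with (- h z0)%C in K1 by ring. rewrite Cmod_opp in K1. lra. }
  assert (Hc : ball z0 r z0) by now apply ball_self.
  set (a := f z0). set (b := g z0).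
  assert (Ha : Cmod a < 1) by (apply Mf, Hz0). assert (Hb : Cmod b < 1) by (apply Mg, Hz0).
  set (F := fun w => mobius a (f w)). set (G1 := fun w => mobius b (g w)).
  assert (DF : forall w, Omega w -> cder F w (mobius' a (f w) * C_derive f w)%C).
  { intros w Hw. apply (cder_comp (mobius a) f); [apply mobius_cder; auto; apply Mf, Hw|].
    destruct (Hf w Hw). eapply C_derive_cder; eauto. }
  assert (DG1 : forall w, Omega w -> cder G1 w (mobius' b (g w) * C_derive g w)%C).
  { intros w Hw. apply (cder_comp (mobius b) g); [apply mobius_cder; auto; apply Mg, Hw|].
    destruct (Hg w Hw). eapply C_derive_cder; eauto. }
  assert (EF : forall w, Omega w -> C_derive F w = (mobius' a (f w) * C_derive f w)%C).
  { intros w Hw. apply is_C_derive_unique, DF, Hw. }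
  assert (EG : forall w, Omega w -> C_derive G1 w = (mobius' b (g w) * C_derive g w)%C).
  { intros w Hw. apply is_C_derive_unique, DG1, Hw. }
  assert (NF : forall w, ball z0 r w -> C_derive F w <> RtoC 0).
  { intros w Hw. destruct (Hin w Hw) as [Ow Nw]. rewrite EF by auto. intro N. apply Cmult_integral in N as [N|N].
    - revert N. apply mobius'_neq; auto. apply Mf, Ow.
    - revert N. apply (representation_density Omega h f q u w); auto. }
  assert (NG : forall w, ball z0 r w -> C_derive G1 w <> RtoC 0).
  { intros w Hw. destruct (Hin w Hw) as [Ow Nw]. rewrite EG by auto. intro N. apply Cmult_integral in N as [N|N].
    - revert N. apply mobius'_neq; auto. apply Mg, Ow.
    - revert N. apply (representation_density Omega h g p u w); auto. }
  assert (Dens : forall w, ball z0 r w ->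
     Cmod (C_derive F w) * (1 - Cmod (G1 w) ^ 2) = Cmod (C_derive G1 w) * (1 - Cmod (F w) ^ 2)).
  { intros w Hw. destruct (Hin w Hw) as [Ow Nw]. rewrite EF, EG, !Cmod_mult by auto.
    unfold F, G1. rewrite <- !mobius_density by (auto; [apply Mf, Ow || apply Mg, Ow ..]).
    rewrite (proj2 (representation_density Omega h f q u w Mf Rf Ow Nw)).
    rewrite (proj2 (representation_density Omega h g p u w Mg Rg Ow Nw)). ring. }
  assert (F0 : F z0 = RtoC 0) by apply mobius_zero. assert (G0 : G1 z0 = RtoC 0) by apply mobius_zero.
  (* Both functions vanish at [z0], so equality of the densities gives derivatives of equal modulus
     there; rotating by [l] makes the derivatives equal. *)
  set (l := (C_derive F z0 / C_derive G1 z0)%C).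
  assert (N0 := NG z0 Hc).
  assert (Hl : Cmod l = 1).
  { unfold l. rewrite Cmod_div by auto. assert (D := Dens z0 Hc). rewrite F0, G0, Cmod_0 in D.
    assert (P := proj1 (Cmod_gt_0 _) N0). replace (Cmod (C_derive F z0)) with (Cmod (C_derive G1 z0)) by lra. field. lra. }
  assert (L0 : l <> RtoC 0) by (apply Cmod_gt_0; lra).
  set (G := fun w => (l * G1 w)%C).
  assert (DG : forall w, Omega w -> cder G w (l * C_derive G1 w)%C).
  { intros w Hw. apply cder_scal. rewrite EG by auto. now apply DG1. }
  assert (EG2 : forall w, Omega w -> C_derive G w = (l * C_derive G1 w)%C).
  { intros w Hw. apply is_C_derive_unique, DG, Hw. }
  assert (MG : forall w, Cmod (G w) = Cmod (G1 w)).
  { intro w. unfold G. rewrite Cmod_mult, Hl. ring. }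
  destruct (isometry_rigidity F G z0 r Hr) as [rho [Hrho E]]; auto.
  - intros w Hw. eexists. apply DF, Hin, Hw.
  - intros w Hw. eexists. apply DG, Hin, Hw.
  - intros w Hw. destruct (Hin w Hw) as [Ow Nw]. split; [now apply NF|]. split; [apply mobius_disk; auto; apply Mf, Ow|].
    rewrite MG. split; [apply mobius_disk; auto; apply Mg, Ow|].
    rewrite EG2, Cmod_mult, Hl, Rmult_1_l by auto. now apply Dens.
  - unfold G. rewrite G0. ring.
  - rewrite EG2 by auto. unfold l. field; auto.
  (* Obtained by solving [l * mobius b (g z) = mobius a (f z)] for [g z]. *)
  - set (T := fun w => mobius (- b) (/ l * mobius a w)%C).
    assert (AT : disk_automorphism T).
    { apply (automorphism_comp (mobius (- b)) (fun w => (/ l * mobius a w)%C)).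
      - apply mobius_automorphism. now rewrite Cmod_opp.
      - apply (automorphism_comp (fun w => (/ l * w)%C) (mobius a)).
        + apply rotation_automorphism. rewrite Cmod_inv, Hl by auto. field.
        + now apply mobius_automorphism. }
    exists T. split; auto. intros z Hz. apply Cminus_0_eq.
    apply (identity_theorem Omega (fun w => g w - T (f w))%C z0 (Rmin r rho)); auto.
    + intros w Hw. destruct (Hg w Hw) as [m1 M1]. destruct (Hf w Hw) as [m2 M2].
      destruct AT as [T1 _]. destruct (T1 (f w) (Mf w Hw)) as [m3 M3].
      eexists. apply cder_minus; [exact M1|]. apply (cder_comp T f); [exact M3|exact M2].
    + now apply Rmin_glb_lt.
    + intros w Hw. apply ball_Rmin in Hw as [W1 W2]. destruct (Hin w W1) as [Ow _].
      assert (Ew := E w W2). unfold T. change (mobius a (f w)) with (F w). rewrite Ew.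
      unfold G. replace (/ l * (l * G1 w))%C with (G1 w) by (field; auto).
      unfold G1. rewrite mobius_inverse; auto; [ring|]. apply Mg, Ow.
Qed.

Theorem theorem3p5 (Omega : C -> Prop) (h : C -> C) (u : C -> R)
  (HOmega : simply_connected_domain Omega)
  (Hh : holomorphic_on Omega h)
  (Hh0 : exists z, Omega z /\ h z <> RtoC 0)
  (Hu : C2_on Omega u)
  (Hpde : forall z, Omega z ->
     laplacian u z = 4 * Cmod (h z) ^ 2 * exp (2 * u z)) :
  (exists f q : C -> C,
     holomorphic_on Omega f /\ maps_to f Omega unit_disk /\
     holomorphic_on Omega q /\ liouville_representation Omega h u f q) /\
  (forall f g q p : C -> C,
     holomorphic_on Omega f -> maps_to f Omega unit_disk ->
     liouville_representation Omega h u f q ->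
     holomorphic_on Omega g -> maps_to g Omega unit_disk ->
     liouville_representation Omega h u g p ->
     exists T : C -> C,
       disk_automorphism T /\ forall z, Omega z -> g z = T (f z)).
Proof.
  split.
  - now apply representation_exists.
  - intros f g q p Hf Mf Rf Hg Mg Rg.
    apply (representation_unique Omega h u f g q p); auto. apply HOmega.
Qed.
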